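(* There is an FPTAS for budget-restrained makespan minimization (given a budget $b$, minimize the makespan among valid schedules with cost at most $b$) in Server Cloud Scheduling on extended chain task graphs, provided that for every parallel subgraph $\mathcal{J}_e$ inserted in place of a chain edge $e=(j-1,j)$ at least one of the following holds: (1) $\min_{j'\in\mathcal{J}_e}\min\{p_s(j'),p_c(j')\}\ge\max_{j'\in\mathcal{J}_e}\max\{c(j-1,j'),c(j',j)\}$; (2) $c(j-1,j')\le c_{\max}$ and $c(j',j)\le c_{\max}$ for all $j'\in\mathcal{J}_e$, where $c_{\max}$ is a fixed constant; (3) $c(j-1,j')=c(j-1,j'')$ for all $j',j''\in\mathcal{J}_e$.
   Context: Server Cloud Scheduling: the input is a directed acyclic task graph $G=(\mathcal{J},E)$ with exactly one source $s$ and one sink $t$; each job $j\in\mathcal{J}$ has a server processing time $p_s(j)\in\mathbb{N}_0$ and a cloud processing time $p_c(j)\in\mathbb{N}_0$, where $p_s(s)=p_s(t)=0$ and $p_c(s)=p_c(t)=\infty$; each edge $(i,j)\in E$ has a communication delay $c(i,j)\in\mathbb{N}_0$. There is one server machine (processing at most one job at a time) and unboundedly many cloud machines. A schedule is a partition $\mathcal{J}=\mathcal{J}_s\cup\mathcal{J}_c$ together with completion times $C:\mathcal{J}\to\mathbb{N}_0$; let $p_\pi(j)=p_s(j)$ if $j\in\mathcal{J}_s$ and $p_\pi(j)=p_c(j)$ if $j\in\mathcal{J}_c$. It is valid if (a) for distinct $i,j\in\mathcal{J}_s$: $C(i)\le C(j)-p_\pi(j)$ or $C(i)-p_\pi(i)\ge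 C(j)$; (b) for every edge $(i,j)$ with $i,j$ on the same side: $C(i)\le C(j)-p_\pi(j)$, and for every edge with $i,j$ on different sides: $C(i)+c(i,j)\le C(j)-p_\pi(j)$. The makespan is $C(t)$ and the cost is $\sum_{j\in\mathcal{J}_c}p_c(j)$. Extended chain: start from a chain $s=0\to1\to\dots\to n\to n+1=t$; for any subset of the chain edges $e=(j-1,j)$, remove the edge, add a set $\mathcal{J}_e$ of new jobs (the parallel subgraph of $e$), and for each $j'\in\mathcal{J}_e$ add edges $(j-1,j')$ and $(j',j)$. *)

(* Defs.v *)
From HB Require Import structures.
From mathcomp Require Import all_boot.
Set Implicit Arguments. Unset Strict Implicit. Unset Printing Implicit Defensive.

(* 1. Model of computation: logarithmic-cost RAM (Cook-Reckhow style).      *)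

Definition bits (v : nat) : nat := (trunc_log 2 v).+1.

Inductive instr :=
| IConst of nat & nat
| IAdd   of nat & nat & nat
| ISub   of nat & nat & nat
| ILoad  of nat & nat
| IStore of nat & nat
| IJz    of nat & nat
| IHalt.

Definition program := seq instr.

Record rstate := RState { pc : nat; regs : nat -> nat; rcost : nat }.

Definition upd (R : nat -> nat) (r v : nat) : nat -> nat :=
  fun x => if x == r then v else R x.

Definition step (P : program) (s : rstate) : rstate :=
  let R := regs s in
  let k := pc s in
  let c := rcost s in
  match nth IHalt P k with
  | IConst r v => RState k.+1 (upd R r v) (c + 1 + bits r + bits v)
  | IAdd r a b => RState k.+1 (upd R r (R a + R b))
                        (c + 1 + bits r + bits a + bits b + bits (R a) + bits (R b))
  | ISub r a b => RState k.+1 (upd R r (R a - R b))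
                        (c + 1 + bits r + bits a + bits b + bits (R a) + bits (R b))
  | ILoad r a => RState k.+1 (upd R r (R (R a)))
                        (c + 1 + bits r + bits a + bits (R a) + bits (R (R a)))
  | IStore a t => RState k.+1 (upd R (R a) (R t))
                        (c + 1 + bits a + bits t + bits (R a) + bits (R t))
  | IJz a l => RState (if R a == 0 then l else k.+1) R (c + 1 + bits a + bits (R a))
  | IHalt => s
  end.

(* a state is halted when the current instruction is IHalt (or pc is out of range) *)
Definition halted (P : program) (s : rstate) : bool :=
  if nth IHalt P (pc s) is IHalt then true else false.

Definition init_state (x : seq nat) : rstate :=
  RState 0 (fun i => if i == 0 then size x else nth 0 x i.-1) 0.

Definition output (R : nat -> nat) : seq nat := [seq R i | i <- iota 1 (R 0)].

Definition computes_within (P : program) (x : seq nat) (T : nat) (y : seq nat) : Prop :=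
  exists n, let s := iter n (step P) (init_state x) in
            [/\ halted P s, rcost s <= T & output (regs s) = y].

Definition input_size (x : seq nat) : nat := \sum_(v <- x) bits v.

(* data of a job of a parallel subgraph: (p_s, p_c, c(j-1,j'), c(j',j)) *)
Record pjob := PJob { pj_ps : nat; pj_pc : nat; pj_cin : nat; pj_cout : nat }.

Definition pjob_code (p : pjob) : nat * nat * nat * nat :=
  (pj_ps p, pj_pc p, pj_cin p, pj_cout p).
Definition pjob_decode (q : nat * nat * nat * nat) : pjob :=
  let: (a, b, c, d) := q in PJob a b c d.
Lemma pjob_codeK : cancel pjob_code pjob_decode. Proof. by case. Qed.
HB.instance Definition _ := Countable.copy pjob (can_type pjob_codeK).

(* chain edge e = (j-1, j): either kept (with its communication delay) or
   replaced by a (nonempty) parallel subgraph J_e *)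
Inductive chain_edge :=
| Kept of nat
| Replaced of seq pjob.

(* chain jobs 1..n with (p_s, p_c) given by ch (n = size ch); chain edge
   (j-1, j), j = 1..n+1, is the element of index j-1 of ed *)
Record ec_instance := ECInst { ch : seq (nat * nat); ed : seq chain_edge }.

Definition ec_n (I : ec_instance) : nat := size (ch I).

Definition edge_of (I : ec_instance) (j : nat) : chain_edge := nth (Kept 0) (ed I) j.-1.

Definition ec_wf (I : ec_instance) : Prop :=
  size (ed I) = (ec_n I).+1 /\
  forall j, 1 <= j <= (ec_n I).+1 -> edge_of I j <> Replaced [::].

(* jobs: CJ k is chain job k (0 = s, n+1 = t); PJ j i is the i-th job of the
   parallel subgraph replacing chain edge (j-1, j) *)
Inductive job := CJ of nat | PJ of nat & nat.

Definition job_code (x : job) : nat * nat :=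
  match x with CJ k => (0, k) | PJ j i => (j.+1, i) end.
Definition job_decode (p : nat * nat) : job :=
  match p with (0, k) => CJ k | (j.+1, i) => PJ j i end.
Lemma job_codeK : cancel job_code job_decode. Proof. by case. Qed.
HB.instance Definition _ := Countable.copy job (can_type job_codeK).

Definition src : job := CJ 0.
Definition snk (I : ec_instance) : job := CJ (ec_n I).+1.

Definition sub_jobs (I : ec_instance) (j : nat) : seq job :=
  if edge_of I j is Replaced l then [seq PJ j i | i <- iota 0 (size l)] else [::].

Definition jobs (I : ec_instance) : seq job :=
  [seq CJ k | k <- iota 0 (ec_n I).+2] ++
  flatten [seq sub_jobs I j | j <- iota 1 (ec_n I).+1].

Definition pjob_of (I : ec_instance) (j i : nat) : pjob :=
  if edge_of I j is Replaced l then nth (PJob 0 0 0 0) l i else PJob 0 0 0 0.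

(* server processing time (p_s(s) = p_s(t) = 0) *)
Definition ps_of (I : ec_instance) (x : job) : nat :=
  match x with
  | CJ k => if (1 <= k <= ec_n I) then (nth (0, 0) (ch I) k.-1).1 else 0
  | PJ j i => pj_ps (pjob_of I j i)
  end.

(* cloud processing time; for s and t it is infinite, which is modelled by
   forbidding s and t on the cloud (see [valid]) *)
Definition pc_of (I : ec_instance) (x : job) : nat :=
  match x with
  | CJ k => (nth (0, 0) (ch I) k.-1).2
  | PJ j i => pj_pc (pjob_of I j i)
  end.

Definition sub_edges (I : ec_instance) (j : nat) : seq (job * job * nat) :=
  match edge_of I j with
  | Kept c => [:: (CJ j.-1, CJ j, c)]
  | Replaced l =>
      flatten [seq [:: (CJ j.-1, PJ j i, pj_cin (nth (PJob 0 0 0 0) l i));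
                       (PJ j i, CJ j, pj_cout (nth (PJob 0 0 0 0) l i))]
              | i <- iota 0 (size l)]
  end.

Definition edges (I : ec_instance) : seq (job * job * nat) :=
  flatten [seq sub_edges I j | j <- iota 1 (ec_n I).+1].

(* A schedule: side x = true iff x is in J_c (cloud); completion times C. *)
Definition ptime (I : ec_instance) (side : job -> bool) (x : job) : nat :=
  if side x then pc_of I x else ps_of I x.

(* validity; "C i <= C j - p j" is written "C i + p j <= C j" (integer reading) *)
Definition valid (I : ec_instance) (side : job -> bool) (C : job -> nat) : Prop :=
  [/\ ~~ side src, ~~ side (snk I),
      (forall x y, x \in jobs I -> y \in jobs I -> x != y -> ~~ side x -> ~~ side y ->
         C x + ptime I side y <= C y \/ C y + ptime I side x <= C x) &
      (forall x y c, (x, y, c) \in edges I ->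
         if side x == side y then C x + ptime I side y <= C y
         else C x + c + ptime I side y <= C y)].

Definition cost (I : ec_instance) (side : job -> bool) : nat :=
  \sum_(x <- jobs I | side x) pc_of I x.

Definition makespan (I : ec_instance) (C : job -> nat) : nat := C (snk I).

Definition cond1 (l : seq pjob) : Prop :=
  forall x y, x \in l -> y \in l ->
    maxn (pj_cin y) (pj_cout y) <= minn (pj_ps x) (pj_pc x).
Definition cond2 (cmax : nat) (l : seq pjob) : Prop :=
  forall x, x \in l -> pj_cin x <= cmax /\ pj_cout x <= cmax.
Definition cond3 (l : seq pjob) : Prop :=
  forall x y, x \in l -> y \in l -> pj_cin x = pj_cin y.

Definition ec_conditions (cmax : nat) (I : ec_instance) : Prop :=
  forall j l, 1 <= j <= (ec_n I).+1 -> edge_of I j = Replaced l ->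
    cond1 l \/ cond2 cmax l \/ cond3 l.

Definition enc_pjob (p : pjob) : seq nat := [:: pj_ps p; pj_pc p; pj_cin p; pj_cout p].

Definition enc_edge (e : chain_edge) : seq nat :=
  match e with
  | Kept c => [:: 0; c]
  | Replaced l => 1 :: size l :: flatten (map enc_pjob l)
  end.

Definition enc_instance (I : ec_instance) : seq nat :=
  ec_n I :: flatten [seq [:: p.1; p.2] | p <- ch I] ++ flatten (map enc_edge (ed I)).

(* input of the approximation algorithm: accuracy parameter k (epsilon = 1/k),
   budget b, instance I *)
Definition enc_input (I : ec_instance) (b k : nat) : seq nat := k :: b :: enc_instance I.

Definition enc_schedule (I : ec_instance) (side : job -> bool) (C : job -> nat) : seq nat :=
  flatten [seq [:: nat_of_bool (side x); C x] | x <- jobs I].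

(* Main.v *)
Require Import Defs.
From HB Require Import structures.
From mathcomp Require Import all_boot.
From mathcomp Require Import zify ring.
Set Implicit Arguments. Unset Strict Implicit. Unset Printing Implicit Defensive.

(* Measure time in units of U: round every duration p up to ceil(p/U), solve the
   rounded instance exactly, and scale its completion times by U; the result is
   valid for the original instance.  Conversely, for a schedule C with makespan T
   and J jobs, C' x = floor(C x / U) + 2 rank(x), where the rank is taken in a
   linear order compatible with C, satisfies all rounded constraints.  If
   2JkU <= T < 4JkU the loss 2JU is at most T/k, and the rounded makespan is at most
   6Jk; a power of two below the sum of the input is such a U, unless T < 4Jk, when
   U = 1 loses nothing.  So time can be enumerated up to 6k times the input length.

   In the rounded instance a dynamic program runs along the chain on the pairs
   (side of the chain job, completion time), keeping the cheapest solution.  Between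
   two consecutive chain jobs with fixed sides and span, a server job of the parallel
   subgraph has a release time and a deadline.  Each of (1), (2), (3) makes it possible
   to cut the span into c_max + 2 intervals such that every server job runs inside one
   of them and is released when it begins: for (3) all releases agree; for (1) no
   server job other than the first to finish starts before all are released; for (2) the
   releases are at most c_max, and cutting at the completion of the jobs started before
   time 1, 2, ..., c_max separates the early starts.  Inside an interval the jobs can be
   packed without gaps by nondecreasing deadline, so a second dynamic program over the
   jobs in that order needs only the current front of each interval.

   The algorithm is a function built from pairs, addition, truncated subtraction, tests
   and folds over lists.  Such functions are compiled to the RAM, with values stored as
   binary trees in a heap that is only appended to; the running time is polynomial when
   the number of tree nodes stays polynomially bounded. *)

(** * Structured commands on the RAM *)

(** The factor 2 in front of the rank is due to edges between different sides: the delay and the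
    duration of the target are rounded up separately, each by at most one unit, so one position in
    the linear order has to pay for two units. Costs are never rounded, so the budget is met
    exactly; this is why the tables keep a cheapest solution per key. Units are powers of two
    because only logarithmically many have to be tried and doubling yields them without division;
    the factor two between neighbouring units is the gap between 2Jk and 4Jk. No optimum exceeds the
    sum of the input, since running all jobs one after the other on the server costs nothing and
    ends by then. The fronts of the intervals form the key of the inner dynamic program, so its
    table is polynomial only because the number of intervals is fixed by [c_max]. The RAM charges
    for word lengths, but a step adds at most one bit to the longest word; hence it is enough to
    count steps, and inside the compiled language to count evaluation units and tree nodes. *)

Definition literals (i : instr) : seq nat :=
  match i with
  | IConst r v => [:: r; v]
  | IAdd r a b | ISub r a b => [:: r; a; b]
  | ILoad r a => [:: r; a]
  | IStore a t => [:: a; t]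
  | IJz a l => [:: a]
  | IHalt => [::]
  end.

Lemma bits_le v w : v < 2 ^ w -> 0 < w -> bits v <= w.
Proof.
move=> hv hw; rewrite /bits; case: (posnP v) => [->|v0]; first by rewrite trunc_log0.
by rewrite -(ltn_exp2l _ _ (isT : 1 < 2)); apply: leq_ltn_trans hv; apply: trunc_logP.
Qed.

Section CostBound.
Variables (P : program) (w : nat).
Hypothesis w_gt0 : 0 < w.
Hypothesis P_lits : forall i x, x \in literals (nth IHalt P i) -> x < 2 ^ w.

(* A step lengthens the longest register by at most one bit, so m steps cost
   O(m (w + m)). *)
Lemma step_bound s u : w <= u -> (forall i, regs s i < 2 ^ u) ->
  (forall i, regs (step P s) i < 2 ^ u.+1) /\
  rcost (step P s) <= rcost s + (1 + 5 * u).
Proof.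
move=> wu hs.
have hS i : regs s i < 2 ^ u.+1 by apply: leq_trans (hs i) _; rewrite leq_exp2l.
have u0 : 0 < u by apply: leq_trans wu.
have hl x : x \in literals (nth IHalt P (pc s)) -> x < 2 ^ u.
  by move=> /P_lits hx; apply: leq_trans hx _; rewrite leq_exp2l.
have hb x : x \in literals (nth IHalt P (pc s)) -> bits x <= u.
  by move=> /hl hx; apply: bits_le.
have hr i : bits (regs s i) <= u by apply: bits_le.
have sum2 a b : a < 2 ^ u -> b < 2 ^ u -> a + b < 2 ^ u.+1.
  by rewrite expnS mul2n -addnn => *; lia.
rewrite /step; case: (nth IHalt P (pc s)) hl hb => [r v|r a b|r a b|r a|a t|a l|] hl hb /=.
- have hr' : bits r <= u by apply: hb; rewrite inE eqxx.
  have hv' : bits v <= u by apply: hb; rewrite !inE eqxx orbT.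
  split=> [i|]; last by lia.
  rewrite /upd; case: eqP => // _; have : v < 2 ^ u by apply: hl; rewrite !inE eqxx orbT.
  by move=> hv; apply: leq_trans hv _; rewrite leq_exp2l.
- have h1 : bits r <= u by apply: hb; rewrite inE eqxx.
  have h2 : bits a <= u by apply: hb; rewrite !inE eqxx ?orbT.
  have h3 : bits b <= u by apply: hb; rewrite !inE eqxx ?orbT.
  have := hr a; have := hr b => h4 h5.
  split=> [i|]; last by lia.
  by rewrite /upd; case: eqP => // _; apply: sum2.
- have h1 : bits r <= u by apply: hb; rewrite inE eqxx.
  have h2 : bits a <= u by apply: hb; rewrite !inE eqxx ?orbT.
  have h3 : bits b <= u by apply: hb; rewrite !inE eqxx ?orbT.
  have := hr a; have := hr b => h4 h5.
  split=> [i|]; last by lia.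
  by rewrite /upd; case: eqP => // _; apply: leq_ltn_trans (leq_subr _ _) _.
- have h1 : bits r <= u by apply: hb; rewrite inE eqxx.
  have h2 : bits a <= u by apply: hb; rewrite !inE eqxx ?orbT.
  have := hr a; have := hr (regs s a) => h4 h5.
  split=> [i|]; last by lia.
  by rewrite /upd; case: eqP.
- have h1 : bits a <= u by apply: hb; rewrite inE eqxx.
  have h2 : bits t <= u by apply: hb; rewrite !inE eqxx ?orbT.
  have := hr a; have := hr t => h4 h5.
  split=> [i|]; last by lia.
  by rewrite /upd; case: eqP.
- have h1 : bits a <= u by apply: hb; rewrite inE eqxx.
  by have := hr a => h5; split=> [i|]; [apply: hS | lia].
- by split=> [i|]; [apply: hS | lia].
Qed.

Lemma iter_bound s m : (forall i, regs s i < 2 ^ w) ->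
  (forall i, regs (iter m (step P) s) i < 2 ^ (w + m)) /\
  rcost (iter m (step P) s) <= rcost s + m * (1 + 5 * (w + m)).
Proof.
move=> hs; elim: m => [|m [IH1 IH2]]; first by rewrite addn0 mul0n addn0; split.
have [h1 h2] := step_bound (leq_addr m w) IH1.
split=> [i|]; first by rewrite addnS; apply: h1.
apply: leq_trans h2 _; apply: leq_trans (leq_add IH2 (leqnn _)) _.
rewrite -addnA leq_add2l.
have : m * (1 + 5 * (w + m)) <= m * (1 + 5 * (w + m.+1)) by rewrite leq_mul2l; apply/orP; right; lia.
by lia.
Qed.
End CostBound.

Inductive cmd :=
| Cblk of seq instr
| Cseq of cmd & cmd
| Cwhile of nat & cmd
| Cif of nat & cmd & cmd.

Definition simple (i : instr) : bool :=
  match i with IJz _ _ | IHalt => false | _ => true end.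

Definition exec1 (R : nat -> nat) (i : instr) : nat -> nat :=
  match i with
  | IConst r v => upd R r v
  | IAdd r a b => upd R r (R a + R b)
  | ISub r a b => upd R r (R a - R b)
  | ILoad r a => upd R r (R (R a))
  | IStore a t => upd R (R a) (R t)
  | _ => R
  end.

Fixpoint csize (c : cmd) : nat :=
  match c with
  | Cblk l => size l
  | Cseq a b => csize a + csize b
  | Cwhile _ c => csize c + 3
  | Cif _ a b => csize a + csize b + 3
  end.

(* Register 0 is scratch: it is zeroed to turn [IJz 0 _] into an unconditional jump. *)
Fixpoint asm (c : cmd) (o : nat) : seq instr :=
  match c with
  | Cblk l => l
  | Cseq a b => asm a o ++ asm b (o + csize a)
  | Cwhile r c => IJz r (o + (csize c + 3)) :: asm c o.+1 ++ [:: IConst 0 0; IJz 0 o]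
  | Cif r a b => IJz r (o + (csize a + 3)) :: asm a o.+1 ++
      [:: IConst 0 0; IJz 0 (o + (csize a + csize b + 3))] ++ asm b (o + (csize a + 3))
  end.

Lemma size_asm c o : size (asm c o) = csize c.
Proof.
elim: c o => [l|a IHa b IHb|r c IH|r a IHa b IHb] o //=.
- by rewrite size_cat IHa IHb.
- by rewrite size_cat IH /=; lia.
- by rewrite size_cat /= IHa IHb; lia.
Qed.

(** The last argument counts RAM steps of the assembled code. A taken loop adds 3 to its body and
    the remaining iterations: the test and the two instructions of the backward jump. That jump
    clears register 0, hence [upd R1 0 0]. The else branch falls through and needs no jump. *)
Inductive bs : cmd -> (nat -> nat) -> (nat -> nat) -> nat -> Prop :=
| bs_blk l R : all simple l -> bs (Cblk l) R (foldl exec1 R l) (size l)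
| bs_seq a b R R1 R2 n1 n2 : bs a R R1 n1 -> bs b R1 R2 n2 -> bs (Cseq a b) R R2 (n1 + n2)
| bs_while0 r c R : R r = 0 -> bs (Cwhile r c) R R 1
| bs_whileS r c R R1 R2 n1 n2 : R r <> 0 -> bs c R R1 n1 ->
    bs (Cwhile r c) (upd R1 0 0) R2 n2 -> bs (Cwhile r c) R R2 (n1 + n2 + 3)
| bs_if0 r a b R R1 n : R r = 0 -> bs b R R1 n -> bs (Cif r a b) R R1 (n + 1)
| bs_ifS r a b R R1 n : R r <> 0 -> bs a R R1 n -> bs (Cif r a b) R (upd R1 0 0) (n + 3).

Lemma nth_mid (pre post : program) i : nth IHalt (pre ++ i :: post) (size pre) = i.
Proof. by rewrite nth_cat ltnn subnn. Qed.

Lemma step_simple (pre post : program) i R rc : simple i ->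
  exists rc', step (pre ++ i :: post) (RState (size pre) R rc) =
              RState (size pre).+1 (exec1 R i) rc'.
Proof. by rewrite /step /= nth_mid; case: i => //= *; eexists. Qed.

Lemma run_blk (pre l post : program) R rc : all simple l ->
  exists rc', iter (size l) (step (pre ++ l ++ post)) (RState (size pre) R rc) =
              RState (size pre + size l) (foldl exec1 R l) rc'.
Proof.
elim: l pre R rc => [|i l IH] pre R rc /=; first by rewrite addn0; exists rc.
case/andP=> si sl; rewrite -iterS iterSr.
have [rc1 ->] := step_simple pre (l ++ post) R rc si.
have [rc2] := IH (rcons pre i) (exec1 R i) rc1 sl.
by rewrite size_rcons cat_rcons addSnnS => ->; exists rc2.
Qed.

Lemma step_jz (pre post : program) r o R rc :
  exists rc', step (pre ++ IJz r o :: post) (RState (size pre) R rc) =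
    RState (if R r == 0 then o else (size pre).+1) R rc'.
Proof. by rewrite /step /= nth_mid; eexists. Qed.

Lemma run_goto (pre post : program) o R rc :
  exists rc', iter 2 (step (pre ++ [:: IConst 0 0; IJz 0 o] ++ post))
       (RState (size pre) R rc) = RState o (upd R 0 0) rc'.
Proof.
rewrite 2!iterSr /=.
have [rc1 ->] := step_simple pre (IJz 0 o :: post) R rc (isT : simple (IConst 0 0)).
have [rc2] := step_jz (rcons pre (IConst 0 0)) post 0 o (exec1 R (IConst 0 0)) rc1.
by rewrite size_rcons cat_rcons /upd /= => ->; exists rc2.
Qed.

(** Jump targets are absolute, so the code is placed at offset [size pre] inside an arbitrary
    program. The cost component stays existential: it is bounded afterwards, for the whole run, by
    [iter_bound]. *)
Lemma asm_correct c R R' n : bs c R R' n -> forall (pre post : program) rc,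
  exists rc', iter n (step (pre ++ asm c (size pre) ++ post)) (RState (size pre) R rc) =
              RState (size pre + csize c) R' rc'.
Proof.
elim=> {c R R' n}
  [l R sl|a b R R1 R2 n1 n2 _ IH1 _ IH2|r c R r0|r c R R1 R2 n1 n2 r0 _ IH1 _ IH2
  |r a b R R1 n r0 _ IH|r a b R R1 n r0 _ IH] pre post rc /=.
- exact: run_blk.
- rewrite addnC iterD -catA.
  have [rc1 ->] := IH1 pre (asm b (size pre + csize a) ++ post) rc.
  have [rc2] := IH2 (pre ++ asm a (size pre)) post rc1.
  by rewrite size_cat size_asm -!catA addnA => ->; exists rc2.
- have [rc1 ->] := step_jz pre ((asm c (size pre).+1 ++
     [:: IConst 0 0; IJz 0 (size pre)]) ++ post) r (size pre + (csize c + 3)) R rc.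
  by rewrite r0 eqxx; exists rc1.
- set J := IJz r _; set B := asm c _; set G := [:: IConst _ _; _].
  set Pg := (pre ++ _).
  (* [iterD] executes the right summand first: test, body, jump back, then the remaining
     iterations. *)
  rewrite (_ : n1 + n2 + 3 = n2 + (2 + (n1 + 1))); last by lia.
  rewrite (iterD n2) (iterD 2 (n1 + 1)) (iterD n1 1) [iter 1 _ _]/=.
  have [rc1] := step_jz pre ((B ++ G) ++ post) r (size pre + (csize c + 3)) R rc.
  rewrite -[_ ++ IJz _ _ :: _]/Pg => ->.
  move/eqP/negPf: (r0) => ->.
  have [rc2] := IH1 (rcons pre J) (G ++ post) rc1.
  rewrite size_rcons -/B cat_rcons.
  have -> : pre ++ J :: B ++ G ++ post = Pg by rewrite /Pg; repeat progress rewrite /= -?catA.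
  move=> ->.
  have [rc3] := run_goto (pre ++ J :: B) post (size pre) R1 rc2.
  rewrite -/G size_cat /= [size B]size_asm -addSnnS.
  have -> : (pre ++ J :: B) ++ IConst 0 0 :: IJz 0 (size pre) :: post = Pg.
    by rewrite /Pg; repeat progress rewrite /= -?catA.
  move=> ->.
  by have [rc4 E3] := IH2 pre post rc3; exists rc4.
- rewrite addn1 iterSr.
  set A := asm a _; pose G := [:: IConst 0 0; IJz 0 (size pre + (csize a + csize b + 3))]; set B := asm b _.
  have [rc1 ->] := step_jz pre ((A ++ G ++ B) ++ post) r (size pre + (csize a + 3)) R rc.
  rewrite r0 eqxx.
  have [rc2] := IH (pre ++ (IJz r (size pre + (csize a + 3)) :: A) ++ G) post rc1.
  have -> : size (pre ++ (IJz r (size pre + (csize a + 3)) :: A) ++ G) = size pre + (csize a + 3).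
    by rewrite !size_cat /= size_asm; lia.
  rewrite -/B => E; exists rc2.
  rewrite [in RHS](_ : size pre + (csize a + csize b + 3) = size pre + (csize a + 3) + csize b); last by lia.
  by rewrite -E; congr (iter _ (step _) _); rewrite /G; repeat progress rewrite /= -?catA.
- pose J := IJz r (size pre + (csize a + 3)); set A := asm a (size pre).+1; pose G := [:: IConst 0 0; IJz 0 (size pre + (csize a + csize b + 3))]; set B := asm b (size pre + (csize a + 3)).
  set Pg := (pre ++ _).
  rewrite (_ : n + 3 = 2 + (n + 1)); last by lia.
  rewrite (iterD 2 (n + 1)) (iterD n 1) [iter 1 _ _]/=.
  have [rc1] := step_jz pre ((A ++ G ++ B) ++ post) r (size pre + (csize a + 3)) R rc.
  rewrite -[_ ++ IJz _ _ :: _]/Pg => ->.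
  move/eqP/negPf: (r0) => ->.
  have [rc2] := IH (rcons pre J) (G ++ B ++ post) rc1.
  rewrite size_rcons -/A cat_rcons.
  have -> : pre ++ J :: A ++ G ++ B ++ post = Pg by rewrite /Pg; repeat progress rewrite /= -?catA.
  move=> ->.
  have [rc3] := run_goto (pre ++ J :: A) (B ++ post) (size pre + (csize a + csize b + 3)) R1 rc2.
  have EP : (pre ++ J :: A) ++ G ++ B ++ post = Pg.
    by rewrite /Pg /G; repeat progress rewrite /= -?catA.
  rewrite -/G EP size_cat /= [size A]size_asm -addSnnS.
  by move=> ->; exists rc3.
Qed.

(** * Compiling a point-free language *)

Inductive value := VN of nat | VP of value & value.

Inductive tm :=
| Tid
| Tcomp of tm & tm
| Tpair of tm & tm
| Tfst
| Tsnd
| Tconst of nat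
| Tadd
| Tsub
| Tisatom
| Tif of tm & tm & tm
| Tfold of tm.

(** A relation, because terms are partial on untyped values. In [ev_fold0] any number ends a list,
    so the compiled loop only has to test whether the first word of a cell is zero. *)
Inductive ev : tm -> value -> value -> nat -> Prop :=
| ev_id v : ev Tid v v 1
| ev_comp f g v u w n m : ev f v u n -> ev g u w m -> ev (Tcomp g f) v w (n + m)
| ev_pair f g v a b n m : ev f v a n -> ev g v b m -> ev (Tpair f g) v (VP a b) (n + m + 1)
| ev_fst a b : ev Tfst (VP a b) a 1
| ev_snd a b : ev Tsnd (VP a b) b 1
| ev_const k v : ev (Tconst k) v (VN k) 1
| ev_add a b : ev Tadd (VP (VN a) (VN b)) (VN (a + b)) 1
| ev_sub a b : ev Tsub (VP (VN a) (VN b)) (VN (a - b)) 1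
| ev_isatomN k : ev Tisatom (VN k) (VN 1) 1
| ev_isatomP a b : ev Tisatom (VP a b) (VN 0) 1
| ev_if c f g v k w n m : ev c v (VN k) n -> ev (if k == 0 then g else f) v w m ->
    ev (Tif c f g) v w (n + m + 1)
| ev_fold0 f a k : ev (Tfold f) (VP a (VN k)) a 1
| ev_foldS f a x l a' w n m : ev f (VP a x) a' n -> ev (Tfold f) (VP a' l) w m ->
    ev (Tfold f) (VP a (VP x l)) w (n + m + 1).

(* Heap layout: a value is the address of a two-word cell, (0, n) for [VN n] and
   (address, address) for [VP]; addresses are at least [lo] > 0, so the first word
   tells the two cases apart. *)
Fixpoint rep (lo hi : nat) (R : nat -> nat) (p : nat) (v : value) : Prop :=
  [/\ lo <= p, p.+1 < hi &
  match v with
  | VN n => R p = 0 /\ R p.+1 = n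
  | VP a b => rep lo hi R (R p) a /\ rep lo hi R (R p.+1) b
  end].

Lemma rep_ge lo hi R p v : rep lo hi R p v -> lo <= p /\ p.+1 < hi.
Proof. by case: v => [n|a b] []. Qed.

Lemma rep_ext lo hi hi' R R' p v : hi <= hi' ->
  (forall i, lo <= i < hi -> R' i = R i) -> rep lo hi R p v -> rep lo hi' R' p v.
Proof.
move=> hh hR; elim: v p => [n|a IHa b IHb] p /= [h1 h2].
  by case=> h3 h4; split; [lia | lia | rewrite !hR //; lia].
case=> h3 h4; split; [lia | lia | rewrite !hR; try lia].
by split; [apply: IHa | apply: IHb].
Qed.

(* Register conventions: 0 is scratch, 1 holds the constant 1, 2 is the allocation
   pointer, 3 and 4 are temporaries. *)
Definition mov (d a : nat) : cmd := Cblk [:: IConst 0 0; IAdd d a 0].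
Definition alloc (d a b : nat) : cmd :=
  Cblk [:: IStore 2 a; IAdd 2 2 1; IStore 2 b; IAdd 2 2 1; IConst 0 2; ISub d 2 0].

Fixpoint Cseqs (l : seq cmd) : cmd :=
  match l with
  | [::] => Cblk [::]
  | [:: c] => c
  | c :: l => Cseq c (Cseqs l)
  end.

(** The argument pointer is in register [r] and the result pointer replaces it; the registers above
    [r] are free for subterms. Since values are shared, copying one is a register move. [Tisatom]
    computes 1 minus the first word of the cell, which is 0 for an atom and a positive address for a
    pair. *)
Fixpoint comp (t : tm) (r : nat) : cmd :=
  match t with
  | Tid => Cblk [::]
  | Tcomp g f => Cseq (comp f r) (comp g r)
  | Tpair f g => Cseqs [:: mov r.+1 r; comp f r.+1; mov r.+2 r; comp g r.+2; alloc r r.+1 r.+2]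
  | Tfst => Cblk [:: ILoad r r]
  | Tsnd => Cblk [:: IAdd r r 1; ILoad r r]
  | Tconst k => Cseqs [:: Cblk [:: IConst 3 0; IConst 4 k]; alloc r 3 4]
  | Tadd => Cseqs [:: Cblk [:: ILoad 3 r; IAdd 3 3 1; ILoad 3 3; IAdd 4 r 1; ILoad 4 4;
                    IAdd 4 4 1; ILoad 4 4; IAdd 4 3 4; IConst 3 0]; alloc r 3 4]
  | Tsub => Cseqs [:: Cblk [:: ILoad 3 r; IAdd 3 3 1; ILoad 3 3; IAdd 4 r 1; ILoad 4 4;
                    IAdd 4 4 1; ILoad 4 4; ISub 4 3 4; IConst 3 0]; alloc r 3 4]
  | Tisatom => Cseqs [:: Cblk [:: ILoad 4 r; ISub 4 1 4; IConst 3 0]; alloc r 3 4]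
  | Tif c f g => Cseqs [:: mov r.+1 r; comp c r.+1; Cblk [:: IAdd r.+1 r.+1 1; ILoad r.+1 r.+1];
                    Cif r.+1 (comp f r) (comp g r)]
  | Tfold f => Cseqs [:: Cblk [:: ILoad r.+1 r; IAdd r r 1; ILoad r r; ILoad r.+2 r];
                 Cwhile r.+2 (Cseqs [:: alloc r.+1 r.+1 r.+2; Cblk [:: IAdd r r 1; ILoad r r];
                                        comp f r.+1; Cblk [:: ILoad r.+2 r]]);
                 mov r r.+1]
  end.

Fixpoint depth (t : tm) : nat :=
  match t with
  | Tcomp f g => maxn (depth f) (depth g)
  | Tpair f g => maxn (depth f) (depth g) + 3
  | Tif c f g => maxn (depth c) (maxn (depth f) (depth g)) + 3
  | Tfold f => depth f + 3
  | _ => 1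
  end.

(** What a caller may rely on after running a subterm: pointers kept below [r] and all cells below
    the old allocation pointer survive, so values represented before are still represented. *)
Record frame (lo r : nat) (R R' : nat -> nat) : Prop := Frame {
  frame_one : R' 1 = 1;
  frame_hp : R 2 <= R' 2;
  frame_reg : forall i, 5 <= i < r -> R' i = R i;
  frame_heap : forall i, lo <= i < R 2 -> R' i = R i }.

Lemma frame_trans lo r r' R R1 R2 : r <= r' -> frame lo r R R1 -> frame lo r' R1 R2 ->
  frame lo r R R2.
Proof.
move=> rr [a1 a2 a3 a4] [b1 b2 b3 b4]; split=> // [|i hi|i hi]; first by lia.
  by rewrite b3; [apply: a3 | lia].
by rewrite b4; [apply: a4 | lia].
Qed.

Lemma frame_weak lo r r' R R' : r <= r' -> frame lo r' R R' -> frame lo r R R'.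
Proof. by move=> rr [a1 a2 a3 a4]; split=> // i hi; apply: a3; lia. Qed.

Lemma rep_frame lo r R R' p v : frame lo r R R' -> rep lo (R 2) R p v -> rep lo (R' 2) R' p v.
Proof. by case=> _ h _ h' ; apply: rep_ext. Qed.

Lemma upd_eq R r v : upd R r v r = v. Proof. by rewrite /upd eqxx. Qed.
Lemma upd_ne R r v i : i <> r -> upd R r v i = R i. Proof. by move=> /eqP/negPf h; rewrite /upd h. Qed.

Ltac ueq := rewrite ?/exec1 /upd;
  repeat (match goal with |- context [@eq_op _ ?a ?b] =>
    first [ rewrite (_ : (a == b) = false); last (by apply/eqP; lia)
          | rewrite (_ : (a == b) = true); last (by apply/eqP; lia) ] end; cbn iota beta).

Lemma bs_mov R d a : a <> 0 ->
  exists R', [/\ bs (mov d a) R R' 2, R' d = R a & forall i, i <> 0 -> i <> d -> R' i = R i].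
Proof.
move=> a0; eexists; split; first exact: (@bs_blk [:: _; _]).
  by rewrite /=; ueq; rewrite addn0.
by move=> i i0 id; rewrite /=; ueq.
Qed.

Lemma bs_alloc lo R d a b : R 1 = 1 -> 5 <= lo <= R 2 ->
  0 < a < lo -> a <> 2 -> 0 < b < lo -> b <> 2 -> 0 < d < lo -> d <> 2 ->
  exists R', [/\ bs (alloc d a b) R R' 6, R' 2 = (R 2).+2, R' d = R 2 &
    [/\ R' (R 2) = R a, R' (R 2).+1 = R b &
      forall i, i <> 0 -> i <> 2 -> i <> d -> i <> R 2 -> i <> (R 2).+1 -> R' i = R i]].
Proof.
move=> R1 hlo ha a2 hb b2 hd d2.
eexists; split; first exact: (@bs_blk [:: _; _; _; _; _; _]).
- by rewrite /=; ueq; lia.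
- by rewrite /=; ueq; lia.
split.
- by rewrite /=; ueq.
- by rewrite /=; ueq; rewrite ?R1 ?addn1; ueq.
- by move=> i *; rewrite /=; ueq.
Qed.

Lemma alloc_spec lo R r d a b : R 1 = 1 -> 5 <= lo <= R 2 ->
  2 < a < lo -> 2 < b < lo -> r <= d -> 5 <= d < lo ->
  exists R', [/\ bs (alloc d a b) R R' 6, frame lo r R R', R' d = R 2, R' 2 = (R 2).+2 &
    [/\ R' (R 2) = R a, R' (R 2).+1 = R b &
      forall i, 2 < i < lo -> i <> d -> R' i = R i]].
Proof.
move=> R1 hlo ha hb hr hd.
have [||||||R' [h1 h2 h3 [h4 h5 h6]]] := @bs_alloc lo R d a b R1 hlo; try lia.
exists R'; split=> //; last by split=> // i hi id; apply: h6; lia.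
split; [by rewrite h6 //; lia | by lia | by move=> i hi; apply: h6; lia | by move=> i hi; apply: h6; lia].
Qed.

Lemma alloc_pair lo R r d a b va vb : R 1 = 1 -> 5 <= lo <= R 2 ->
  2 < a < lo -> 2 < b < lo -> r <= d -> 5 <= d < lo ->
  rep lo (R 2) R (R a) va -> rep lo (R 2) R (R b) vb ->
  exists R', [/\ bs (alloc d a b) R R' 6, frame lo r R R', rep lo (R' 2) R' (R' d) (VP va vb) &
      forall i, 2 < i < lo -> i <> d -> R' i = R i].
Proof.
move=> R1 hlo ha hb hr hd repa repb.
have [R' [h1 h2 h3 h4 [h5 h6 h7]]] := alloc_spec R1 hlo ha hb hr hd.
exists R'; split=> //=; rewrite h3; split; [by lia|by lia|].
by rewrite h5 h6; split; apply: rep_frame h2 _.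
Qed.

Lemma alloc_atom lo R r d n : R 1 = 1 -> 5 <= lo <= R 2 ->
  r <= d -> 5 <= d < lo -> R 3 = 0 -> R 4 = n ->
  exists R', [/\ bs (alloc d 3 4) R R' 6, frame lo r R R', rep lo (R' 2) R' (R' d) (VN n) &
      forall i, 2 < i < lo -> i <> d -> R' i = R i].
Proof.
move=> R1 hlo hr hd R3 R4.
have [| |R' [h1 h2 h3 h4 [h5 h6 h7]]] := @alloc_spec lo R r d 3 4 R1 hlo _ _ hr hd; try lia.
by exists R'; split=> //=; rewrite h3; split; [by lia|by lia|rewrite h5 h6].
Qed.

Lemma frame_blk lo r R R' : R 1 = 1 -> 5 <= lo -> r <= lo ->
  (forall i, i = 1 \/ i = 2 \/ 5 <= i < r \/ lo <= i -> R' i = R i) -> frame lo r R R'.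
Proof.
move=> R1 hlo hr hR; split; first by rewrite hR //; lia.
- by rewrite hR //; lia.
- by move=> i hi; apply: hR; lia.
- by move=> i hi; apply: hR; lia.
Qed.

(** The factor 20 is slack over the longest fixed instruction sequence, which has 15 instructions
    and belongs to the arithmetic terms; the overhead of a construct is paid by the unit that its
    [ev] rule adds. *)
Definition implements (t : tm) : Prop := forall v w n, ev t v w n -> forall lo r R,
  5 <= r -> r + depth t < lo -> R 1 = 1 -> lo <= R 2 -> rep lo (R 2) R (R r) v ->
  exists R' s, [/\ bs (comp t r) R R' s, s <= 20 * n, frame lo r R R' &
                   rep lo (R' 2) R' (R' r) w].

Lemma ev_gt0 t v w n : ev t v w n -> 0 < n.
Proof. by elim=> *; lia. Qed.

Lemma load_left R r : R 1 = 1 -> (R (R r)).+1 <> 3 -> 4 < r ->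
  foldl exec1 R [:: ILoad 3 r; IAdd 3 3 1; ILoad 3 3] 3 = R (R (R r)).+1.
Proof. by move=> R1 h hr; rewrite /= !upd_eq [upd R _ _ 1]upd_ne // R1 addn1 !upd_ne. Qed.

Lemma load_right R r : R 1 = 1 -> 4 < r -> (R r).+1 <> 4 -> (R (R r).+1).+1 <> 4 ->
  foldl exec1 R [:: IAdd 4 r 1; ILoad 4 4; IAdd 4 4 1; ILoad 4 4] 4 = R (R (R r).+1).+1.
Proof.
move=> R1 hr h h'; rewrite /= !upd_eq R1 !addn1.
by rewrite !(@upd_ne _ _ _ 1) // R1 addn1 !upd_ne.
Qed.

Lemma implements_arith (t : tm) (i : instr) (op : nat -> nat -> nat) :
  simple i -> (forall R, exec1 R i = upd R 4 (op (R 3) (R 4))) ->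
  (forall r, comp t r = Cseqs [:: Cblk [:: ILoad 3 r; IAdd 3 3 1; ILoad 3 3; IAdd 4 r 1; ILoad 4 4;
                    IAdd 4 4 1; ILoad 4 4; i; IConst 3 0]; alloc r 3 4]) ->
  forall a b lo r R,
  5 <= r -> r + 1 < lo -> R 1 = 1 -> lo <= R 2 -> rep lo (R 2) R (R r) (VP (VN a) (VN b)) ->
  exists R' s, [/\ bs (comp t r) R R' s, s <= 20, frame lo r R R' &
                   rep lo (R' 2) R' (R' r) (VN (op a b))].
Proof.
move=> si hi ct a b lo r R r5 rlo R1 R2 /= [h1 h2 [[h3 h4 [h5 h6]] [h7 h8 [h9 h10]]]].
set B := [:: ILoad 3 r; IAdd 3 3 1; ILoad 3 3; IAdd 4 r 1; ILoad 4 4; IAdd 4 4 1; ILoad 4 4;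
  i; IConst 3 0].
have hB : all simple B by rewrite /B /= si.
have hb := bs_blk R hB.
set R' := foldl exec1 R B in hb.
have h1' : R 1 = 1 by [].
have E i' : i' <> 3 -> i' <> 4 -> R' i' = R i'.
  by move=> n3 n4; rewrite /R' /B /= hi !upd_ne.
have E3 : R' 3 = 0 by rewrite /R' /= upd_eq.
have E4 : R' 4 = op a b.
  have e1 := load_left R1 (_ : (R (R r)).+1 <> 3) r5.
  pose S := foldl exec1 R [:: ILoad 3 r; IAdd 3 3 1; ILoad 3 3].
  have Se i' : i' <> 3 -> S i' = R i' by move=> n3; rewrite /S /= !upd_ne.
  have e2 := @load_right S r.
  rewrite (_ : R' = exec1 (exec1 (foldl exec1 S [:: IAdd 4 r 1; ILoad 4 4; IAdd 4 4 1; ILoad 4 4]) i)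
     (IConst 3 0)) // hi /exec1 upd_ne // upd_eq e2 ?Se //; try lia.
  have -> : foldl exec1 S [:: IAdd 4 r 1; ILoad 4 4; IAdd 4 4 1; ILoad 4 4] 3 = S 3.
    by rewrite /= !upd_ne.
  by rewrite [S 3]e1 ?h6 ?h10 //; lia.
have fr : frame lo r R R' by apply: frame_blk => // [||i' hi']; [lia|lia|apply: E; lia].
have R1' := frame_one fr; have hp' := frame_hp fr.
have [R'' [k1 k2 k3 _]] := @alloc_atom lo R' r r (op a b) R1' ltac:(lia) (leqnn r) ltac:(lia) E3 E4.
exists R'', (9 + 6); rewrite ct -/B /=; split=> //; first exact: bs_seq hb k1.
exact: frame_trans fr k2.
Qed.

Lemma implements_comp f g : implements f -> implements g -> implements (Tcomp g f).
Proof.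
move=> IHf IHg v w n E; inversion_clear E as [|? ? ? u ? n1 n2 E1 E2| | | | | | | | | | |].
move=> lo r R r5 /= rlo R1 R2 hv.
have [R' [s1 [b1 c1 f1 v1]]] := IHf _ _ _ E1 lo r R r5 ltac:(lia) R1 R2 hv.
have [R'' [s2 [b2 c2 f2 v2]]] := IHg _ _ _ E2 lo r R' r5 ltac:(lia) (frame_one f1)
  ltac:(have := frame_hp f1; lia) v1.
exists R'', (s1 + s2); split=> //; [exact: bs_seq b1 b2 | lia | exact: frame_trans f1 f2].
Qed.

Lemma mov_spec lo R d a v r : R 1 = 1 -> 5 <= lo <= R 2 -> 2 < a < lo -> r <= d -> 5 <= d < lo ->
  rep lo (R 2) R (R a) v ->
  exists R', [/\ bs (mov d a) R R' 2, frame lo r R R', rep lo (R' 2) R' (R' d) v &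
    forall i, 0 < i -> i <> d -> R' i = R i].
Proof.
move=> R1 hlo ha hr hd hv.
have [|R' [b e1 e2]] := @bs_mov R d a; first by lia.
have fr : frame lo r R R' by apply: frame_blk => // [||i hi]; [lia|lia|apply: e2; lia].
exists R'; split=> //; first by rewrite e1; apply: rep_frame fr hv.
by move=> i i0 id; apply: e2; lia.
Qed.

Lemma implements_pair f g : implements f -> implements g -> implements (Tpair f g).
Proof.
move=> IHf IHg v w n E; inversion_clear E as [| |? ? ? a b n1 n2 E1 E2| | | | | | | | | |].
move=> lo r R r5 /= rlo R1 R2 hv.
have [||||Ra [b1 f1 v1 e1]] := @mov_spec lo R r.+1 r v r.+1 R1 _ _ _ _ hv; try lia.
have [Rb [s1 [b2 c2 f2 v2]]] := IHf _ _ _ E1 lo r.+1 Ra ltac:(lia) ltac:(lia) (frame_one f1)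
  ltac:(have := frame_hp f1; lia) v1.
have f12 := frame_trans (leqnn _) f1 f2.
have hv' := rep_frame f12 hv.
have hp1 := frame_hp f1; have hp2 := frame_hp f2.
rewrite -(frame_reg f12 (_ : 5 <= r < r.+1)) in hv'; last by lia.
have [||||Rc [b3 f3 v3 e3]] := @mov_spec lo Rb r.+2 r v r.+2 (frame_one f2) _ _ _ _ hv'; try lia.
have [Rd [s2 [b4 c4 f4 v4]]] := IHg _ _ _ E2 lo r.+2 Rc ltac:(lia) ltac:(lia) (frame_one f3)
  ltac:(have := frame_hp f3; lia) v3.
have f34 := frame_trans (leqnn _) f3 f4.
have hp3 := frame_hp f3; have hp4 := frame_hp f4.
have va := rep_frame f34 v2.
rewrite -(frame_reg f34 (_ : 5 <= r.+1 < r.+2)) in va; last by lia.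
have [|||||Re [b5 f5 v5 e5]] := @alloc_pair lo Rd r r r.+1 r.+2 a b (frame_one f4) _ _ _ _ _ va v4; try lia.
exists Re, (2 + (s1 + (2 + (s2 + 6)))); split=> //.
- by apply: (bs_seq b1); apply: (bs_seq b2); apply: (bs_seq b3); apply: (bs_seq b4).
- lia.
- by apply: frame_trans (frame_trans _ (frame_weak _ f12) f34) f5; lia.
Qed.

Lemma implements_fst : implements Tfst.
Proof.
move=> v w n E; inversion_clear E as [| | |a b| | | | | | | | |].
move=> lo r R r5 /= rlo R1 R2 [h1 h2 [h3 h4]].
eexists; exists 1; split; [exact: (@bs_blk [:: _]) | by [] | |].
  by apply: frame_blk => // [||i hi]; [lia | lia | rewrite /= upd_ne //; lia].
by rewrite /= upd_eq upd_ne; [apply: rep_ext h3 => // i hi; rewrite upd_ne //; lia | lia].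
Qed.

Lemma implements_snd : implements Tsnd.
Proof.
move=> v w n E; inversion_clear E as [| | | |a b| | | | | | | |].
move=> lo r R r5 /= rlo R1 R2 [h1 h2 [h3 h4]].
eexists; exists 2; split; [exact: (@bs_blk [:: _; _]) | by [] | |].
  by apply: frame_blk => // [||i hi]; [lia | lia | rewrite /= !upd_ne //; lia].
rewrite /= !upd_eq !(@upd_ne _ _ _ 2); try lia.
rewrite upd_ne; last by lia.
by rewrite R1 addn1; apply: rep_ext h4 => // i hi; rewrite !upd_ne //; lia.
Qed.

Lemma implements_const k : implements (Tconst k).
Proof.
move=> v w n E; inversion_clear E.
move=> lo r R r5 /= rlo R1 R2 hv.
have fr : frame lo r R (upd (upd R 3 0) 4 k).
  by apply: frame_blk => // [||i hi]; [lia | lia | rewrite /= !upd_ne //; lia].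
have fr1 := frame_one fr; have frh := frame_hp fr.
have [R' [k1 k2 k3 _]] := @alloc_atom lo _ r r k fr1 ltac:(lia) (leqnn r) ltac:(lia)
  (erefl _) (erefl _).
exists R', (2 + 6); split=> //; last exact: frame_trans fr k2.
by apply: bs_seq _ k1; exact: (@bs_blk [:: _; _]).
Qed.

Lemma implements_isatom : implements Tisatom.
Proof.
move=> v w n E lo r R r5 /= rlo R1 R2 hv.
pose R0 := foldl exec1 R [:: ILoad 4 r; ISub 4 1 4; IConst 3 0].
have fr : frame lo r R R0.
  by apply: frame_blk => // [||i hi]; [lia | lia | rewrite /R0 /= !upd_ne //; lia].
have fr1 := frame_one fr; have frh := frame_hp fr.
have R04 : R0 4 = 1 - R (R r) by rewrite /R0 /= upd_ne // !upd_eq upd_ne // R1.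
have -> : w = VN (1 - R (R r)).
  inversion E; subst; move: hv => /= [h1 h2 [h3 h4]]; first by rewrite h3.
  by have [] := rep_ge h3; case: (R (R r)) => [|m] // *; lia.
have [R' [k1 k2 k3 _]] := @alloc_atom lo _ r r _ fr1 ltac:(lia) (leqnn r) ltac:(lia) (erefl _) R04.
exists R', (3 + 6); split=> //; last exact: frame_trans fr k2.
  by apply: bs_seq _ k1; exact: (@bs_blk [:: _; _; _]).
by have := ev_gt0 E; lia.
Qed.

Lemma implements_if c f g : implements c -> implements f -> implements g ->
  implements (Tif c f g).
Proof.
move=> IHc IHf IHg v w n E; inversion_clear E as [| | | | | | | | | |? ? ? ? k ? n1 n2 E1 E2| |].
move=> lo r R r5 /= rlo R1 R2 hv.
have [||||Ra [b1 f1 v1 e1]] := @mov_spec lo R r.+1 r v r.+1 R1 _ _ _ _ hv; try lia.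
have [Rb [s1 [b2 c2 f2 v2]]] := IHc _ _ _ E1 lo r.+1 Ra ltac:(lia) ltac:(lia) (frame_one f1)
  ltac:(have := frame_hp f1; lia) v1.
have f12 := frame_trans (leqnn _) f1 f2.
have hv' := rep_frame f12 hv.
have hp12 := frame_hp f12.
rewrite -(frame_reg f12 (_ : 5 <= r < r.+1)) in hv'; last by lia.
pose Rc := foldl exec1 Rb [:: IAdd r.+1 r.+1 1; ILoad r.+1 r.+1].
have b3 : bs (Cblk [:: IAdd r.+1 r.+1 1; ILoad r.+1 r.+1]) Rb Rc 2 by exact: (@bs_blk [:: _; _]).
have f3 : frame lo r.+1 Rb Rc.
  by apply: frame_blk (frame_one f2) _ _ _ => // [||i hi]; [lia | lia | rewrite /Rc /= !upd_ne //; lia].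
have Rck : Rc r.+1 = k.
  move: v2 => /= [h1 h2 [h3 h4]].
  by rewrite /Rc /= !upd_eq (frame_one f2) upd_ne ?addn1 ?h4 //; lia.
have f123 := frame_weak (leqnSn _) (frame_trans (leqnn _) f12 f3).
have hp3 := frame_hp f3.
have hv3 := rep_frame f3 hv'.
rewrite -(frame_reg f3 (_ : 5 <= r < r.+1)) in hv3; last by lia.
case: (eqVneq k 0) E2 => [k0|k0] E2.
  have [Rd [s2 [b4 c4 f4 v4]]] := IHg _ _ _ E2 lo r Rc r5 ltac:(lia) (frame_one f3) ltac:(lia) hv3.
  exists Rd, (2 + (s1 + (2 + (s2 + 1)))); split=> //.
  - apply: (bs_seq b1); apply: (bs_seq b2); apply: (bs_seq b3).
    by apply: bs_if0 b4; rewrite Rck.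
  - lia.
  - exact: frame_trans f123 f4.
have [Rd [s2 [b4 c4 f4 v4]]] := IHf _ _ _ E2 lo r Rc r5 ltac:(lia) (frame_one f3) ltac:(lia) hv3.
have f5 : frame lo r Rd (upd Rd 0 0).
  by apply: frame_blk (frame_one f4) _ _ _ => // [||i hi]; [lia | lia | rewrite upd_ne //; lia].
exists (upd Rd 0 0), (2 + (s1 + (2 + (s2 + 3)))); split=> //.
- apply: (bs_seq b1); apply: (bs_seq b2); apply: (bs_seq b3).
  by apply: bs_ifS b4; rewrite Rck; apply/eqP.
- lia.
- exact: frame_trans (frame_trans _ f123 f4) f5.
- by rewrite (upd_ne _ _ (_ : r <> 0)); [apply: rep_frame f5 v4 | lia].
Qed.

Definition fold_body f r := Cseqs [:: alloc r.+1 r.+1 r.+2; Cblk [:: IAdd r r 1; ILoad r r];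
                        comp f r.+1; Cblk [:: ILoad r.+2 r]].

(** Loop invariant: [r] holds the rest of the list, [r.+1] the accumulator, and [r.+2] the first
    word of the current cell, which is the pointer to the head, or 0 at the end. Six steps are set
    aside for the code around the loop. *)
Lemma fold_loop f : implements f -> forall l acc w n, ev (Tfold f) (VP acc l) w n ->
  forall lo r R, 5 <= r -> r + (depth f + 3) < lo -> R 1 = 1 -> lo <= R 2 ->
  rep lo (R 2) R (R r) l -> rep lo (R 2) R (R r.+1) acc -> R r.+2 = R (R r) ->
  exists R' s, [/\ bs (Cwhile r.+2 (fold_body f r)) R R' s, s + 6 <= 20 * n, frame lo r R R' &
                   rep lo (R' 2) R' (R' r.+1) w].
Proof.
move=> IHf; elim=> [k|x _ l IHl] acc w n E lo r R r5 rlo R1 R2 hl ha hr.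
  inversion E; subst; exists R, 1; split=> //; apply: bs_while0.
  by rewrite hr; case: hl => _ _ [].
inversion_clear E as [| | | | | | | | | | | |? ? ? ? acc' ? n1 n2 E1 E2].
have hl0 := hl; case: hl => h1 h2 [h3 h4].
have hx : rep lo (R 2) R (R r.+2) x by rewrite hr.
have [|||||Ra [b1 f1 v1 e1]] := @alloc_pair lo R r.+1 r.+1 r.+1 r.+2 acc x R1 _ _ _ _ _ ha hx; try lia.
have hp1 := frame_hp f1.
have Rar : Ra r = R r by apply: e1; lia.
pose Rb := foldl exec1 Ra [:: IAdd r r 1; ILoad r r].
have b2 : bs (Cblk [:: IAdd r r 1; ILoad r r]) Ra Rb 2 by exact: (@bs_blk [:: _; _]).
have Rbe i : i <> r -> Rb i = Ra i by move=> hi; rewrite /Rb /= !upd_ne.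
have Rbr : Rb r = R (R r).+1.
  rewrite /Rb /= !upd_eq (frame_one f1) Rar addn1 upd_ne; last by lia.
  by apply: (frame_heap f1); lia.
have f2 : frame lo r Ra Rb.
  by apply: frame_blk (frame_one f1) _ _ _ => // [||i hi]; [lia | lia | apply: Rbe; lia].
have hp2 := frame_hp f2.
have v2 : rep lo (Rb 2) Rb (Rb r.+1) (VP acc x) by rewrite (Rbe r.+1); [apply: rep_frame f2 v1 | lia].
have [Rc [s [b3 c3 f3 v3]]] := IHf _ _ _ E1 lo r.+1 Rb ltac:(lia) ltac:(lia) (frame_one f2) ltac:(lia) v2.
have hp3 := frame_hp f3.
pose Rd0 := foldl exec1 Rc [:: ILoad r.+2 r].
pose Rd := upd Rd0 0 0.
have b4 : bs (Cblk [:: ILoad r.+2 r]) Rc Rd0 1 by exact: (@bs_blk [:: _]).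
have Rde i : i <> r.+2 -> i <> 0 -> Rd i = Rc i by move=> *; rewrite /Rd /Rd0 /= !upd_ne.
have f4 : frame lo r Rc Rd.
  by apply: frame_blk (frame_one f3) _ _ _ => // [||i hi]; [lia | lia | apply: Rde; lia].
have hp4 := frame_hp f4.
have fa : frame lo r R Rb by exact: frame_trans (leqnn _) (frame_weak (leqnSn _) f1) f2.
have fb : frame lo r R Rc by exact: frame_trans (leqnn _) fa (frame_weak (leqnSn _) f3).
have fc : frame lo r R Rd by exact: frame_trans (leqnn _) fb f4.
have Rcr : Rc r = R (R r).+1 by rewrite (frame_reg f3) ?Rbr //; lia.
have Rdr : Rd r = R (R r).+1 by rewrite Rde ?Rcr //; lia.
have hl' : rep lo (Rd 2) Rd (Rd r) l by rewrite Rdr; apply: rep_frame fc h4.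
have ha' : rep lo (Rd 2) Rd (Rd r.+1) acc'.
  by rewrite (Rde r.+1); [apply: rep_frame f4 v3 | lia | lia].
have [hg1 hg2] := rep_ge h4.
have hr' : Rd r.+2 = Rd (Rd r).
  rewrite Rdr (Rde (R (R r).+1)); [|lia|lia].
  by rewrite /Rd /Rd0 /= upd_ne; [rewrite upd_eq Rcr | lia].
have [Re [s' [b5 c5 f5 v5]]] := IHl _ _ _ E2 lo r Rd r5 rlo (frame_one f4) ltac:(lia) hl' ha' hr'.
exists Re, ((6 + (2 + (s + 1))) + s' + 3); split=> //.
- apply: bs_whileS b5; first by rewrite hr; have := rep_ge h3; lia.
  by apply: (bs_seq b1); apply: (bs_seq b2); apply: (bs_seq b3).
- lia.
- exact: frame_trans fc f5.
Qed.

Lemma implements_fold f : implements f -> implements (Tfold f).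
Proof.
move=> IHf v w n E lo r R r5 /= rlo R1 R2 hv.
have [acc [l ?]] : exists a l, v = VP a l by inversion E; do 2 eexists.
subst v; case: hv => h1 h2 [h3 h4].
pose Ra := foldl exec1 R [:: ILoad r.+1 r; IAdd r r 1; ILoad r r; ILoad r.+2 r].
have b1 : bs (Cblk [:: ILoad r.+1 r; IAdd r r 1; ILoad r r; ILoad r.+2 r]) R Ra 4
  by exact: (@bs_blk [:: _; _; _; _]).
have Rae i : i <> r -> i <> r.+1 -> i <> r.+2 -> Ra i = R i by move=> *; rewrite /Ra /= !upd_ne.
have f1 : frame lo r R Ra.
  by apply: frame_blk => // [||i hi]; [lia | lia | apply: Rae; lia].
have Rar1 : Ra r.+1 = R (R r). rewrite /Ra /=; do 3 (rewrite upd_ne; last by lia). by rewrite upd_eq.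
have Rar : Ra r = R (R r).+1.
  rewrite /Ra /= upd_ne; last by lia.
  rewrite !upd_eq !(@upd_ne _ _ _ 1); try lia.
  rewrite (@upd_ne R r.+1 _ r); last by lia.
  by rewrite R1 addn1 !upd_ne //; lia.
have Rar2 : Ra r.+2 = Ra (Ra r).
  have [hg1 hg2] := rep_ge h4.
  rewrite Rar (Rae (R (R r).+1)); [|lia|lia|lia].
  rewrite {1}/Ra /= upd_eq; move: Rar; rewrite {1}/Ra /= upd_ne; last by lia.
  by move=> ->; do 3 (rewrite upd_ne; last by lia).
have hp1 := frame_hp f1.
have [|||R' [s [b2 c2 f2 v2]]] := fold_loop IHf E r5 rlo (frame_one f1) _ _ _ Rar2; first by lia.
- by rewrite Rar; apply: rep_frame f1 h4.
- by rewrite Rar1; apply: rep_frame f1 h3.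
have hp2 := frame_hp f2.
have [||||R'' [b3 f3 v3 _]] := @mov_spec lo R' r r.+1 w r (frame_one f2) _ _ _ _ v2; try lia.
exists R'', (4 + (s + 2)); split=> //.
- by apply: (bs_seq b1); apply: (bs_seq b2).
- lia.
- by apply: frame_trans (frame_trans _ f1 f2) f3.
Qed.

Lemma comp_correct t : implements t.
Proof.
elim: t => [|g IHg f IHf|f IHf g IHg| | |k| | | |c IHc f IHf g IHg|f IHf].
- move=> v w n E; inversion_clear E => lo r R r5 rlo R1 R2 hv.
  by exists R, 0; split=> //; exact: (@bs_blk [::]).
- exact: implements_comp.
- exact: implements_pair.
- exact: implements_fst.
- exact: implements_snd.
- exact: implements_const.
- move=> v w n E; inversion_clear E => lo r R r5 rlo R1 R2 hv.
  exact: (@implements_arith Tadd (IAdd 4 3 4) addn).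
- move=> v w n E; inversion_clear E => lo r R r5 rlo R1 R2 hv.
  exact: (@implements_arith Tsub (ISub 4 3 4) subn).
- exact: implements_isatom.
- exact: implements_if.
- exact: implements_fold.
Qed.

(** * Reading the input and writing the output *)

Definition vseq (l : seq value) : value := foldr VP (VN 0) l.

(** At the start the input fills the registers from 1 on, and only register 0, which holds its
    length, can be altered. Doubling it in place yields an address beyond the input and beyond all
    registers that the code uses. *)
Definition doubling n := nseq n (IAdd 0 0 0).

Lemma doubling_spec n R : foldl exec1 R (doubling n) 0 = 2 ^ n * R 0 /\
  forall i, i <> 0 -> foldl exec1 R (doubling n) i = R i.
Proof.
elim: n R => [|n IH] R /=; first by rewrite mul1n.
have [-> h2] := IH (upd R 0 (R 0 + R 0)); split; first by rewrite upd_eq expnS; lia.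
by move=> i i0; rewrite h2 // upd_ne.
Qed.

(** Straight-line code, as no register is free for a loop counter: 0 is the target address and 1 the
    constant. *)
Fixpoint save_low j n : seq instr :=
  if n is n'.+1 then [:: IAdd 0 0 1, IStore 0 j & save_low j.+1 n'] else [::].

Lemma save_low_spec n j R : R 1 = 1 -> 0 < j -> 0 < n -> j + n <= R 0 ->
  let R' := foldl exec1 R (save_low j n) in
  [/\ R' 0 = R 0 + n, forall i, i < n -> R' (R 0 + i.+1) = R (j + i) &
      forall i, i <> 0 -> i <= R 0 \/ R 0 + n < i -> R' i = R i].
Proof.
move=> R1 j0 _; elim: n j R R1 j0 => [|n IH] j R R1 j0 h /=.
  by rewrite addn0.
set S := upd (upd _ _ _) _ _.
have S0 : S 0 = R 0 + 1 by rewrite /S upd_eq R1 upd_ne ?upd_eq //; lia.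
have Se i : i <> 0 -> i <> (R 0).+1 -> S i = R i.
  by move=> i0 iR; rewrite /S upd_eq R1 !upd_ne //; lia.
have Sn : S (R 0).+1 = R j by rewrite /S upd_eq R1 addn1 upd_eq upd_ne //; lia.
have [||h1 h2 h3] := IH j.+1 S _ isT; rewrite ?S0 ?Se //; try lia.
split; first by rewrite h1 S0; lia.
- move=> [|i] hi.
    by rewrite addn1 addn0 h3 ?Sn //; lia.
  have := h2 i hi; rewrite S0 (_ : R 0 + 1 + i.+1 = R 0 + i.+2); last by lia.
  by move=> ->; rewrite addSnnS Se //; lia.
- by move=> i i0 hi; rewrite h3; [rewrite Se; lia | lia | lia].
Qed.

Fixpoint load_low n : seq instr :=
  if n is n'.+1 then [:: ILoad n'.+2 0, ISub 0 0 1 & load_low n'] else [::].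

Lemma load_low_spec n O R : R 1 = 1 -> R 0 = O + n.+1 -> n < O ->
  let R' := foldl exec1 R (load_low n) in
  [/\ R' 0 = O.+1, forall i, 2 <= i <= n.+1 -> R' i = R (O + i) &
      forall i, i <> 0 -> ~~ (2 <= i <= n.+1) -> R' i = R i].
Proof.
elim: n R => [|n IH] R R1 R0 h /=; first by split=> //; [lia | move=> i; lia].
set S := upd _ 0 _.
have S0 : S 0 = O + n.+1 by rewrite /S upd_eq !upd_ne // R0 R1; lia.
have Se i : i <> 0 -> i <> n.+2 -> S i = R i by move=> *; rewrite /S !upd_ne.
have Sn : S n.+2 = R (O + n.+2) by rewrite /S upd_ne // upd_eq R0.
have S1 : S 1 = 1 by rewrite Se.
have [|h1 h2 h3] := IH S S1 S0; first by lia.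
split=> // [i hi|i i0 hi].
  case: (leqP i n.+1) => hi'; first by rewrite h2 ?Se //; lia.
  by rewrite h3; [rewrite (_ : i = n.+2) ?Sn //; lia | lia | lia].
by rewrite h3; [rewrite Se; lia | lia | lia].
Qed.

(** Memory is read downwards so that consing yields the words in order. Register 8 is the cursor, 9
    the counter, 6 the list and 7 the running sum. *)
Definition collect_body := Cseqs [::
  Cblk [:: ISub 9 9 1; ILoad 4 8; ISub 8 8 1; IAdd 7 7 4; IConst 3 0];
  alloc 11 3 4; alloc 6 11 6].

(** A variant of [frame] for hand-written loops on fixed registers, where the altered registers are
    listed explicitly. *)
Record keeps (lo : nat) (used : seq nat) (R R' : nat -> nat) : Prop := Keeps {
  keeps_one : R' 1 = 1;
  keeps_hp : R 2 <= R' 2;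
  keeps_low : forall i, 2 < i < lo -> i \notin used -> R' i = R i;
  keeps_heap : forall i, lo <= i < R 2 -> R' i = R i }.

Lemma keeps_trans lo us1 us2 us3 R R1 R2 : {subset us1 <= us3} -> {subset us2 <= us3} ->
  keeps lo us1 R R1 -> keeps lo us2 R1 R2 -> keeps lo us3 R R2.
Proof.
move=> s1 s2 [a1 a2 a3 a4] [b1 b2 b3 b4]; split=> //; first by lia.
  move=> i hi hu; rewrite b3 //; last by apply: contra hu; apply: s2.
  by apply: a3 => //; apply: contra hu; apply: s1.
by move=> i hi; rewrite b4; [apply: a4 | lia].
Qed.

Lemma rep_keeps lo us R R' p v : keeps lo us R R' -> rep lo (R 2) R p v -> rep lo (R' 2) R' p v.
Proof. by case=> _ h _ h'; apply: rep_ext. Qed.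

Lemma keeps_frame lo d R R' : frame lo 5 R R' ->
  (forall i, 2 < i < lo -> i <> d -> R' i = R i) -> keeps lo [:: d] R R'.
Proof.
move=> [h1 h2 h3 h4] h; split=> // i hi; rewrite inE => /eqP id; exact: h.
Qed.

Lemma keeps_blk lo us R R' : R 1 = 1 -> 5 <= lo ->
  (forall i, i = 1 \/ i = 2 \/ (2 < i /\ i \notin us) -> R' i = R i) ->
  all (fun i => i < lo) us -> keeps lo us R R'.
Proof.
move=> h1 hlo h hus; split; first by rewrite h //; lia.
- by rewrite h //; lia.
- by move=> i hi iu; apply: h; right; right; split=> //; lia.
- move=> i hi; apply: h; right; right; split; first by lia.
  by apply/negP => /(allP hus); lia.
Qed.

Lemma alloc_pair' lo R d a b va vb : R 1 = 1 -> 5 <= lo <= R 2 ->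
  2 < a < lo -> 2 < b < lo -> 5 <= d < lo ->
  rep lo (R 2) R (R a) va -> rep lo (R 2) R (R b) vb ->
  exists R', [/\ bs (alloc d a b) R R' 6, keeps lo [:: d] R R' & rep lo (R' 2) R' (R' d) (VP va vb)].
Proof.
move=> R1 hlo ha hb hd hva hvb.
have [|R' [h1 h2 h3 h4]] := @alloc_pair lo R 5 d a b va vb R1 hlo ha hb _ hd hva hvb; first by lia.
by exists R'; split=> //; apply: keeps_frame.
Qed.

Lemma alloc_atom' lo R d n : R 1 = 1 -> 5 <= lo <= R 2 -> 5 <= d < lo -> R 3 = 0 -> R 4 = n ->
  exists R', [/\ bs (alloc d 3 4) R R' 6, keeps lo [:: d] R R' & rep lo (R' 2) R' (R' d) (VN n)].
Proof.
move=> R1 hlo hd h3 h4.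
have [|R' [k1 k2 k3 k4]] := @alloc_atom lo R 5 d n R1 hlo _ hd h3 h4; first by lia.
by exists R'; split=> //; apply: keeps_frame.
Qed.

Lemma collect_loop lo c : forall R L p, R 1 = 1 -> lo <= R 2 -> R 9 = c -> R 8 = p + c ->
  20 <= p -> p + c < lo -> rep lo (R 2) R (R 6) L ->
  exists R' s, [/\ bs (Cwhile 9 collect_body) R R' s, s <= 20 * c.+1,
    keeps lo [:: 3; 4; 6; 7; 8; 9; 11] R R',
    rep lo (R' 2) R' (R' 6) (foldr VP L [seq VN (R i) | i <- iota p.+1 c]) &
    R' 7 = R 7 + sumn [seq R i | i <- iota p.+1 c]].
Proof.
elim: c => [|c IH] R L p R1 R2 R9 R8 hp hlo hL.
  exists R, 1; split=> //; first by apply: bs_while0; rewrite R9.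
  by rewrite addn0.
pose l := [:: ISub 9 9 1; ILoad 4 8; ISub 8 8 1; IAdd 7 7 4; IConst 3 0].
pose Ra := foldl exec1 R l.
have b1 : bs (Cblk l) R Ra 5 by exact: (@bs_blk l).
have Rae i : i \notin [:: 3; 4; 7; 8; 9] -> Ra i = R i.
  by rewrite !inE !negb_or => /and5P[/eqP ? /eqP ? /eqP ? /eqP ? /eqP ?]; rewrite /Ra /= !upd_ne.
have Ra4 : Ra 4 = R (p + c.+1) by rewrite /Ra /= 3?upd_ne // upd_eq [upd _ _ _ 8]upd_ne // R8 upd_ne //; lia.
have k1 : keeps lo [:: 3; 4; 7; 8; 9] R Ra.
  apply: keeps_blk => //; first by lia.
    by move=> i [->|[->|[_ h]]]; apply: Rae.
  by apply/allP => i; rewrite !inE; lia.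
have hL1 := rep_keeps k1 hL.
have hk1 := keeps_hp k1.
have [Rb [b2 k2 v2]] := @alloc_atom' lo Ra 11 _ (keeps_one k1) ltac:(lia) ltac:(lia) (erefl _) Ra4.
have hL2 := rep_keeps k2 hL1; have hk2 := keeps_hp k2.
rewrite -(Rae 6) // -(keeps_low k2 (_ : 2 < 6 < lo)) // in hL2; last by lia.
have [Rc [b3 k3 v3]] := @alloc_pair' lo Rb 6 11 6 _ _ (keeps_one k2) ltac:(lia) ltac:(lia) ltac:(lia)
   ltac:(lia) v2 hL2.
have hk3 := keeps_hp k3.
have k : keeps lo [:: 3; 4; 6; 7; 8; 9; 11] R Rc.
  apply: (@keeps_trans lo [:: 3; 4; 7; 8; 9; 11] [:: 6]) (keeps_trans _ _ k1 k2) k3;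
   by move=> i; rewrite !inE; lia.
have Rce i : i \in [:: 7; 8; 9] -> Rc i = Ra i.
  move=> hi; rewrite (keeps_low k3) ?(keeps_low k2) //; move: hi; rewrite !inE; lia.
have Rc9 : Rc 9 = c by rewrite Rce // /Ra /= 4?upd_ne // upd_eq R9 R1; lia.
have Rc8 : Rc 8 = p + c by rewrite Rce // /Ra /= 2?upd_ne // upd_eq !upd_ne // R8 R1; lia.
have Rc7 : Rc 7 = R 7 + R (p + c.+1).
  rewrite Rce // /Ra /= upd_ne // upd_eq.
  rewrite [upd _ 8 _ 4]upd_ne // upd_eq 3?upd_ne // [upd R 9 _ 8]upd_ne // R8.
  by rewrite upd_ne //; lia.
pose Rd := upd Rc 0 0.
have k4 : keeps lo [::] Rc Rd.
  apply: keeps_blk (keeps_one k) _ _ _ => //; first by lia.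
  by move=> i [->|[->|[h _]]]; rewrite /Rd upd_ne //; lia.
have := IH Rd (VP (VN (R (p + c.+1))) L) p (keeps_one k4).
rewrite /Rd !upd_ne // => /(_ _ Rc9 Rc8 hp) [||| R' [s [b5 c5 k5 v5 e5]]]; try lia.
  exact: rep_keeps k4 v3.
have kk : keeps lo [:: 3; 4; 6; 7; 8; 9; 11] R Rd by apply: keeps_trans k k4.
have em : [seq Rd i | i <- iota p.+1 c] = [seq R i | i <- iota p.+1 c].
  apply/eq_in_map => i; rewrite mem_iota => hi; apply: (keeps_low kk); first by lia.
  by rewrite !inE; lia.
have ei : iota p.+1 c.+1 = iota p.+1 c ++ [:: p + c.+1].
  by have := iotaD p.+1 c 1; rewrite addn1 addSnnS.
exists R', (5 + (6 + 6) + s + 3); split.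
- apply: bs_whileS b5; first by lia.
  by apply: (bs_seq b1); apply: (bs_seq b2).
- lia.
- exact: keeps_trans kk k5.
- rewrite ei map_cat foldr_cat /=.
  by move: v5; rewrite (map_comp VN Rd) -/Rd em -map_comp.
- by rewrite ei map_cat sumn_cat /= e5 -/Rd em Rc7; lia.
Qed.

Lemma rep_keeps_reg lo us R R' r v : keeps lo us R R' -> 2 < r < lo -> r \notin us ->
  rep lo (R 2) R (R r) v -> rep lo (R' 2) R' (R' r) v.
Proof. by move=> k hr hu h; rewrite (@keeps_low _ _ _ _ k r) //; apply: rep_keeps k h. Qed.

Local Notation carry r k h := (@rep_keeps_reg _ _ _ _ r _ k ltac:(lia) isT h) (only parsing).

Lemma keeps_zero lo R : R 1 = 1 -> 5 <= lo -> keeps lo [::] R (upd R 0 0).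
Proof. by move=> R1 hlo; apply: keeps_blk => // i [->|[->|[h _]]]; rewrite upd_ne //; lia. Qed.

Ltac keeps_regs k R' := apply: (keeps_blk k) => //=; try lia;
  move=> i [->|[->|[_]]]; unfold R'; rewrite /= ?inE => *; rewrite !upd_ne //; lia.

Definition unary_body := Cseqs [:: alloc 12 13 12; Cblk [:: ISub 9 9 1]].

Lemma unary_loop lo c : forall R L, R 1 = 1 -> 20 <= lo <= R 2 -> R 9 = c ->
  rep lo (R 2) R (R 13) (VN 0) -> rep lo (R 2) R (R 12) L ->
  exists R' s, [/\ bs (Cwhile 9 unary_body) R R' s, s <= 20 * c.+1, keeps lo [:: 9; 12] R R' &
    rep lo (R' 2) R' (R' 12) (foldr VP L (nseq c (VN 0)))].
Proof.
elim: c => [|c IH] R L R1 R2 R9 h13 h12.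
  by exists R, 1; split=> //; apply: bs_while0; rewrite R9.
have [Ra [b1 k1 v1]] := @alloc_pair' lo R 12 13 12 _ _ R1 ltac:(lia) ltac:(lia) ltac:(lia) ltac:(lia)
  h13 h12.
pose Rb := foldl exec1 Ra [:: ISub 9 9 1].
have b2 : bs (Cblk [:: ISub 9 9 1]) Ra Rb 1 by exact: (@bs_blk [:: _]).
have k2 : keeps lo [:: 9] Ra Rb.
  apply: keeps_blk (keeps_one k1) _ _ _ => //=; try lia.
  by move=> i [->|[->|[_]]]; rewrite /Rb /= ?inE => *; rewrite upd_ne //; lia.
have hp1 := keeps_hp k1; have hp2 := keeps_hp k2.
have k3 : keeps lo [:: 9; 12] R (upd Rb 0 0).
  apply: (@keeps_trans lo [:: 12] [:: 9]) k1 _; try by move=> i; rewrite !inE; lia.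
  by apply: keeps_trans k2 (keeps_zero (keeps_one k2) _) => //; lia.
have hp3 := keeps_hp k3.
have [||||R' [s [b4 c4 k4 v4]]] := IH (upd Rb 0 0) (VP (VN 0) L) (keeps_one k3); first by lia.
- rewrite upd_ne // /Rb /= upd_eq (keeps_one k1) (keeps_low k1) //; last by lia.
  by rewrite R9; lia.
- by rewrite (@keeps_low _ _ _ _ k3 13) //; [apply: rep_keeps k3 h13 | lia].
- apply: rep_keeps (keeps_zero (keeps_one k2) _) _; first by lia.
  have -> : upd Rb 0 0 12 = Ra 12 by rewrite /Rb /= !upd_ne.
  exact: rep_keeps k2 v1.
exists R', (6 + 1 + s + 3); split; last first.
- by move: v4; congr rep; elim: (c) => //= n <-.
- by apply: keeps_trans k3 k4.
- by lia.
- apply: bs_whileS b4; first by lia.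
  exact: bs_seq b1 b2.
Qed.

Definition powers_body := Cseqs [:: Cblk [:: IConst 3 0; IAdd 4 8 3]; alloc 11 3 4; alloc 14 11 14;
  Cblk [:: IAdd 8 8 8; ISub 9 10 8]].

(** Register 9 holds the truncated difference [m.+1 - 2 ^ e], which is nonzero exactly while
    [2 ^ e <= m], so it can serve as the loop condition. *)
Lemma powers_loop lo c : forall R L e m, R 1 = 1 -> 20 <= lo <= R 2 -> R 8 = 2 ^ e -> R 10 = m.+1 ->
  R 9 = m.+1 - 2 ^ e -> m < 2 ^ (e + c) -> (forall i, i < c -> 2 ^ (e + i) <= m) ->
  rep lo (R 2) R (R 14) L ->
  exists R' s, [/\ bs (Cwhile 9 powers_body) R R' s, s <= 20 * c.+1,
    keeps lo [:: 3; 4; 8; 9; 11; 14] R R' &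
    rep lo (R' 2) R' (R' 14) (foldl (fun a n => VP (VN (2 ^ n)) a) L (iota e c))].
Proof.
elim: c => [|c IH] R L e m R1 R2 R8 R10 R9 hm hc h14.
  exists R, 1; split=> //; apply: bs_while0; rewrite R9; rewrite addn0 in hm; lia.
have he : 2 ^ e <= m by have := hc 0 isT; rewrite addn0.
pose Ra := foldl exec1 R [:: IConst 3 0; IAdd 4 8 3].
have b1 : bs (Cblk [:: IConst 3 0; IAdd 4 8 3]) R Ra 2 by exact: (@bs_blk [:: _; _]).
have k1 : keeps lo [:: 3; 4] R Ra.
  by keeps_regs (R1) Ra.
have Ra4 : Ra 4 = 2 ^ e by rewrite /Ra /= upd_eq upd_ne // upd_eq R8 addn0.
have hp1 := keeps_hp k1.
have [Rb [b2 k2 v2]] := @alloc_atom' lo Ra 11 _ (keeps_one k1) ltac:(lia) ltac:(lia) (erefl _) Ra4.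
have hp2 := keeps_hp k2.
have k12 : keeps lo [:: 3; 4; 11] R Rb.
  by apply: keeps_trans k1 k2 => i; rewrite !inE; lia.
have h14' := rep_keeps k12 h14.
rewrite -(keeps_low k12 (_ : 2 < 14 < lo)) // in h14'; last by lia.
have [Rc [b3 k3 v3]] := @alloc_pair' lo Rb 14 11 14 _ _ (keeps_one k2) ltac:(lia) ltac:(lia) ltac:(lia)
   ltac:(lia) v2 h14'.
have hp3 := keeps_hp k3.
have k13 : keeps lo [:: 3; 4; 11; 14] R Rc.
  by apply: keeps_trans k12 k3 => i; rewrite !inE; lia.
pose Rd := foldl exec1 Rc [:: IAdd 8 8 8; ISub 9 10 8].
have b4 : bs (Cblk [:: IAdd 8 8 8; ISub 9 10 8]) Rc Rd 2 by exact: (@bs_blk [:: _; _]).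
have k4 : keeps lo [:: 8; 9] Rc Rd.
  by keeps_regs (keeps_one k3) Rd.
have Rc8 : Rc 8 = 2 ^ e by rewrite (keeps_low k13) //; lia.
have Rc10 : Rc 10 = m.+1 by rewrite (keeps_low k13) //; lia.
have hp4 := keeps_hp k4.
have k5 := keeps_zero (keeps_one k4) (_ : 5 <= lo).
have {}k5 : keeps lo [::] Rd (upd Rd 0 0) by apply: k5; lia.
have k : keeps lo [:: 3; 4; 8; 9; 11; 14] R (upd Rd 0 0).
  apply: keeps_trans k13 (@keeps_trans lo [:: 8; 9] [::] [:: 8; 9] _ _ _ _ _ k4 k5) => // i;
  by rewrite !inE; lia.
have hp5 := keeps_hp k.
have [|||||||R' [s [b6 c6 k6 v6]]] := IH (upd Rd 0 0) (VP (VN (2 ^ e)) L) e.+1 m (keeps_one k).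
- by lia.
- by rewrite upd_ne // /Rd /= upd_ne // upd_eq Rc8 expnS; lia.
- by rewrite upd_ne // /Rd /= !upd_ne.
- by rewrite upd_ne // /Rd /= upd_eq upd_eq upd_ne // Rc8 Rc10 expnS; lia.
- by rewrite addSnnS.
- by move=> i hi; rewrite addSnnS; apply: hc.
- apply: rep_keeps k5 _.
  have -> : upd Rd 0 0 14 = Rc 14 by rewrite /Rd /= !upd_ne.
  exact: rep_keeps k4 v3.
exists R', (2 + (6 + (6 + 2)) + s + 3); split=> //.
- apply: bs_whileS b6; first by lia.
  by apply: (bs_seq b1); apply: (bs_seq b2); apply: (bs_seq b3).
- lia.
- by apply: keeps_trans k k6.
Qed.

(** The address [B] is recovered from register 0, and the heap starts at 2[B], above the saved
    words. The words from [m0 + 1] to [B - 1] are collected first, and the saved low words are then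
    put in front of them. Addresses past the input contain 0, which is where the padding of the
    token list comes from. *)
Definition prelude m0 := Cseqs [::
  Cblk [:: IConst 3 m0.-1; ISub 5 0 3; IAdd 2 5 5; IConst 7 0; IConst 3 0; IConst 4 0];
  alloc 13 3 4;
  Cblk [:: IConst 4 0; IAdd 6 13 4; IAdd 12 13 4; IAdd 14 13 4; ISub 8 5 1; IConst 3 m0; ISub 9 8 3];
  Cwhile 9 collect_body;
  Cblk [:: IConst 9 m0; IAdd 8 5 9; ISub 8 8 1];
  Cwhile 9 collect_body;
  Cblk [:: ILoad 9 5];
  Cwhile 9 unary_body;
  Cblk [:: IConst 8 1; IAdd 10 7 1; ISub 9 10 8];
  Cwhile 9 powers_body;
  alloc 12 12 14; alloc 20 12 6].

Definition powers_upto m := rev [seq 2 ^ n | n <- iota 0 (trunc_log 2 m).+1].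
Definition in_value k m toks :=
  VP (VP (vseq (nseq k (VN 0))) (vseq (map VN (powers_upto m)))) (vseq (map VN toks)).

Lemma prelude_spec m0 B T R : 20 <= m0 < B -> R 0 = B + m0.-1 -> R 1 = 1 -> 0 < T 1 ->
  (forall j, j < m0 -> R (B + j) = T j.+1) -> (forall i, m0 < i < B -> R i = T i) ->
  let toks := [seq T i | i <- iota 1 B.-1] in
  exists R' s, [/\ bs (prelude m0) R R' s,
    s <= 20 * (B + T 1 + trunc_log 2 (sumn toks) + 10), R' 1 = 1, B + B <= R' 2 &
    rep (B + B) (R' 2) R' (R' 20) (in_value (T 1) (sumn toks) toks)].
Proof.
move=> hB R0 R1 T1 hlow hhigh toks.
set lo := B + B.
pose l1 := [:: IConst 3 m0.-1; ISub 5 0 3; IAdd 2 5 5; IConst 7 0; IConst 3 0; IConst 4 0].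
pose Ra := foldl exec1 R l1.
have b1 : bs (Cblk l1) R Ra 6 by exact: (@bs_blk l1).
have Ra5 : Ra 5 = B by rewrite /Ra /= /upd /= R0; lia.
have Ra2 : Ra 2 = lo by rewrite /Ra /= /upd /= R0 /lo; lia.
have Ra7 : Ra 7 = 0 by [].
have Ra3 : Ra 3 = 0 by [].
have Ra4 : Ra 4 = 0 by [].
have Ra1 : Ra 1 = 1 by [].
have Rae i : 7 < i -> Ra i = R i by move=> hi; rewrite /Ra /= !upd_ne //; lia.
have [Rb [b2 k2 v2]] := @alloc_atom' lo Ra 13 _ Ra1 ltac:(lia) ltac:(lia) Ra3 Ra4.
have hp2 := keeps_hp k2.
pose l3 := [:: IConst 4 0; IAdd 6 13 4; IAdd 12 13 4; IAdd 14 13 4; ISub 8 5 1; IConst 3 m0; ISub 9 8 3].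
pose Rc := foldl exec1 Rb l3.
have b3 : bs (Cblk l3) Rb Rc 7 by exact: (@bs_blk l3).
have Rb5 : Rb 5 = B by rewrite (keeps_low k2) //; lia.
have Rc6 : Rc 6 = Rb 13 by rewrite /Rc /= /upd /= addn0.
have Rc12 : Rc 12 = Rb 13 by rewrite /Rc /= /upd /= addn0.
have Rc14 : Rc 14 = Rb 13 by rewrite /Rc /= /upd /= addn0.
have Rc8 : Rc 8 = B.-1 by rewrite /Rc /= /upd /= Rb5 (keeps_one k2); lia.
have Rc9 : Rc 9 = B.-1 - m0 by rewrite /Rc /= /upd /= Rb5 (keeps_one k2); lia.
have k3 : keeps lo [:: 3; 4; 6; 8; 9; 12; 14] Rb Rc.
  by keeps_regs (keeps_one k2) Rc.
have hp3 := keeps_hp k3.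
have nil3 := rep_keeps k3 v2.
have Rc7 : Rc 7 = 0 by rewrite (@keeps_low _ _ _ _ k3 7) ?(@keeps_low _ _ _ _ k2 7) //; lia.
have [|||||Rd [s4 [b4 c4 k4 v4 e4]]] := @collect_loop lo (B.-1 - m0) Rc (VN 0) m0 (keeps_one k3) _ Rc9;
  try lia.
  by rewrite Rc6.
have hp4 := keeps_hp k4.
have nil12 : rep lo (Rc 2) Rc (Rc 12) (VN 0) by rewrite Rc12.
have nil14 : rep lo (Rc 2) Rc (Rc 14) (VN 0) by rewrite Rc14.
have nil13 : rep lo (Rc 2) Rc (Rc 13) (VN 0) by rewrite (@keeps_low _ _ _ _ k3 13) //; lia.
have d12 := carry 12 k4 nil12.
have d13 := carry 13 k4 nil13.
have d14 := carry 14 k4 nil14.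
have Rd5 : Rd 5 = B by rewrite (@keeps_low _ _ _ _ k4 5) ?(@keeps_low _ _ _ _ k3 5) //; lia.
pose l5 := [:: IConst 9 m0; IAdd 8 5 9; ISub 8 8 1].
pose Re := foldl exec1 Rd l5.
have b5 : bs (Cblk l5) Rd Re 3 by exact: (@bs_blk l5).
have k5 : keeps lo [:: 8; 9] Rd Re.
  by keeps_regs (keeps_one k4) Re.
have hp5 := keeps_hp k5.
have Re9 : Re 9 = m0 by [].
have Re8 : Re 8 = B.-1 + m0 by rewrite /Re /= /upd /= Rd5 (keeps_one k4); lia.
have e6 := carry 6 k5 v4.
have [|||Rf [s6 [b6 c6 k6 v6 e7]]] := @collect_loop lo m0 Re _ B.-1 (keeps_one k5) _ Re9 Re8 _ _ e6;
  try lia.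
have hp6 := keeps_hp k6.
have k56 : keeps lo [:: 3; 4; 6; 7; 8; 9; 11] Rd Rf by apply: keeps_trans k5 k6 => i; rewrite !inE; lia.
have f12 := carry 12 k56 d12.
have f13 := carry 13 k56 d13.
have f14 := carry 14 k56 d14.
have mem i : 15 <= i < lo -> [/\ Rc i = R i, Rd i = R i, Re i = R i & Rf i = R i].
  move=> hi.
  have Ec : Rc i = R i.
    by rewrite (@keeps_low _ _ _ _ k3 i) ?(@keeps_low _ _ _ _ k2 i) ?Rae ?inE //; lia.
  have Ed : Rd i = R i by rewrite (@keeps_low _ _ _ _ k4 i) ?inE //; lia.
  have Ee : Re i = R i by rewrite (@keeps_low _ _ _ _ k5 i) ?inE //; lia.
  by split=> //; rewrite (@keeps_low _ _ _ _ k6 i) ?inE //; lia.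
have toksE : toks = [seq Re i | i <- iota B m0] ++ [seq Rc i | i <- iota m0.+1 (B.-1 - m0)].
  rewrite /toks [in LHS](_ : B.-1 = m0 + (B.-1 - m0)); last by lia.
  rewrite iotaD map_cat add1n; congr (_ ++ _).
    rewrite (_ : iota B m0 = [seq B + i | i <- iota 0 m0]); last by rewrite -iotaDl addn0.
    rewrite (iotaDl 1 0 m0) -!map_comp; apply/eq_in_map => i; rewrite mem_iota => hi /=.
    by have [|_ _ -> _] := mem (B + i); [lia | rewrite hlow ?add1n //; lia].
  apply/eq_in_map => i; rewrite mem_iota => hi.
  by have [|-> _ _ _] := mem i; [lia | rewrite hhigh //; lia].
have Rf7 : Rf 7 = sumn toks.
  rewrite e7 toksE sumn_cat (@keeps_low _ _ _ _ k5 7) //; last by lia.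
  by rewrite e4 Rc7 add0n addnC (_ : B.-1.+1 = B) //; lia.
have f6 : rep lo (Rf 2) Rf (Rf 6) (vseq (map VN toks)).
  move: v6; rewrite toksE map_cat /vseq foldr_cat -!map_comp (_ : B.-1.+1 = B) //; lia.
have Rf5 : Rf 5 = B by rewrite (@keeps_low _ _ _ _ k56 5) //; lia.
pose Rg := foldl exec1 Rf [:: ILoad 9 5].
have b7 : bs (Cblk [:: ILoad 9 5]) Rf Rg 1 by exact: (@bs_blk [:: _]).
have k7 : keeps lo [:: 9] Rf Rg.
  by keeps_regs (keeps_one k6) Rg.
have hp7 := keeps_hp k7.
have Rg9 : Rg 9 = T 1.
  rewrite /Rg /= /upd /= Rf5; have [|_ _ _ ->] := mem B; first by lia.
  by have := hlow 0; rewrite addn0 => ->; lia.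
have g13 := carry 13 k7 f13.
have g12 := carry 12 k7 f12.
have [|Rh [s8 [b8 c8 k8 v8]]] := @unary_loop lo (T 1) Rg _ (keeps_one k7) _ Rg9 g13 g12; first by lia.
have hp8 := keeps_hp k8.
have k78 : keeps lo [:: 9; 12] Rf Rh by apply: keeps_trans k7 k8 => i; rewrite !inE; lia.
pose l9 := [:: IConst 8 1; IAdd 10 7 1; ISub 9 10 8].
pose Ri := foldl exec1 Rh l9.
have b9 : bs (Cblk l9) Rh Ri 3 by exact: (@bs_blk l9).
have k9 : keeps lo [:: 8; 9; 10] Rh Ri.
  by keeps_regs (keeps_one k8) Ri.
have hp9 := keeps_hp k9.
have Rh7 : Rh 7 = sumn toks by rewrite (@keeps_low _ _ _ _ k78 7) //; lia.
have Ri8 : Ri 8 = 2 ^ 0 by [].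
have Ri10 : Ri 10 = (sumn toks).+1 by rewrite /Ri /= /upd /= Rh7 (keeps_one k8) addn1.
have Ri9 : Ri 9 = (sumn toks).+1 - 2 ^ 0 by rewrite /Ri /= /upd /= Rh7 (keeps_one k8) addn1.
have k79 : keeps lo [:: 8; 9; 10; 12] Rf Ri by apply: keeps_trans k78 k9 => i; rewrite !inE; lia.
have i14 := carry 14 k79 f14.
have i6 := carry 6 k79 f6.
have i12 := carry 12 k9 v8.
have sum0 : 0 < sumn toks.
  by rewrite /toks (_ : B.-1 = (B.-2).+1) /=; lia.
have [|||Rj [s10 [b10 c10 k10 v10]]] := @powers_loop lo (trunc_log 2 (sumn toks)).+1 Ri _ 0 (sumn toks)
  (keeps_one k9) _ Ri8 Ri10 Ri9 _ _ i14; first by lia.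
- by rewrite add0n; apply: trunc_log_ltn.
- by move=> i hi; rewrite add0n; apply: leq_trans (trunc_logP (isT : 1 < 2) sum0); rewrite leq_exp2l.
have hp10 := keeps_hp k10.
have j6 := carry 6 k10 i6.
have j12 := carry 12 k10 i12.
have [Rk [b11 k11 v11]] := @alloc_pair' lo Rj 12 12 14 _ _ (keeps_one k10) ltac:(lia) ltac:(lia)
  ltac:(lia) ltac:(lia) j12 v10.
have hp11 := keeps_hp k11.
have l6 := carry 6 k11 j6.
have [Rl [b12 k12 v12]] := @alloc_pair' lo Rk 20 12 6 _ _ (keeps_one k11) ltac:(lia) ltac:(lia)
  ltac:(lia) ltac:(lia) v11 l6.
have hp12 := keeps_hp k12.
exists Rl, (6 + (6 + (7 + (s4 + (3 + (s6 + (1 + (s8 + (3 + (s10 + (6 + 6))))))))))); split.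
- apply: (bs_seq b1); apply: (bs_seq b2); apply: (bs_seq b3); apply: (bs_seq b4).
  apply: (bs_seq b5); apply: (bs_seq b6); apply: (bs_seq b7); apply: (bs_seq b8).
  by apply: (bs_seq b9); apply: (bs_seq b10); apply: (bs_seq b11).
- lia.
- exact: keeps_one k12.
- lia.
- move: v12; rewrite /in_value /vseq; congr (rep _ _ _ _ (VP (VP _ _) _)).
  rewrite /powers_upto; elim: (iota _ _) (VN 0) => // n l IH v.
  by rewrite map_cons rev_cons map_rcons foldr_rcons -IH.
Qed.

(* [m0] exceeds every register used by the code. *)
Definition setup m0 : seq instr :=
  doubling m0 ++ [:: IStore 0 1; IConst 1 1] ++ save_low 2 m0.-1.

Lemma setup_spec m0 x : 0 < size x -> 0 < m0 ->
  let B := 2 ^ m0 * size x in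
  let R := foldl exec1 (regs (init_state x)) (setup m0) in
  let T i := nth 0 x i.-1 in
  [/\ m0 < B, R 0 = B + m0.-1, R 1 = 1, forall j, j < m0 -> R (B + j) = T j.+1 &
      forall i, m0 < i < B -> R i = T i].
Proof.
move=> x0 m00 B R T; rewrite {}/R /setup foldl_cat.
have [h0 hi] := doubling_spec m0 (regs (init_state x)).
move: (foldl _ _ _) h0 hi => S; rewrite -/B => S0 Si.
have hB : m0 < B by apply: leq_trans (ltn_expl m0 (isT : 1 < 2)) _; rewrite leq_pmulr.
have ST i : 0 < i -> S i = T i by move=> i0; rewrite Si /=; case: i i0.
pose S1 := foldl exec1 S [:: IStore 0 1; IConst 1 1].
rewrite foldl_cat -/S1.
have S0B : S 0 = B := S0.
have S10 : S1 0 = B by rewrite /S1 /= !upd_ne //; lia.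
have S1B : S1 B = T 1 by rewrite /S1 /= S0B upd_ne ?upd_eq; [apply: ST | lia].
have S1i i : 1 < i -> i <> B -> S1 i = T i.
  by move=> i1 iB; rewrite /S1 /= S0B upd_ne ?upd_ne; [apply: ST; lia | lia | lia].
case: (posnP m0.-1) => [e|m1].
  rewrite e /= S10 addn0; split=> // [j hj|i hi]; last by apply: S1i; lia.
  by rewrite (_ : j = 0) ?addn0 //; lia.
have [|h1 h2 h3] := @save_low_spec m0.-1 2 S1 (erefl _) isT m1; first by rewrite S10; lia.
rewrite S10 in h1 h2 h3; split=> //.
- by rewrite h3 //; lia.
- move=> [|j] hj; first by rewrite addn0 h3 //; lia.
  by rewrite h2; [rewrite S1i //; lia | lia].
- by move=> i hi'; rewrite h3; [rewrite S1i //; lia | lia | lia].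
Qed.

(** The result is first written as an array above the heap, so that no cell still to be read is
    overwritten. *)
Definition out_block := [:: IAdd 2 2 1; IAdd 9 9 1; ILoad 9 9; IStore 2 9; IAdd 8 8 1; ILoad 8 8; ILoad 9 8].

Lemma out_loop lo h ys : forall R, R 1 = 1 -> 20 <= lo -> lo <= h <= (R 2).+1 ->
  rep lo h R (R 8) (vseq (map VN ys)) -> R 9 = R (R 8) ->
  exists R' s, [/\ bs (Cwhile 9 (Cblk out_block)) R R' s, s <= 20 * (size ys).+1,
    R' 2 = R 2 + size ys, forall i, i < size ys -> R' (R 2 + i.+1) = nth 0 ys i &
    forall i, i \notin [:: 0; 2; 8; 9] -> i <= R 2 \/ R 2 + size ys < i -> R' i = R i].
Proof.
elim: ys => [|y ys IH] R R1 hlo hh hrep R9.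
  exists R, 1; split=> //; last by rewrite addn0.
  by apply: bs_while0; rewrite R9; case: hrep => _ _ [].
case: hrep => h1 h2 [[h3 h4 [h5 h6]] h7].
have [h8 h9] := rep_ge h7.
pose Ra := foldl exec1 R out_block.
have b1 : bs (Cblk out_block) R Ra 7 by exact: (@bs_blk out_block).
pose Sa := exec1 R (IAdd 2 2 1); pose Sb := exec1 Sa (IAdd 9 9 1).
pose Sc := exec1 Sb (ILoad 9 9); pose Sd := exec1 Sc (IStore 2 9).
pose Se := exec1 Sd (IAdd 8 8 1); pose Sf := exec1 Se (ILoad 8 8).
have a2 : Sa 2 = (R 2).+1 by rewrite /Sa /= upd_eq R1 addn1.
have ae i : i <> 2 -> Sa i = R i by move=> hi; rewrite /Sa /= upd_ne.
have b9 : Sb 9 = (R (R 8)).+1 by rewrite /Sb /= upd_eq !ae // R1 R9 addn1.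
have be i : i <> 9 -> Sb i = Sa i by move=> hi; rewrite /Sb /= upd_ne.
have c9 : Sc 9 = y by rewrite /Sc /= upd_eq b9 be ?ae ?h6 //; lia.
have ce i : i <> 9 -> Sc i = Sa i by move=> hi; rewrite /Sc /= upd_ne // be.
have c2 : Sc 2 = (R 2).+1 by rewrite ce.
have dR : Sd (R 2).+1 = y by rewrite /Sd /= c2 upd_eq c9.
have de i : i <> (R 2).+1 -> Sd i = Sc i by move=> hi; rewrite /Sd /= upd_ne // c2.
have e8 : Se 8 = (R 8).+1.
  rewrite /Se /= upd_eq !de; [| lia | lia].
  by rewrite !ce // !ae // R1 addn1.
have ee i : i <> 8 -> Se i = Sd i by move=> hi; rewrite /Se /= upd_ne.
have f8 : Sf 8 = R (R 8).+1.
  by rewrite /Sf /= upd_eq e8 ee ?de ?ce ?ae //; lia.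
have fe i : i <> 8 -> Sf i = Sd i by move=> hi; rewrite /Sf /= upd_ne // ee.
have g9 : Ra 9 = R (R (R 8).+1).
  rewrite (_ : Ra = exec1 Sf (ILoad 9 8)) //= upd_eq f8.
  by rewrite fe ?de ?ce ?ae //; lia.
have ge i : i <> 9 -> Ra i = Sf i by move=> hi; rewrite (_ : Ra = exec1 Sf (ILoad 9 8)) //= upd_ne.
have Rae i : i \notin [:: 2; 8; 9] -> i <> (R 2).+1 -> Ra i = R i.
  rewrite !inE !negb_or => /and3P[/eqP ? /eqP ? /eqP ?] ?.
  by rewrite ge // fe // de // ce // ae.
have Ra2 : Ra 2 = (R 2).+1 by rewrite ge // fe // de ?c2 //; lia.
have RaR : Ra (R 2).+1 = y by rewrite ge ?fe ?dR //; lia.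
have Ra8 : Ra 8 = R (R 8).+1 by rewrite ge.
pose Rb := upd Ra 0 0.
have Rbe i : i <> 0 -> Rb i = Ra i by move=> hi; rewrite /Rb upd_ne.
have Rb2 : Rb 2 = (R 2).+1 by rewrite Rbe.
have [|||||R' [s [k1 k2 k3 k4 k5]]] := IH Rb.
- by rewrite Rbe // Rae //; lia.
- by [].
- by rewrite Rb2; lia.
- rewrite Rbe // Ra8; apply: rep_ext h7 => // i hi.
  by rewrite Rbe ?Rae ?inE //; lia.
- by rewrite !Rbe ?g9 ?Ra8 ?Rae ?inE //; lia.
exists R', (7 + s + 3); split.
- by apply: bs_whileS k1 => //; rewrite R9; have := rep_ge (And3 h3 h4 (conj h5 h6) : rep lo h R _ (VN y)); lia.
- by rewrite /=; lia.
- by rewrite k3 Rb2 /=; lia.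
- move=> [|i] hi /=.
    by rewrite addn1 k5 ?Rb2 ?Rbe ?RaR ?inE //; lia.
  by have := k4 i hi; rewrite Rb2 (_ : (R 2).+1 + i.+1 = R 2 + i.+2) //; lia.
- move=> i hi1 hi2; rewrite k5 ?Rb2 //; last by move: hi2; rewrite /=; lia.
  move: hi1; rewrite !inE => hi1; rewrite Rbe ?Rae ?inE //; first by lia.
    by move: hi2; rewrite /=; lia.
  by lia.
Qed.

(** Words whose final address exceeds [m0] can be moved by a loop; the lower addresses include the
    registers of the loop itself and are left to [load_low]. *)
Definition copy_block := [:: ILoad 3 2; IStore 8 3; ISub 2 2 1; ISub 8 8 1; ISub 9 9 1].

Lemma copy_loop c : forall R O m0, R 1 = 1 -> 20 <= m0 -> m0 + c < O -> R 9 = c -> R 8 = m0 + c ->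
  R 2 = O + (m0 + c) ->
  exists R' s, [/\ bs (Cwhile 9 (Cblk copy_block)) R R' s, s <= 20 * c.+1,
    forall i, m0 < i <= m0 + c -> R' i = R (O + i) &
    forall i, i \notin [:: 0; 2; 3; 8; 9] -> i <= m0 \/ m0 + c < i -> R' i = R i].
Proof.
elim: c => [|c IH] R O m0 R1 hm hO R9 R8 R2.
  by exists R, 1; split=> // [|i]; [apply: bs_while0 | lia].
pose Ra := foldl exec1 R copy_block.
have b1 : bs (Cblk copy_block) R Ra 5 by exact: (@bs_blk copy_block).
pose Sa := exec1 R (ILoad 3 2); pose Sb := exec1 Sa (IStore 8 3).
have a3 : Sa 3 = R (R 2) by rewrite /Sa /= upd_eq.
have ae i : i <> 3 -> Sa i = R i by move=> hi; rewrite /Sa /= upd_ne.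
have b8 : Sb (m0 + c.+1) = R (R 2) by rewrite /Sb /= (ae 8) // R8 upd_eq.
have be i : i <> m0 + c.+1 -> Sb i = Sa i by move=> hi; rewrite /Sb /= upd_ne // ae // R8.
have RaE : Ra = foldl exec1 Sb [:: ISub 2 2 1; ISub 8 8 1; ISub 9 9 1] by [].
have Rae i : i \notin [:: 2; 8; 9] -> Ra i = Sb i.
  rewrite !inE !negb_or => /and3P[/eqP ? /eqP ? /eqP ?]; rewrite RaE /= !upd_ne //.
have sb i : i < 20 -> i <> 3 -> Sb i = R i by move=> *; rewrite be ?ae //; lia.
have Ra2 : Ra 2 = O + (m0 + c) by rewrite RaE /= /upd /= !sb // R2 R1; lia.
have Ra8 : Ra 8 = m0 + c by rewrite RaE /= /upd /= !sb // R8 R1; lia.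
have Ra9 : Ra 9 = c by rewrite RaE /= /upd /= !sb // R9 R1; lia.
pose Rb := upd Ra 0 0.
have Rbe i : i <> 0 -> Rb i = Ra i by move=> hi; rewrite /Rb upd_ne.
have [||||||R' [s [k1 k2 k3 k4]]] := IH Rb O m0; rewrite ?Rbe //; try lia.
  by rewrite Rae // sb.
exists R', (5 + s + 3); split.
- by apply: bs_whileS k1 => //; rewrite R9.
- lia.
- move=> i hi; case: (leqP i (m0 + c)) => hi'.
    rewrite k3; last by lia.
    by rewrite Rbe ?Rae ?be ?ae ?inE //; lia.
  rewrite (_ : i = m0 + c.+1); last by lia.
  rewrite k4 ?inE; [|lia|lia].
  by rewrite Rbe ?Rae ?b8 ?R2 ?inE //; lia.
- move=> i; rewrite !inE => hi1 hi2; rewrite k4 ?inE; [|lia|lia].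
  by rewrite Rbe ?Rae ?be ?ae ?inE //; lia.
Qed.

(** Registers 0 and 1 are filled last, since [load_low] uses them as address and constant. Register
    1 then receives the literal 0, which is why the output has to begin with 0. *)
Definition postlude m0 := Cseqs [::
  Cblk [:: IConst 3 0; IAdd 5 2 3; IAdd 8 20 3; ILoad 9 8];
  Cwhile 9 (Cblk out_block);
  Cblk [:: ISub 6 2 5; IAdd 4 5 1; IStore 4 6; IConst 3 0; IAdd 8 6 3; IConst 3 m0; ISub 9 6 3];
  Cwhile 9 (Cblk copy_block);
  Cblk ([:: IConst 3 m0; IAdd 0 5 3; IConst 1 1] ++ load_low m0.-1 ++ [:: ILoad 0 0; IConst 1 0])].

Lemma simple_load_low n : all simple (load_low n).
Proof. by elim: n. Qed.

Lemma simple_save_low n j : all simple (save_low j n).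
Proof. by elim: n j => //= n IH j; apply: IH. Qed.

Lemma size_save_low n j : size (save_low j n) = n.*2.
Proof. by elim: n j => //= n IH j; rewrite IH; lia. Qed.

Lemma size_load_low n : size (load_low n) = n.*2.
Proof. by elim: n => //= n ->; lia. Qed.

Lemma postlude_spec lo m0 R ys : 20 <= m0 < lo -> R 1 = 1 -> lo <= R 2 -> (size ys).+1 < lo ->
  rep lo (R 2) R (R 20) (vseq (map VN (0 :: ys))) ->
  exists R' s, [/\ bs (postlude m0) R R' s, s <= 60 * (size ys + m0 + 1) & output R' = 0 :: ys].
Proof.
move=> hm R1 R2 hys hrep.
set O := R 2 in R2; set l := (size ys).+1 in hys.
pose l1 := [:: IConst 3 0; IAdd 5 2 3; IAdd 8 20 3; ILoad 9 8].
pose Ra := foldl exec1 R l1.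
have b1 : bs (Cblk l1) R Ra 4 by exact: (@bs_blk l1).
have [hp1 hp2] := rep_ge hrep.
have Rae i : i \notin [:: 3; 5; 8; 9] -> Ra i = R i.
  by rewrite !inE !negb_or => /and4P[/eqP ? /eqP ? /eqP ? /eqP ?]; rewrite /Ra /= !upd_ne.
have Ra5 : Ra 5 = O by rewrite /Ra /= /upd /= addn0.
have Ra8 : Ra 8 = R 20 by rewrite /Ra /= /upd /= addn0.
have Ra9 : Ra 9 = R (R 20).
  rewrite /Ra /= upd_eq.
  have -> : upd (upd (upd R 3 0) 5 (upd R 3 0 2 + upd R 3 0 3)) 8
    (upd (upd R 3 0) 5 (upd R 3 0 2 + upd R 3 0 3) 20 + upd (upd R 3 0) 5 (upd R 3 0 2 + upd R 3 0 3) 3) 8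
    = R 20 by rewrite /upd /= addn0.
  by rewrite !upd_ne //; lia.
have Ra2 : Ra 2 = O by rewrite Rae.
have [|||||Rb [s2 [b2 c2 h2 h3 h4]]] := @out_loop lo O (0 :: ys) Ra.
- by rewrite Rae.
- by lia.
- by rewrite Ra2; lia.
- rewrite Ra8; apply: rep_ext hrep => // i hi; apply: Rae; rewrite !inE; lia.
- by rewrite Ra9 Ra8 Rae // !inE; lia.
rewrite Ra2 /= in h2 h3 h4.
have Rb5 : Rb 5 = O by rewrite h4 //; lia.
have Rb1 : Rb 1 = 1 by rewrite h4 ?Rae //; lia.
pose l3 := [:: ISub 6 2 5; IAdd 4 5 1; IStore 4 6; IConst 3 0; IAdd 8 6 3; IConst 3 m0; ISub 9 6 3].
pose Rc := foldl exec1 Rb l3.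
have b3 : bs (Cblk l3) Rb Rc 7 by exact: (@bs_blk l3).
pose S := foldl exec1 Rb [:: ISub 6 2 5; IAdd 4 5 1].
have S6 : S 6 = l by rewrite /S /= /upd /= h2 Rb5 /l; lia.
have S4 : S 4 = O.+1 by rewrite /S /= /upd /= Rb5 Rb1 addn1.
have Se i : i \notin [:: 4; 6] -> S i = Rb i.
  by rewrite !inE !negb_or => /andP[/eqP ? /eqP ?]; rewrite /S /= !upd_ne.
pose T := exec1 S (IStore 4 6).
have TO : T O.+1 = l by rewrite /T /= S4 upd_eq.
have Te i : i <> O.+1 -> T i = S i by move=> hi; rewrite /T /= upd_ne // S4.
have RcE : Rc = foldl exec1 T [:: IConst 3 0; IAdd 8 6 3; IConst 3 m0; ISub 9 6 3] by [].
have Rce i : i \notin [:: 3; 8; 9] -> Rc i = T i.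
  by rewrite RcE !inE !negb_or => /and3P[/eqP ? /eqP ? /eqP ?]; rewrite /= !upd_ne.
have T6 : T 6 = l by rewrite Te //; lia.
have Rc8 : Rc 8 = l by rewrite RcE /= /upd /= T6 addn0.
have Rc9 : Rc 9 = l - m0 by rewrite RcE /= /upd /= T6.
have Rc2 : Rc 2 = O + l by rewrite Rce // Te ?Se ?h2 //; lia.
have Rc1 : Rc 1 = 1 by rewrite Rce // Te ?Se //; lia.
have Rc5 : Rc 5 = O by rewrite Rce // Te ?Se //; lia.
have RcO i : i < size ys -> Rc (O + i.+2) = nth 0 ys i.
  move=> hi; rewrite Rce ?inE; last by lia.
  rewrite Te; last by lia.
  rewrite Se ?inE; last by lia.
  by have := h3 i.+1 hi.
have RcO1 : Rc O.+1 = l by rewrite Rce ?inE //; lia.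
have [Rd [s4 [b4 c4 h5 h6]]] : exists Rd s4, [/\ bs (Cwhile 9 (Cblk copy_block)) Rc Rd s4,
    s4 <= 20 * (size ys).+2, forall i, m0 < i <= l -> Rd i = Rc (O + i) &
    forall i, i \notin [:: 0; 2; 3; 8; 9] -> i <= m0 \/ l < i -> Rd i = Rc i].
  case: (leqP l m0) => hl.
    exists Rc, 1; split=> // [|i]; last by lia.
    by apply: bs_while0; rewrite Rc9; lia.
  have [||||Rd [s [k1 k2 k3 k4]]] := @copy_loop (l - m0) Rc O m0 Rc1 _ _ Rc9; try lia.
  rewrite subnKC in k3 k4; last by lia.
  by exists Rd, s; split=> //; lia.
have Rd5 : Rd 5 = O by rewrite h6 //; lia.
have RdO i : 0 < i -> Rd (O + i) = Rc (O + i).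
  by move=> hi; apply: h6; rewrite ?inE; lia.
pose Re := foldl exec1 Rd [:: IConst 3 m0; IAdd 0 5 3; IConst 1 1].
have Re0 : Re 0 = O + m0 by rewrite /Re /= /upd /= Rd5.
have Ree i : i \notin [:: 0; 1; 3] -> Re i = Rd i.
  by rewrite !inE !negb_or => /and3P[/eqP ? /eqP ? /eqP ?]; rewrite /Re /= !upd_ne.
have [||k1 k2 k3] := @load_low_spec m0.-1 O Re (erefl _).
- by rewrite Re0; lia.
- by lia.
pose Rf := foldl exec1 Re (load_low m0.-1).
have ReO i : 0 < i -> Re (O + i) = Rc (O + i).
  by move=> hi; rewrite Ree ?RdO ?inE //; lia.
have Rf0 : Rf O.+1 = l by rewrite /Rf k3 ?inE; [rewrite -addn1 ReO // addn1 | lia | lia].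
pose Rg := foldl exec1 Rf [:: ILoad 0 0; IConst 1 0].
pose l5 := [:: IConst 3 m0; IAdd 0 5 3; IConst 1 1] ++ load_low m0.-1 ++ [:: ILoad 0 0; IConst 1 0].
have b5 : bs (Cblk l5) Rd Rg (size l5).
  have -> : Rg = foldl exec1 Rd l5 by rewrite /l5 !foldl_cat.
  by apply: bs_blk; rewrite /l5 !all_cat simple_load_low.
exists Rg, (4 + (s2 + (7 + (s4 + size l5)))); split.
- by apply: (bs_seq b1); apply: (bs_seq b2); apply: (bs_seq b3); apply: (bs_seq b4).
- move: c2; rewrite /l5 !size_cat size_load_low /=; lia.
- have Rg0 : Rg 0 = l by rewrite /Rg /= upd_ne // upd_eq [Rf 0]k1.
  have Rg1 : Rg 1 = 0 by [].
  have Rge i : 2 <= i -> Rg i = Rf i by move=> hi; rewrite /Rg /= !upd_ne //; lia.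
  rewrite /output Rg0 /l; apply: (@eq_from_nth _ 0); first by rewrite size_map size_iota.
  move=> i; rewrite size_map size_iota => hi.
  rewrite (nth_map 0) ?size_iota // nth_iota //.
  case: i hi => [|i] hi //=; rewrite add1n Rge // -RcO; last by lia.
  case: (leqP i.+2 m0) => hi'.
    by rewrite /Rf k2 ?ReO //; lia.
  rewrite /Rf k3; [|by lia|by lia].
  by rewrite Ree ?inE ?h5 //; rewrite /l; lia.
Qed.

(** * Bit lengths and the complete machine *)

Lemma input_size_cons v x : input_size (v :: x) = bits v + input_size x.
Proof. by rewrite /input_size big_cons. Qed.

Lemma ltn_bits v : v < 2 ^ bits v.
Proof. exact: trunc_log_ltn. Qed.

Lemma size_input_size x : size x <= input_size x.
Proof. by elim: x => // v x IH; rewrite input_size_cons /= /bits; lia. Qed.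

Lemma sumn_input_size x : sumn x < 2 ^ input_size x.
Proof.
elim: x => [|v x IH]; first by rewrite /input_size big_nil.
rewrite input_size_cons /= expnD; have := ltn_bits v.
by move: (2 ^ _) (2 ^ _) IH => a b; nia.
Qed.

Lemma nth_input_size x i : nth 0 x i < 2 ^ input_size x.
Proof.
apply: leq_ltn_trans (sumn_input_size x); elim: x i => [|v x IH] [|i] //=; first by lia.
by have := IH i; lia.
Qed.

Definition machine (t : tm) (m0 : nat) : program :=
  setup m0 ++ asm (Cseqs [:: prelude m0; comp t 20; postlude m0]) (size (setup m0)).

Definition literal_bound (P : program) : nat := (\sum_(i <- P) \sum_(x <- literals i) x).

Lemma literal_boundP (P : program) w i x : literal_bound P <= w ->
  x \in literals (nth IHalt P i) -> x < 2 ^ w.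
Proof.
move=> hw hx; apply: leq_ltn_trans (ltn_expl w (isT : 1 < 2)); apply: leq_trans hw.
have hi : i < size P by rewrite ltnNge; apply/negP => h; rewrite nth_default in hx.
rewrite /literal_bound (big_nth IHalt) big_mkord (bigD1 (Ordinal hi)) //=.
by apply: leq_trans (leq_addr _ _); rewrite (big_rem x) //= leq_addr.
Qed.

Definition padded m0 (x : seq nat) := x ++ nseq ((2 ^ m0 * size x).-1 - size x) 0.

Lemma machine_correct (t : tm) : exists (P : program) (m0 c : nat), 0 < m0 /\ forall x ys n,
  0 < head 0 x -> (size ys).+1 <= (size x).*2 ->
  ev t (in_value (head 0 x) (sumn x) (padded m0 x)) (vseq (map VN (0 :: ys))) n ->
  computes_within P x (c * (input_size x + head 0 x + n).+1 ^ 2) (0 :: ys).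
Proof.
have [m0 m0E] : exists m0, m0 = depth t + 21 by exists (depth t + 21).
pose P := machine t m0.
pose w0 := literal_bound P + 1.
(* The summands belong to [setup], [prelude], the compiled term and [postlude]. *)
pose k0 := 3 * m0 + 2 + 20 * (2 ^ m0 + 12) + 20 + 60 * (m0 + 3).
exists P, m0, (k0 * (1 + 5 * (w0 + 1 + k0))); split; first by rewrite m0E; lia.
move=> x ys n hx hsz hev.
have x0 : 0 < size x by case: (x) hx.
have m00 : 0 < m0 by lia.
have [hB R0 R1 hlow hhigh] := setup_spec x0 m00.
pose B := 2 ^ m0 * size x; pose T i := nth 0 x i.-1.
rewrite -/B in hB R0 hlow hhigh.
pose R := foldl exec1 (regs (init_state x)) (setup m0); rewrite -/R in R0 R1 hlow hhigh.
have T1 : T 1 = head 0 x by rewrite /T nth0.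
have hB2 : (size x).*2 <= B.
  by rewrite -mul2n leq_mul2r; apply/orP; right; apply: (@leq_pexp2l 2 1 m0).
have toksE : [seq T i | i <- iota 1 B.-1] = padded m0 x.
  apply: (@eq_from_nth _ 0).
    by rewrite size_map size_iota size_cat size_nseq subnKC //; rewrite -/B; lia.
  move=> i; rewrite size_map size_iota => hi.
  rewrite (nth_map 0) ?size_iota // nth_iota // /T add1n /= nth_cat.
  by case: ltnP => // h; rewrite nth_default // nth_nseq if_same.
have sumE : sumn (padded m0 x) = sumn x by rewrite sumn_cat sumn_nseq mul0n addn0.
have [||Ra [s1 [b1 c1 Ra1 Ra2 v1]]] := @prelude_spec m0 B T R _ R0 R1 _ hlow hhigh.
- by rewrite hB; lia.
- by rewrite T1.
rewrite toksE sumE T1 in c1 v1.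
have [|Rb [s2 [b2 c2 f2 v2]]] := @comp_correct t _ _ _ hev (B + B) 20 Ra isT _ Ra1 Ra2 v1.
  by lia.
have hp2 := frame_hp f2.
have hm0 : 20 <= m0 < B + B by lia.
have hys : (size ys).+1 < B + B by lia.
have [|Rc [s3 [b3 c3 e3]]] := @postlude_spec (B + B) m0 Rb ys hm0 (frame_one f2) _ hys v2.
  by apply: leq_trans Ra2 hp2.
have bb : bs (Cseqs [:: prelude m0; comp t 20; postlude m0]) R Rc (s1 + (s2 + s3)).
  by apply: (bs_seq b1); apply: (bs_seq b2).
have hsetup : all simple (setup m0).
  rewrite /setup !all_cat /= /doubling all_nseq orbT /=.
  exact: simple_save_low.
set body := Cseqs _ in bb.
have [rc1] := @run_blk [::] (setup m0) (asm body (size (setup m0))) (regs (init_state x)) 0 hsetup.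
rewrite add0n cat0s -/R -[_ ++ _]/P => e1.
have [rc2] := asm_correct bb (setup m0) [::] rc1.
rewrite cats0 -[_ ++ _]/P => e2.
pose m := s1 + (s2 + s3) + size (setup m0).
have em : iter m (step P) (init_state x) = RState (size (setup m0) + csize body) Rc rc2.
  by rewrite /m iterD [iter (size _) _ _]e1 e2.
pose S := (input_size x + head 0 x + n).+1.
have hI := size_input_size x.
have hm : m <= k0 * S.
  have h1 : size (setup m0) <= 3 * m0 + 2.
    rewrite /setup !size_cat size_nseq /=.
    by rewrite size_save_low; lia.
  have h2 : trunc_log 2 (sumn x) <= input_size x.
    by have := bits_le (sumn_input_size x); rewrite /bits; lia.
  have h3 : 20 * B <= 20 * 2 ^ m0 * S by rewrite /B mulnA leq_mul2l; apply/orP; right; rewrite /S; lia.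
  have h4 : size (setup m0) <= (3 * m0 + 2) * S by apply: leq_trans h1 _; rewrite leq_pmulr.
  have h5 : 60 * (size ys + m0 + 1) <= 60 * (m0 + 3) * S.
    rewrite -mulnA leq_mul2l; apply/orP; right.
    have h6 : m0 <= m0 * S by rewrite leq_pmulr.
    by rewrite mulnDl; rewrite /S in h6 *; lia.
  have h7 : s1 <= 20 * 2 ^ m0 * S + 240 * S by apply: leq_trans c1 _; rewrite /S in h3 *; lia.
  have h8 : s2 <= 20 * S by rewrite /S; lia.
  have h9 := leq_trans c3 h5; rewrite /m /k0.
  by clear - h4 h7 h8 h9; move: (2 ^ m0) S h4 h7 h8 h9 => X S' *; lia.
(* Large enough for the literals of the program and for the initial registers. *)
pose w := w0 + input_size x.
have hw : 0 < w by rewrite /w /w0; lia.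
have hlit i y : y \in literals (nth IHalt P i) -> y < 2 ^ w.
  by apply: literal_boundP; rewrite /w /w0; lia.
have hreg i : regs (init_state x) i < 2 ^ w.
  apply: (@leq_trans (2 ^ input_size x)); last by rewrite leq_exp2l // /w; lia.
  rewrite /=; case: eqP => _; last exact: nth_input_size.
  by apply: leq_ltn_trans hI _; apply: ltn_expl.
have [_] := iter_bound hw hlit m hreg.
rewrite em /= add0n => hc.
exists m; rewrite em; split=> //.
  rewrite /halted /= nth_default // /P /machine size_cat size_asm //.
apply: leq_trans hc _.
have hb : 1 + 5 * (w + m) <= (1 + 5 * (w0 + 1 + k0)) * S.
  have hw0 : w0 <= w0 * S by rewrite leq_pmulr.
  by rewrite !(mulnDl, mulnDr) /w; rewrite /S in hm hw0 *; lia.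
apply: leq_trans (leq_mul hm hb) _.
by rewrite -/S; apply: eq_leq; ring.
Qed.

(** * Polynomial time *)

Fixpoint vsize (v : value) : nat :=
  match v with VN _ => 1 | VP a b => vsize a + vsize b + 1 end.

Class Enc (A : Type) := enc : A -> value.
#[global] Instance enc_nat : Enc nat := VN.
#[global] Instance enc_bool : Enc bool := fun b => VN (nat_of_bool b).
#[global] Instance enc_prod (A B : Type) (eA : Enc A) (eB : Enc B) : Enc (A * B) :=
  fun p => VP (enc p.1) (enc p.2).
#[global] Instance enc_seq (A : Type) (eA : Enc A) : Enc (seq A) := fun l => vseq (map enc l).

(* A number counts as one node whatever its magnitude: word lengths are already
   controlled by the number of steps. *)
Definition sz {A} {eA : Enc A} (x : A) : nat := vsize (enc x).

(** The base is at least 3, so constants and leading coefficients are absorbed by the exponent. *)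
Definition pbd {E} {eE : Enc E} (F : E -> nat) : Prop :=
  exists c, forall e, F e <= (sz e).+2 ^ c.

Lemma sz_gt0 {A} {eA : Enc A} (x : A) : 0 < sz x.
Proof. by rewrite /sz; case: (enc x) => //= *; lia. Qed.

Section Pbd.
Context {E : Type} {eE : Enc E}.
Implicit Types F G : E -> nat.

Lemma pbd_le F G : (forall e, F e <= G e) -> pbd G -> pbd F.
Proof. by move=> h [c hc]; exists c => e; apply: leq_trans (h e) (hc e). Qed.

Lemma pbd_const k : pbd (fun _ : E => k).
Proof.
exists k => e; apply: leq_trans (ltnW (ltn_expl k (isT : 1 < 2))) _.
by case: k => // k; rewrite leq_exp2r.
Qed.

Lemma pbd_sz : pbd (fun e : E => sz e).
Proof. by exists 1 => e; rewrite expn1; lia. Qed.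

Lemma pbd_mul F G : pbd F -> pbd G -> pbd (fun e => F e * G e).
Proof. by move=> [c hc] [d hd]; exists (c + d) => e; rewrite expnD leq_mul. Qed.

Lemma pbd_add F G : pbd F -> pbd G -> pbd (fun e => F e + G e).
Proof.
move=> [c hc] [d hd]; exists (c + d).+1 => e.
have h (a b : nat) : (sz e).+2 ^ a <= (sz e).+2 ^ (a + b) by rewrite leq_exp2l ?leq_addr.
have := h c d; have := h d c; rewrite addnC => h1 h2; have := hc e; have := hd e.
rewrite expnS => h3 h4; apply: leq_trans (leq_mul (_ : 2 <= _) (leqnn _)); last by [].
by rewrite mul2n -addnn; lia.
Qed.

Lemma pbd_exp F k : pbd F -> pbd (fun e => F e ^ k).
Proof.
move=> hF; elim: k => [|k IH]; first exact: (@pbd_le _ (fun=> 1)) (pbd_const 1).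
by apply: pbd_le (pbd_mul hF IH) => e; rewrite expnS.
Qed.

Lemma pbd_comp {A} {eA : Enc A} (F : A -> nat) (g : E -> A) :
  pbd F -> pbd (fun e => sz (g e)) -> pbd (fun e => F (g e)).
Proof.
move=> [c hc] hg; apply: (@pbd_le _ (fun e => (sz (g e) + 2) ^ c)).
  by move=> e; rewrite addn2; apply: hc.
exact: pbd_exp (pbd_add hg (pbd_const 2)).
Qed.
End Pbd.

(** A time bound alone would not compose: the bound on the size of the result turns a bound in the
    size of [g e] into one in the size of [e]. *)
Definition PT {A B} {eA : Enc A} {eB : Enc B} (f : A -> B) : Prop :=
  exists t N, [/\ pbd N, pbd (fun x => sz (f x)) &
    forall x, exists2 n, n <= N x & ev t (enc x) (enc (f x)) n].

Section Closure.
Context {E A B : Type} {eE : Enc E} {eA : Enc A} {eB : Enc B}.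

Lemma PT_sz (f : E -> A) : PT f -> pbd (fun x => sz (f x)).
Proof. by case=> t [N []]. Qed.

Lemma PT_ext (f g : E -> A) : f =1 g -> PT f -> PT g.
Proof.
move=> fg [t [N [h1 h2 h3]]]; exists t, N; split=> //.
  by apply: pbd_le h2 => e; rewrite fg.
by move=> x; rewrite -fg.
Qed.

Lemma PT_id : PT (fun x : E => x).
Proof.
exists Tid, (fun=> 1); split; [exact: pbd_const | exact: pbd_sz |].
by move=> x; exists 1 => //; constructor.
Qed.

Lemma PT_comp (f : A -> B) (g : E -> A) : PT f -> PT g -> PT (fun e => f (g e)).
Proof.
move=> [t [N [h1 h2 h3]]] [t' [N' [h1' h2' h3']]].
exists (Tcomp t t'), (fun e => N' e + N (g e)); split.
- exact: pbd_add h1' (pbd_comp h1 h2').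
- exact: pbd_comp h2 h2'.
- move=> x; have [n hn en] := h3 (g x); have [n' hn' en'] := h3' x.
  by exists (n' + n); [lia | apply: ev_comp en' en].
Qed.

Lemma PT_pair (f : E -> A) (g : E -> B) : PT f -> PT g -> PT (fun e => (f e, g e)).
Proof.
move=> [t [N [h1 h2 h3]]] [t' [N' [h1' h2' h3']]].
exists (Tpair t t'), (fun e => N e + N' e + 1); split.
- exact: pbd_add (pbd_add h1 h1') (pbd_const 1).
- exact: pbd_add (pbd_add h2 h2') (pbd_const 1).
- move=> x; have [n hn en] := h3 x; have [n' hn' en'] := h3' x.
  by exists (n + n' + 1); [lia | apply: ev_pair en en'].
Qed.

Lemma PT_prim t (f : A -> B) k : (forall a, ev t (enc a) (enc (f a)) 1) ->
  (forall a, sz (f a) <= sz a + k) -> PT f.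
Proof.
move=> ht hf; exists t, (fun=> 1); split; first exact: pbd_const.
- by apply: pbd_le hf _; apply: pbd_add (pbd_const k); apply: pbd_sz.
- by move=> a; exists 1.
Qed.

Lemma PT_const (a : A) : PT (fun _ : E => a).
Proof.
have [t [n hn]] : exists t n, forall v, ev t v (enc a) n.
  elim: (enc a) => [k|u [t [n ht]] w [t' [n' ht']]].
    by exists (Tconst k), 1 => v; constructor.
  by exists (Tpair t t'), (n + n' + 1) => v; constructor.
exists t, (fun=> n); split; [exact: pbd_const | exact: pbd_const |].
by move=> x; exists n.
Qed.

Lemma PT_if (b : E -> bool) (f g : E -> A) : PT b -> PT f -> PT g ->
  PT (fun e => if b e then f e else g e).
Proof.
move=> [c [M [k1 k2 k3]]] [t [N [h1 h2 h3]]] [t' [N' [h1' h2' h3']]].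
exists (Tif c t t'), (fun e => M e + (N e + N' e) + 1); split.
- exact: pbd_add (pbd_add k1 (pbd_add h1 h1')) (pbd_const 1).
- by apply: pbd_le (pbd_add h2 h2') => e; case: (b e); lia.
- move=> x; have [m hm em] := k3 x; have [n hn en] := h3 x; have [n' hn' en'] := h3' x.
  case: (b x) em => em.
    by exists (m + n + 1); [lia | apply: ev_if em _].
  by exists (m + n' + 1); [lia | apply: ev_if em _].
Qed.

Lemma PT_cons (f : E -> A) (g : E -> seq A) : PT f -> PT g -> PT (fun e => f e :: g e).
Proof.
move=> [t [N [h1 h2 h3]]] [t' [N' [h1' h2' h3']]].
exists (Tpair t t'), (fun e => N e + N' e + 1); split.
- exact: pbd_add (pbd_add h1 h1') (pbd_const 1).
- exact: pbd_add (pbd_add h2 h2') (pbd_const 1).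
- move=> x; have [n hn en] := h3 x; have [n' hn' en'] := h3' x.
  by exists (n + n' + 1); [lia | apply: ev_pair en en'].
Qed.

Lemma PT_case (l : E -> seq A) (g0 : E -> B) (g : E -> A -> seq A -> B) :
  PT l -> PT g0 -> PT (fun p : E * (A * seq A) => g p.1 p.2.1 p.2.2) ->
  PT (fun e => match l e with [::] => g0 e | a :: s => g e a s end).
Proof.
move=> [c [M [k1 k2 k3]]] [t [N [h1 h2 h3]]] [t' [N' [h1' h2' h3']]].
pose F e := match l e with [::] => 0 | a :: s => N' (e, (a, s)) end.
have hF : pbd F.
  case: h1' => d hd; case: (pbd_exp d (pbd_add (pbd_add k2 pbd_sz) (pbd_const 3))) => d' hd'.
  exists d' => e; apply: leq_trans (hd' e); rewrite /F; case E1: (l e) => [|a s] //.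
  apply: leq_trans (hd _) _; case: (d) => // q; rewrite leq_exp2r //.
  by rewrite (_ : sz (e, (a, s)) = sz e + sz (l e) + 1) ?E1 //; lia.
have hG : pbd (fun e => sz (match l e with [::] => g0 e | a :: s => g e a s end)).
  case: h2' => d hd; case: (pbd_exp d (pbd_add (pbd_add k2 pbd_sz) (pbd_const 3))) => d' hd'.
  apply: pbd_le (pbd_add h2 (ex_intro _ d' hd')) => e; case E1: (l e) => [|a s] //; first by lia.
  apply: leq_trans (leq_addl _ _); apply: leq_trans (hd (e, (a, s))) _.
  case: (d) => // q; rewrite leq_exp2r //.
  by rewrite (_ : sz (e, (a, s)) = sz e + sz (l e) + 1) ?E1 //; lia.
exists (Tif (Tcomp Tisatom c) t (Tcomp t' (Tpair Tid c))), (fun e => 2 * M e + N e + F e + 10); split.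
- exact: pbd_add (pbd_add (pbd_add (pbd_mul (pbd_const 2) k1) h1) hF) (pbd_const 10).
- exact: hG.
- move=> x; have [m hm em] := k3 x; have [n hn en] := h3 x.
  rewrite /F; case E1: (l x) em => [|a s] em.
    exists (m + 1 + n + 1); first by lia.
    by apply: (@ev_if _ _ _ _ 1) en; apply: ev_comp em _; constructor.
  have [n' hn' en'] := h3' (x, (a, s)).
  exists (m + 1 + (1 + m + 1 + n') + 1); first by lia.
  apply: (@ev_if _ _ _ _ 0); first by apply: ev_comp em _; constructor.
  by apply: ev_comp en'; apply: ev_pair em; constructor.
Qed.

End Closure.

Section Projections.
Context {E A B : Type} {eE : Enc E} {eA : Enc A} {eB : Enc B}.

Lemma PT_fst (g : E -> A * B) : PT g -> PT (fun e => (g e).1).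
Proof.
apply: PT_comp; apply: (@PT_prim _ _ _ _ Tfst _ 0) => [p|p]; first exact: ev_fst.
by rewrite /sz /=; lia.
Qed.

Lemma PT_snd (g : E -> A * B) : PT g -> PT (fun e => (g e).2).
Proof.
apply: PT_comp; apply: (@PT_prim _ _ _ _ Tsnd _ 0) => [p|p]; first exact: ev_snd.
by rewrite /sz /=; lia.
Qed.
End Projections.

Section Fold.
Context {E A X : Type} {eE : Enc E} {eA : Enc A} {eX : Enc X}.

Lemma sz_cons (a : A) s : sz (a :: s) = sz a + sz s + 1.
Proof. by []. Qed.

Lemma sz_cat (s1 s2 : seq A) : sz (s1 ++ s2) + 1 = sz s1 + sz s2.
Proof. by elim: s1 => [|a s IH]; [rewrite addnC | rewrite cat_cons !sz_cons; lia]. Qed.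

Lemma sz_size (s : seq A) : size s < sz s.
Proof. by elim: s => //= a s; rewrite sz_cons; have := sz_gt0 a; lia. Qed.

(** Iterating a polynomial-time step may, say, double the accumulator every time, so a polynomial
    bound on all intermediate accumulators is demanded separately. *)
Lemma PT_foldl (f : E -> X -> A -> X) (x0 : E -> X) (l : E -> seq A) :
  PT (fun p : (E * X) * A => f p.1.1 p.1.2 p.2) -> PT x0 -> PT l ->
  (exists2 G : E -> nat, pbd G & forall e l1 l2, l e = l1 ++ l2 -> sz (foldl (f e) (x0 e) l1) <= G e) ->
  PT (fun e => foldl (f e) (x0 e) (l e)).
Proof.
move=> [t [N [h1 h2 h3]]] [t0 [N0 [h01 h02 h03]]] [tl [Nl [hl1 hl2 hl3]]] [G hG hacc].
case: h1 => d hd.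
(* [Tfold] passes only accumulator and element to its body, so the environment [e] travels inside
   the accumulator. *)
pose body := Tpair (Tcomp Tfst Tfst) t.
pose S := fun e : E => @sz _ eE e + G e + @sz _ (enc_seq eA) (l e).
pose step := fun e : E => (S e + 4) ^ d + 5.
exists (Tcomp Tsnd (Tcomp (Tfold body) (Tpair (Tpair Tid t0) tl))),
  (fun e => N0 e + Nl e + sz (l e) * step e + 10).
have hS : pbd S by apply: pbd_add hl2; apply: pbd_add hG; apply: pbd_sz.
split.
- apply: pbd_add (pbd_const 10); apply: pbd_add (pbd_add h01 hl1) _.
  by apply: pbd_mul hl2 _; apply: pbd_add (pbd_const 5); apply: pbd_exp; apply: pbd_add (pbd_const 4).
- by apply: pbd_le hG => e; apply: (hacc e (l e) [::]); rewrite cats0.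
move=> e; have [n0 hn0 en0] := h03 e; have [nl hnl enl] := hl3 e.
have key l1 l2 : l e = l1 ++ l2 -> exists2 n, n <= size l2 * step e + 1 &
    ev (Tfold body) (VP (VP (enc e) (enc (foldl (f e) (x0 e) l1))) (enc l2))
       (VP (enc e) (enc (foldl (f e) (x0 e) (l e)))) n.
  elim: l2 l1 => [|a l2 IH] l1 el.
    by exists 1 => //; rewrite cats0 in el; rewrite el; constructor.
  have [|n hn en] := IH (rcons l1 a); first by rewrite cat_rcons.
  have [m hm em] := h3 (e, foldl (f e) (x0 e) l1, a).
  exists ((1 + 1 + m + 1) + n + 1).
    have : m <= (S e + 4) ^ d.
      apply: leq_trans hm (leq_trans (hd _) _); case: (d) => // q; rewrite leq_exp2r //.
      have h4 := hacc e _ _ el; have h5 := sz_cat l1 (a :: l2); rewrite -el sz_cons in h5.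
      have h6 : sz (e, foldl (f e) (x0 e) l1, a) = sz e + sz (foldl (f e) (x0 e) l1) + 1 + sz a + 1 by [].
      by have := sz_gt0 l1; have := sz_gt0 l2; rewrite /S; lia.
    by rewrite /= mulSn /step in hn *; lia.
  apply: (@ev_foldS _ _ _ _ (VP (enc e) (enc (foldl (f e) (x0 e) (rcons l1 a))))) en.
  rewrite -cats1 foldl_cat /=; apply: ev_pair em.
  by apply: ev_comp; constructor.
have [n hn en] := key [::] (l e) erefl.
exists (1 + n0 + 1 + nl + 1 + n + 1).
  have := sz_size (l e); move=> hs.
  have : size (l e) * step e <= sz (l e) * step e by rewrite leq_mul2r; apply/orP; right; lia.
  lia.
apply: ev_comp; last by constructor.
apply: ev_comp en; apply: ev_pair enl; apply: ev_pair en0; constructor.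
Qed.

(** The growth per step is bounded independently of the accumulator, so sizes add up instead of
    compounding. This criterion serves the folds outside the layered dynamic program. *)
Lemma PT_foldl_add (f : E -> X -> A -> X) (x0 : E -> X) (l : E -> seq A) :
  PT (fun p : (E * X) * A => f p.1.1 p.1.2 p.2) -> PT x0 -> PT l ->
  (exists2 G : E * A -> nat, pbd G & forall e x a, sz (f e x a) <= sz x + G (e, a)) ->
  PT (fun e => foldl (f e) (x0 e) (l e)).
Proof.
move=> hf h0 hl [G [d hd] hG]; apply: PT_foldl => //.
have hl' := PT_sz hl; have h0' := PT_sz h0.
exists (fun e => sz (x0 e) + sz (l e) * (sz e + sz (l e) + 3) ^ d).
  apply: (pbd_add h0'); apply: (pbd_mul hl'); apply: pbd_exp.
  by apply: pbd_add (pbd_const 3); apply: pbd_add hl'; apply: pbd_sz.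
move=> e l1 l2 el; set Q := (_ ^ d).
have {hd}hd a : a \in [pred a | sz a <= sz (l e)] -> G (e, a) <= Q.
  rewrite inE => ha; apply: leq_trans (hd _) _; rewrite /Q; case: (d) => // q; rewrite leq_exp2r //.
  have -> : sz (e, a) = sz e + sz a + 1 by [].
  lia.
have : sz (foldl (f e) (x0 e) l1) <= sz (x0 e) + size l1 * Q.
  elim/last_ind: l1 l2 el => [|l1 a IH] l2 el; first by rewrite /=; lia.
  rewrite -cats1 foldl_cat size_cat /= addn1 mulSn.
  rewrite cat_rcons in el.
  have h5 := sz_cat l1 (a :: l2); rewrite -el sz_cons in h5.
  have h6 : G (e, a) <= Q by apply: hd; rewrite inE; have := sz_gt0 l1; lia.
  by have := IH _ el; have := hG e (foldl (f e) (x0 e) l1) a; lia.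
move/leq_trans; apply; rewrite leq_add2l leq_mul2r; apply/orP; right.
by have := sz_size (l e); rewrite el size_cat; lia.
Qed.
End Fold.

Section Arith.
Context {E : Type} {eE : Enc E}.
Implicit Types (f g : E -> nat) (b c : E -> bool).

Lemma PT_add f g : PT f -> PT g -> PT (fun e => f e + g e).
Proof.
move=> hf hg; apply: (PT_comp (f := fun p : nat * nat => p.1 + p.2)) (PT_pair hf hg).
by apply: (@PT_prim _ _ _ _ Tadd _ 0) => -[m n]; [exact: ev_add | rewrite /sz /=; lia].
Qed.

Lemma PT_sub f g : PT f -> PT g -> PT (fun e => f e - g e).
Proof.
move=> hf hg; apply: (PT_comp (f := fun p : nat * nat => p.1 - p.2)) (PT_pair hf hg).
by apply: (@PT_prim _ _ _ _ Tsub _ 0) => -[m n]; [exact: ev_sub | rewrite /sz /=; lia].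
Qed.

Lemma PT_succ f : PT f -> PT (fun e => (f e).+1).
Proof. by move=> hf; apply: PT_ext (PT_add hf (PT_const 1)) => e; rewrite addn1. Qed.

Lemma PT_neq0 f : PT f -> PT (fun e => f e != 0).
Proof.
move=> [t [N [h1 h2 h3]]].
exists (Tif t (Tconst 1) (Tconst 0)), (fun e => N e + 2); split.
- exact: pbd_add h1 (pbd_const 2).
- exact: (pbd_const 1).
- move=> x; have [n hn en] := h3 x; exists (n + 1 + 1); first by lia.
  by apply: ev_if en _; case: eqP => h; constructor.
Qed.

Lemma PT_not b : PT b -> PT (fun e => ~~ b e).
Proof. by move=> hb; apply: PT_ext (PT_if hb (PT_const false) (PT_const true)) => e; case: (b e). Qed.
Lemma PT_and b c : PT b -> PT c -> PT (fun e => b e && c e).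
Proof. by move=> hb hc; apply: PT_ext (PT_if hb hc (PT_const false)) => e; case: (b e). Qed.
Lemma PT_eqb b c : PT b -> PT c -> PT (fun e => b e == c e).
Proof. by move=> hb hc; apply: PT_ext (PT_if hb hc (PT_not hc)) => e; case: (b e); case: (c e). Qed.

Lemma PT_leq f g : PT f -> PT g -> PT (fun e => f e <= g e).
Proof. by move=> hf hg; apply: PT_ext (PT_not (PT_neq0 (PT_sub hf hg))) => e; rewrite negbK subn_eq0. Qed.

Lemma PT_ltn f g : PT f -> PT g -> PT (fun e => f e < g e).
Proof. by move=> hf hg; apply: (PT_leq (PT_succ hf)). Qed.

Lemma PT_eqn f g : PT f -> PT g -> PT (fun e => f e == g e).
Proof.
by move=> hf hg; apply: PT_ext (PT_and (PT_leq hf hg) (PT_leq hg hf)) => e; rewrite eqn_leq.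
Qed.

Lemma PT_nat_of_bool b : PT b -> PT (fun e => nat_of_bool (b e)).
Proof. by move=> hb; apply: PT_ext (PT_if hb (PT_const 1) (PT_const 0)) => e; case: (b e). Qed.
End Arith.

(** A hook for [pt1], redefined once the list operations are available. *)
Ltac pt_ext := fail.
Ltac pt1 := lazymatch goal with
  | h : ?G |- ?G => exact h
  | |- PT (fun e => e) => exact PT_id
  | |- PT id => exact PT_id
  | |- PT fst => exact (PT_fst PT_id)
  | |- PT snd => exact (PT_snd PT_id)
  | |- PT (fun _ => ?c) => exact (PT_const c)
  | |- PT (fun e => fst (@?g e)) => apply (PT_fst (g := g))
  | |- PT (fun e => snd (@?g e)) => apply (PT_snd (g := g))
  | |- PT (fun e => pair (@?f e) (@?g e)) => apply (PT_pair (f := f) (g := g))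
  | |- PT (fun e => cons (@?f e) (@?g e)) => apply (PT_cons (f := f) (g := g))
  | |- PT (fun e => addn (@?f e) (@?g e)) => apply (PT_add (f := f) (g := g))
  | |- PT (fun e => subn (@?f e) (@?g e)) => apply (PT_sub (f := f) (g := g))
  | |- PT (fun e => leq (S (@?f e)) (@?g e)) => apply (PT_ltn (f := f) (g := g))
  | |- PT (fun e => leq (@?f e) (@?g e)) => apply (PT_leq (f := f) (g := g))
  | |- PT (fun e => S (@?f e)) => apply (PT_succ (f := f))
  | |- PT (fun e => @eq_op Datatypes_nat__canonical__eqtype_Equality (@?f e) (@?g e)) =>
         apply (PT_eqn (f := f) (g := g))
  | |- PT (fun e => @eq_op Datatypes_bool__canonical__eqtype_Equality (@?f e) (@?g e)) =>
         apply (PT_eqb (b := f) (c := g))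
  | |- PT (fun e => andb (@?f e) (@?g e)) => apply (PT_and (b := f) (c := g))
  | |- PT (fun e => negb (@?f e)) => apply (PT_not (b := f))
  | |- PT (fun e => nat_of_bool (@?f e)) => apply (PT_nat_of_bool (b := f))
  | |- PT (fun e => if _ then _ else _) => apply: PT_if
  | h : PT ?f |- PT (fun e => ?f (@?g e)) => apply (PT_comp (f := f) (g := g) h)
  | _ => pt_ext
  end.
Ltac pt := cbv beta; repeat (pt1; cbv beta).

Ltac pbdt := repeat lazymatch goal with
  | |- pbd (fun _ => ?c) => exact (pbd_const c)
  | |- pbd (fun e => addn (@?f e) (@?g e)) => apply (@pbd_add _ _ f g)
  | |- pbd (fun e => muln (@?f e) (@?g e)) => apply (@pbd_mul _ _ f g)
  | |- pbd (fun e => expn (@?f e) ?k) => apply (@pbd_exp _ _ f k)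
  | |- pbd (fun e => sz e) => exact pbd_sz
  end.

Section Rev.
Context {E A : Type} {eE : Enc E} {eA : Enc A}.

Lemma PT_catrev (l m : E -> seq A) : PT l -> PT m -> PT (fun e => catrev (l e) (m e)).
Proof.
move=> hl hm; apply: (@PT_ext _ _ _ _ (fun e => foldl (fun acc a => a :: acc) (m e) (l e))).
  by move=> e; elim: (l e) (m e) => //= a s IH m'; rewrite IH.
apply: PT_foldl_add => //; first by pt.
exists (fun p => sz p); first by exact: pbd_sz.
by move=> e x a; rewrite sz_cons (_ : sz (e, a) = sz e + sz a + 1) //; lia.
Qed.

Lemma PT_rev (l : E -> seq A) : PT l -> PT (fun e => rev (l e)).
Proof. by move=> hl; apply: PT_catrev => //; apply: PT_const. Qed.

Lemma PT_cat (l m : E -> seq A) : PT l -> PT m -> PT (fun e => l e ++ m e).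
Proof.
move=> hl hm; apply: PT_ext (PT_catrev (PT_rev hl) hm) => e.
by rewrite catrevE revK.
Qed.

End Rev.

Section Map.
Context {E A B : Type} {eE : Enc E} {eA : Enc A} {eB : Enc B}.

Lemma PT_map (F : E -> A -> B) (l : E -> seq A) :
  PT (fun p : E * A => F p.1 p.2) -> PT l -> PT (fun e => [seq F e a | a <- l e]).
Proof.
move=> hF hl.
apply: (@PT_ext _ _ _ _ (fun e => rev (foldl (fun acc a => F e a :: acc) [::] (l e)))).
  move=> e; rewrite -[RHS]revK; congr rev.
  elim/last_ind: (l e) => // s a IH.
  by rewrite -cats1 foldl_cat IH map_cat rev_cat.
apply: PT_rev; apply: (@PT_foldl_add _ _ _ _ _ _ (fun e acc a => F e a :: acc)) => //.
- apply: PT_cons; last by pt.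
  by apply: (PT_comp (g := fun p : E * seq B * A => (p.1.1, p.2)) hF); pt.
- exact: PT_const.
exists (fun p => sz (F p.1 p.2) + 1); first by pbdt; apply: PT_sz hF.
by move=> e x a; rewrite sz_cons /=; lia.
Qed.

Lemma PT_flatten (l : E -> seq (seq A)) : PT l -> PT (fun e => flatten (l e)).
Proof.
move=> hl.
apply: (@PT_ext _ _ _ _ (fun e => foldl (fun acc a => acc ++ a) [::] (l e))).
  move=> e; elim/last_ind: (l e) => // s a IH.
  by rewrite -cats1 foldl_cat IH flatten_cat /= cats0.
apply: (@PT_foldl_add _ _ _ _ _ _ (fun e acc a => acc ++ a)) => //.
- by apply: PT_cat; pt.
- exact: PT_const.
exists (fun p => sz p); first by exact: pbd_sz.
by move=> e x a; pose proof (sz_cat x a) as h; rewrite (_ : sz (e, a) = sz e + sz a + 1) //; lia.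
Qed.

End Map.

Section Lists.
Context {E A B : Type} {eE : Enc E} {eA : Enc A} {eB : Enc B}.

Lemma PT_filter (p : E -> A -> bool) (l : E -> seq A) :
  PT (fun q : E * A => p q.1 q.2) -> PT l -> PT (fun e => [seq a <- l e | p e a]).
Proof.
move=> hp hl.
apply: (@PT_ext _ _ _ _ (fun e => flatten [seq if p e a then [:: a] else [::] | a <- l e])).
  by move=> e; elim: (l e) => //= a s ->; case: (p e a).
apply: PT_flatten; apply: (@PT_map _ _ _ _ _ _ (fun e a => if p e a then [:: a] else [::])) => //.
by apply: PT_if => //; pt.
Qed.

Lemma PT_size (l : E -> seq A) : PT l -> PT (fun e => size (l e)).
Proof.
move=> hl; apply: (@PT_ext _ _ _ _ (fun e => foldl (fun n _ => n.+1) 0 (l e))).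
  by move=> e; rewrite -[RHS]add0n; elim: (l e) 0 => [|a s IH] n /=; rewrite ?addn0 // IH addSnnS.
by apply: PT_foldl_add => //; [pt | pt | exists (fun=> 0); [pbdt | move=> *; rewrite addn0]].
Qed.

End Lists.

Section Lists2.
Context {E A B : Type} {eE : Enc E} {eA : Enc A} {eB : Enc B}.

Lemma PT_isnil (l : E -> seq A) : PT l -> PT (fun e => nilp (l e)).
Proof. by move=> hl; apply: (PT_eqn (PT_size hl) (PT_const 0)). Qed.

Lemma PT_all (p : E -> A -> bool) (l : E -> seq A) :
  PT (fun q : E * A => p q.1 q.2) -> PT l -> PT (fun e => all (p e) (l e)).
Proof.
move=> hp hl; apply: (PT_ext _ (PT_isnil (PT_filter (p := fun e a => ~~ p e a) (PT_not hp) hl))) => e.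
by elim: (l e) => //= a s <-; case: (p e a).
Qed.

Lemma PT_has (p : E -> A -> bool) (l : E -> seq A) :
  PT (fun q : E * A => p q.1 q.2) -> PT l -> PT (fun e => has (p e) (l e)).
Proof.
move=> hp hl; apply: (PT_ext _ (PT_not (PT_isnil (PT_filter (p := p) hp hl)))) => e.
by elim: (l e) => //= a s <-; case: (p e a).
Qed.

(** A range has to be indexed by the length of a list: a number counts as one node, so [iota 0 n]
    has no polynomial bound in the size of [n]. *)
Lemma PT_iota (l : E -> seq A) : PT l -> PT (fun e => iota 0 (size (l e))).
Proof.
move=> hl.
apply: (@PT_ext _ _ _ _ (fun e => rev (foldl (fun acc _ => size acc :: acc) [::] (l e)))).
  move=> e; rewrite -[RHS]revK; congr rev; elim/last_ind: (l e) => // s a IH.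
  rewrite -cats1 foldl_cat IH /= size_cat /= size_rev size_iota.
  by rewrite iotaD rev_cat.
apply: PT_rev; apply: (@PT_foldl_add _ _ _ _ _ _ (fun _ acc (_ : A) => size acc :: acc)) => //.
- by apply: PT_cons; [apply: PT_size |]; pt.
- exact: PT_const.
exists (fun=> 2); first by pbdt.
by move=> e x a; rewrite sz_cons (_ : sz (size x) = 1) //; lia.
Qed.

Lemma PT_zip (l : E -> seq A) (m : E -> seq B) : PT l -> PT m -> PT (fun e => zip (l e) (m e)).
Proof.
move=> hl hm.
pose f (e : E) (st : seq B * seq (A * B)) a :=
  match st.1 with [::] => st | b :: r => (r, (a, b) :: st.2) end.
apply: (@PT_ext _ _ _ _ (fun e => rev (foldl (f e) (m e, [::]) (l e)).2)).
  move=> e; have H l' m' acc : rev (foldl (f e) (m', acc) l').2 = rev acc ++ zip l' m'.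
    elim: l' m' acc => [|a l' IH] [|b m'] acc /=; rewrite ?cats0 //.
      by rewrite /f /= -/(f e); elim: l' {IH}.
    by rewrite {2}/f /= IH rev_cons cat_rcons.
  by rewrite H.
apply: PT_rev; apply: PT_snd; apply: PT_foldl_add => //.
- rewrite /f; apply: PT_case; by pt.
- by pt.
exists (fun p => sz p); first by pbdt.
move=> e [r acc] a; rewrite /f /=; case: r => [|b r] /=; first by lia.
have -> : sz (r, (a, b) :: acc) = sz r + (sz a + sz b + 1 + sz acc + 1) + 1 by [].
have -> : sz (b :: r, acc) = sz b + sz r + 1 + sz acc + 1 by [].
by have -> : sz (e, a) = sz e + sz a + 1 by []; have := sz_gt0 e; lia.
Qed.
End Lists2.

Lemma PT_eqseq {E} {A : eqType} {eE : Enc E} {eA : Enc A} (l m : E -> seq A) :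
  PT (fun p : A * A => p.1 == p.2) -> PT l -> PT m -> PT (fun e => l e == m e).
Proof.
move=> hA hl hm.
apply: (@PT_ext _ _ _ _ (fun e => (size (l e) == size (m e)) &&
   all (fun p => p.1 == p.2) (zip (l e) (m e)))).
  by move=> e; rewrite eqseq_all all2E.
apply: PT_and; first by apply: PT_eqn; exact: PT_size.
apply: (@PT_all _ _ _ _ (fun _ p => p.1 == p.2)); last exact: PT_zip.
by apply: (PT_comp (g := snd) hA); apply: PT_snd; exact: PT_id.
Qed.

Lemma PT_eqpair {E} {A B : eqType} {eE : Enc E} {eA : Enc A} {eB : Enc B} (f g : E -> A * B) :
  PT (fun p => (f p).1 == (g p).1) -> PT (fun p => (f p).2 == (g p).2) -> PT (fun e => f e == g e).
Proof. by move=> h1 h2; apply: PT_ext (PT_and h1 h2) => e; rewrite -pair_eqE. Qed.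

Lemma PT_head {E A} {eE : Enc E} {eA : Enc A} (x0 : A) (l : E -> seq A) :
  PT l -> PT (fun e => head x0 (l e)).
Proof.
move=> hl; apply: (@PT_ext _ _ _ _ (fun e => match l e with [::] => x0 | a :: s => a end)).
  by move=> e; case: (l e).
by apply: PT_case => //; pt.
Qed.

Lemma PT_behead {E A} {eE : Enc E} {eA : Enc A} (l : E -> seq A) :
  PT l -> PT (fun e => behead (l e)).
Proof.
move=> hl; apply: (@PT_ext _ _ _ _ (fun e => match l e with [::] => [::] | a :: s => s end)).
  by move=> e; case: (l e).
by apply: PT_case => //; pt.
Qed.

Ltac pt_ext ::= lazymatch goal with
  | |- PT (fun e => rev (@?l e)) => apply (PT_rev (l := l))
  | |- PT (fun e => cat (@?l e) (@?m e)) => apply (PT_cat (l := l) (m := m))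
  | |- PT (fun e => flatten (@?l e)) => apply (PT_flatten (l := l))
  | |- PT (fun e => size (@?l e)) => apply (PT_size (l := l))
  | |- PT (fun e => head ?x (@?l e)) => apply (PT_head x (l := l))
  | |- PT (fun e => behead (@?l e)) => apply (PT_behead (l := l))
  | |- PT (fun e => iota 0 (size (@?l e))) => apply (PT_iota (l := l))
  | |- PT (fun e => zip (@?l e) (@?m e)) => apply (PT_zip (l := l) (m := m))
  | |- PT (fun e => map (@?F e) (@?l e)) => apply (PT_map (F := F) (l := l))
  | |- PT (fun e => filter (@?F e) (@?l e)) => apply (PT_filter (p := F) (l := l))
  | |- PT (fun e => all (@?F e) (@?l e)) => apply (PT_all (p := F) (l := l))
  | |- PT (fun e => has (@?F e) (@?l e)) => apply (PT_has (p := F) (l := l))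
  end.

(** * The scheduling algorithm *)

Section LayeredDP.
Variables (K : eqType) (E S : Type).
Local Notation entry := (K * (nat * seq S))%type.

(* An entry is (key, (cost, choices made, latest first)); a table keeps one cheapest
   entry per key. *)
Definition dp_insert (t : seq entry) (x : entry) : seq entry :=
  if has (fun y => (y.1 == x.1) && (y.2.1 <= x.2.1)) t then t
  else x :: [seq y <- t | y.1 != x.1].

Definition dp_expand (opt : E -> K -> seq (K * (nat * S))) (e : E) (t : seq entry) : seq entry :=
  flatten [seq [seq (o.1, (y.2.1 + o.2.1, o.2.2 :: y.2.2)) | o <- opt e y.1] | y <- t].

Definition dp_step opt t e := foldl dp_insert [::] (dp_expand opt e t).

Definition dp opt init es := foldl (dp_step opt) init es.
End LayeredDP.

Notation times := ((nat * nat) * (nat * nat))%type.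
Definition t_ps (d : times) := d.1.1.
Definition t_pc (d : times) := d.1.2.
Definition t_in (d : times) := d.2.1.
Definition t_out (d : times) := d.2.2.

(* (index, (times, cloud cost)) *)
Notation item := (nat * (times * nat))%type.
(* (identifier, (front, limit)): the server is free from [front] to [limit] *)
Notation slot := (nat * (nat * nat))%type.
(* (index, (on the cloud?, completion time)) *)
Notation placed := (nat * (bool * nat))%type.

(* (delay of the kept edge, (parallel jobs, (cloud allowed?, (p_s, (p_c, cloud cost))))) *)
Notation stage := (nat * (seq item * (bool * (nat * (nat * nat)))))%type.
(* ((on the cloud?, completion time), (completion of the previous chain job, parallel jobs)) *)
Notation stage_sol := ((bool * nat) * (nat * seq placed))%type.
Notation edge_data := (nat * seq times)%type.
(* ((cloud allowed?, (p_s, p_c)), incoming edge) *)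
Notation raw_stage := ((bool * (nat * nat)) * edge_data)%type.
(* ((remaining tokens, (chain jobs, (parallel jobs, edges) still to be read)), (chain, edges)),
   both accumulators reversed *)
Notation pstate := ((seq nat * (nat * (nat * nat))) * (seq (nat * nat) * seq edge_data))%type.

Section Algorithm.
Variable D : nat.

Definition advance (iv : seq slot) (m f : nat) : seq slot :=
  [seq if e.1 == m then (e.1, (f, e.2.2)) else e | e <- iv].

(** On the cloud a job runs as early as possible, since cloud machines do not compete. On the server
    it is appended at the front of a slot, provided that it is released by then. The tests on
    [size iv] and [size l] keep the number of keys polynomial even on malformed input. *)
Definition block_opt (l : seq nat) (a b : bool) (T : nat) (x : item) (iv : seq slot) :
    seq (seq slot * (nat * placed)) :=
  let d := x.2.1 in
  (if (if a then 0 else t_in d) + t_pc d + (if b then 0 else t_out d) <= T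
   then [:: (iv, (x.2.2, (x.1, (true, (if a then 0 else t_in d) + t_pc d))))] else [::]) ++
  [seq (advance iv e.1 (e.2.1 + t_ps d), (0, (x.1, (false, e.2.1 + t_ps d)))) |
     e <- iv & [&& size iv == D.+1, (if a then t_in d else 0) <= e.2.1,
                   e.2.1 + t_ps d <= e.2.2,
                   e.2.1 + t_ps d + (if b then t_out d else 0) <= T &
                   e.2.1 + t_ps d < size l]].

Definition lower (g : nat * seq slot) : nat := (head (0, (0, 0)) g.2).2.1.

(* A guess is (span, slots), the slots listed from the earliest in time. *)
Fixpoint guesses n (l : seq nat) : seq (nat * seq slot) :=
  if n is n'.+1 then
    flatten [seq [seq (g.1, (n'.+1, (b, lower g)) :: g.2) | b <- iota 0 (size l) & b <= lower g]
            | g <- guesses n' l]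
  else flatten [seq [seq (u, [:: (0, (b, u))]) | b <- iota 0 (size l) & b <= u] | u <- iota 0 (size l)].

(** Decreasing outgoing delay is increasing deadline: if the next chain job is on the cloud, a
    server job must end by the span minus [t_out]. If it is on the server, all deadlines agree and
    any order will do. *)
Definition insert_out (acc : seq item) (x : item) : seq item :=
  [seq y <- acc | t_out x.2.1 <= t_out y.2.1] ++ x :: [seq y <- acc | t_out y.2.1 < t_out x.2.1].
Definition sort_out (s : seq item) : seq item := foldl insert_out [::] s.

Definition block_sols (l : seq nat) (a b : bool) (s : seq item) : seq (nat * (nat * seq placed)) :=
  flatten [seq [seq (g.1, y.2) | y <- dp (block_opt l a b g.1) [:: (g.2, (0, [::]))] (sort_out s)]
          | g <- guesses D l].

(** The span [g.1] runs from the completion of the previous chain job to the start of the next. The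
    delay of a kept edge is a lower bound on it; a replaced edge carries delay 0 and a kept one no
    parallel jobs, so both kinds share one formula. *)
Definition stage_opt (l : seq nat) (st : stage) (k : bool * nat) :
    seq ((bool * nat) * (nat * stage_sol)) :=
  flatten [seq [seq ((b, k.2 + g.1 + (if b then st.2.2.2.2.1 else st.2.2.2.1)),
                     (g.2.1 + (if b then st.2.2.2.2.2 else 0),
                      ((b, k.2 + g.1 + (if b then st.2.2.2.2.1 else st.2.2.2.1)), (k.2, g.2.2)))) |
                g <- block_sols l k.1 b st.2.1 &
                ((if k.1 == b then 0 else st.1) <= g.1) &&
                (k.2 + g.1 + (if b then st.2.2.2.2.1 else st.2.2.2.1) < size l)]
          | b <- if st.2.2.1 then [:: false; true] else [:: false]].

Definition chain_sols (l : seq nat) (sts : seq stage) :=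
  dp (stage_opt l) [:: ((false, 0), (0, [::]))] sts.

(* [U * minn c (size l)]; the language has no multiplication. *)
Definition scale (l : seq nat) (U c : nat) : nat :=
  foldl (fun acc h => if h < c then acc + U else acc) 0 (iota 0 (size l)).

(** Division by counting: when [ms] lists the first multiples of [U] from 0 on, this is the ceiling
    of [p / U], capped at the length of the list. *)
Definition roundup (ms : seq nat) (p : nat) : nat := size [seq m <- ms | m < p].

Definition round_times ms (d : times) : times :=
  ((roundup ms (t_ps d), roundup ms (t_pc d)), (roundup ms (t_in d), roundup ms (t_out d))).

(** A cloud time is stored twice, rounded as a duration and unrounded as a cost, so the budget is
    tested exactly. *)
Definition round_stage (ms : seq nat) (r : raw_stage) : stage :=
  (roundup ms r.2.1,
   ([seq (z.1, (round_times ms z.2, t_pc z.2)) | z <- zip (iota 0 (size r.2.2)) r.2.2],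
    (r.1.1, (roundup ms r.1.2.1, (roundup ms r.1.2.2, r.1.2.2))))).

Definition candidates (l : seq nat) (b0 : nat) (rs : seq raw_stage) (U : nat) :
    seq (nat * (nat * seq stage_sol)) :=
  let ms := [seq scale l U h | h <- iota 0 (size l)] in
  [seq (scale l U y.1.2, (U, rev y.2.2)) |
     y <- chain_sols l [seq round_stage ms r | r <- rs] & (y.2.1 <= b0) && ~~ y.1.1].

(** A list with at most one element plays the role of an option. *)
Definition keep_best (acc : seq (nat * (nat * seq stage_sol))) (c : nat * (nat * seq stage_sol)) :=
  if all (fun d => c.1 < d.1) acc then [:: c] else acc.

(* The leading zeros are the side and the completion time of the source. *)
Definition write (l : seq nat) (rs : seq raw_stage) (c : nat * (nat * seq stage_sol)) : seq nat :=
  [:: 0; 0] ++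
  flatten [seq [:: nat_of_bool s.1.1; scale l c.2.1 s.1.2] | s <- c.2.2] ++
  flatten [seq flatten [seq flatten [seq [:: nat_of_bool e.2.1; scale l c.2.1 (z.2.2.1 + e.2.2)] |
                                       e <- z.2.2.2 & e.1 == i] |
                        i <- iota 0 (size z.1.2.2)] |
           z <- zip rs c.2.2].

(** The three counters decide whether a chain job, a parallel job or the header of an edge is read,
    so parsing is the iteration of one function. *)
Definition parse_step (s : pstate) : pstate :=
  let tk := s.1.1 in
  let tk2 := behead (behead tk) in
  let x := head 0 tk in
  let y := head 0 (behead tk) in
  let top := head (0, [::]) s.2.2 in
  if s.1.2.1 != 0 then
    ((tk2, (s.1.2.1 - 1, s.1.2.2)), ((x, y) :: s.2.1, s.2.2))
  else if s.1.2.2.1 != 0 then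
    ((behead (behead tk2), (0, (s.1.2.2.1 - 1, s.1.2.2.2))),
     (s.2.1, (top.1, ((x, y), (head 0 tk2, head 0 (behead tk2))) :: top.2) :: behead s.2.2))
  else if s.1.2.2.2 != 0 then
    if x == 0 then ((tk2, (0, (0, s.1.2.2.2 - 1))), (s.2.1, (y, [::]) :: s.2.2))
    else ((tk2, (0, (y, s.1.2.2.2 - 1))), (s.2.1, (0, [::]) :: s.2.2))
  else s.

(** The token list itself is the fuel: every productive step consumes tokens, and afterwards
    [parse_step] is the identity. The pair appended to the chain stands for the sink, which must not
    go to the cloud. *)
Definition parse (tk : seq nat) : seq raw_stage :=
  let n := head 0 (behead (behead tk)) in
  let s := foldl (fun s _ => parse_step s)
             ((behead (behead (behead tk)), (n, (0, n.+1))), ([::], [::])) tk in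
  zip ([seq (true, p) | p <- rev s.2.1] ++ [:: (false, (0, 0))])
      [seq (e.1, rev e.2) | e <- rev s.2.2].

(* A list of length 6 k |tk| + 1, with k in unary: it bounds the rounded makespans. *)
Definition horizon (kun tk : seq nat) : seq nat :=
  0 :: flatten [seq tk ++ tk ++ tk ++ tk ++ tk ++ tk | _ <- kun].

Definition schedule (inp : (seq nat * seq nat) * seq nat) : seq nat :=
  let l := horizon inp.1.1 inp.2 in
  let rs := parse inp.2 in
  let b0 := head 0 (behead inp.2) in
  flatten [seq write l rs c |
     c <- foldl keep_best [::] (flatten [seq candidates l b0 rs U | U <- inp.1.2])].
End Algorithm.

Section PTdp.
Context {V : Type} {K : eqType} {E S : Type} {eV : Enc V} {eK : Enc K} {eE : Enc E} {eS : Enc S}.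
Local Notation entry := (K * (nat * seq S))%type.

Lemma sz_filter {A} {eA : Enc A} (p : pred A) (s : seq A) : sz (filter p s) <= sz s.
Proof. by elim: s => //= a s IH; case: (p a); rewrite !sz_cons; lia. Qed.

Lemma sz_mem {A : eqType} {eA : Enc A} (x : A) (s : seq A) : x \in s -> sz x < sz s.
Proof.
by elim: s => // a s IH; rewrite inE sz_cons => /orP[/eqP ->|/IH]; [have := sz_gt0 s; lia | lia].
Qed.

Lemma PT_dp_insert_fold (t : V -> seq entry) : PT (fun p : K * K => p.1 == p.2) -> PT t ->
  PT (fun e => foldl (@dp_insert K S) [::] (t e)).
Proof.
move=> hK ht; apply: (@PT_foldl_add _ _ _ _ _ _ (fun _ => @dp_insert K S)) => //.
- have hk W (eW : Enc W) (f g : W -> K) : PT f -> PT g -> PT (fun w => f w == g w).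
    by move=> hf hg; apply: (PT_comp hK (PT_pair hf hg)).
  rewrite /dp_insert; pt; apply: hk; pt.
- exact: PT_const.
exists (fun p => sz p + 1); first by pbdt.
move=> e x a; rewrite /dp_insert; case: has; first by lia.
pose proof (sz_filter (fun y => y.1 != a.1) x) as h.
by rewrite sz_cons (_ : sz (e, a) = sz e + sz a + 1) //; lia.
Qed.
End PTdp.

(** * Layered dynamic programming *)

Section LayeredDPTheory.
Variables (K : eqType) (E : Type) (S : eqType).
Local Notation entry := (K * (nat * seq S))%type.
Implicit Types (s t : seq entry) (opt : E -> K -> seq (K * (nat * S))).

Lemma dp_insert_uniq t x : uniq (map fst t) -> uniq (map fst (dp_insert t x)).
Proof.
move=> ut; rewrite /dp_insert; case: has => //=; apply/andP; split.
  by apply/negP => /mapP[y]; rewrite mem_filter => /andP[/eqP h _] h'; apply: h.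
by move: ut; apply: subseq_uniq; apply: map_subseq; apply: filter_subseq.
Qed.

Lemma dp_insert_sub t x : {subset dp_insert t x <= x :: t}.
Proof.
move=> y; rewrite /dp_insert; case: has; first by rewrite inE orbC => ->.
by rewrite !inE mem_filter => /orP[->|/andP[_ ->]] //; rewrite orbT.
Qed.

Lemma dp_insert_dom t x y : y \in x :: t ->
  exists2 z, z \in dp_insert t x & (z.1 == y.1) && (z.2.1 <= y.2.1).
Proof.
rewrite /dp_insert inE; case: hasP => [[z zt hz]|hn] /orP[/eqP->|yt].
- by exists z.
- by exists y; rewrite ?eqxx ?leqnn.
- by exists x; rewrite ?inE ?eqxx ?leqnn.
- case: (eqVneq y.1 x.1) => e; last first.
    by exists y; rewrite ?inE ?mem_filter ?e ?yt ?orbT ?eqxx ?leqnn.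
  exists x; first by rewrite inE eqxx.
  rewrite e eqxx /= leqNgt; apply/negP => h; apply: hn; exists y => //.
  by rewrite e eqxx ltnW.
Qed.

Lemma dp_inserts_spec s : let t := foldl (@dp_insert K S) [::] s in
  [/\ uniq (map fst t), {subset t <= s} &
    forall y, y \in s -> exists2 z, z \in t & (z.1 == y.1) && (z.2.1 <= y.2.1)].
Proof.
elim/last_ind: s => // s x [h1 h2 h3]; rewrite -cats1 foldl_cat /=; split.
- exact: dp_insert_uniq.
- move=> y /dp_insert_sub; rewrite inE mem_cat inE orbC => /orP[/h2 ->|->] //.
  by rewrite orbT.
- move=> y; rewrite mem_cat inE => /orP[/h3[z zt /andP[/eqP e1 e2]]|/eqP ->].
    have [|w wt /andP[/eqP e3 e4]] := @dp_insert_dom (foldl (@dp_insert K S) [::] s) x z.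
      by rewrite inE zt orbT.
    by exists w => //; rewrite e3 e1 eqxx (leq_trans e4 e2).
  by apply: dp_insert_dom; rewrite inE eqxx.
Qed.

Lemma mem_dp_expand opt e t y : y \in dp_expand opt e t ->
  exists2 z, z \in t & exists2 o, o \in opt e z.1 & y = (o.1, (z.2.1 + o.2.1, o.2.2 :: z.2.2)).
Proof. by move=> /flattenP[l /mapP[z zt ->] /mapP[o ho ->]]; exists z => //; exists o. Qed.

Lemma dp_rcons opt init es e : dp opt init (rcons es e) = dp_step opt (dp opt init es) e.
Proof. by rewrite /dp -cats1 foldl_cat. Qed.

Lemma dp_sound opt (k0 : K) (P : seq E -> K -> nat -> seq S -> Prop) :
  P [::] k0 0 [::] ->
  (forall es e k c ss o, P es k c ss -> o \in opt e k -> P (rcons es e) o.1 (c + o.2.1) (o.2.2 :: ss)) ->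
  forall es y, y \in dp opt [:: (k0, (0, [::]))] es -> P es y.1 y.2.1 y.2.2.
Proof.
move=> h0 hS; elim/last_ind => [|es e IH] y; first by rewrite /dp /= inE => /eqP ->; exact: h0.
rewrite dp_rcons => hy; have [_ hsub _] := dp_inserts_spec (dp_expand opt e (dp opt [:: (k0, (0, [::]))] es)).
have /mem_dp_expand[z zt [o ho ->]] := hsub _ hy; exact: (hS _ _ _ _ _ _ (IH _ zt) ho).
Qed.

(** [kap] and [gam] describe an intended path of keys and bounds on its cost. Options depend on the
    key alone, so an entry that has displaced the intended one at the same key can take the same
    option at no higher cost. *)
Lemma dp_complete opt k0 (kap : seq E -> K) (gam : seq E -> nat) es :
  kap [::] = k0 ->
  (forall es1 e es2, es = es1 ++ e :: es2 ->
     exists2 o, o \in opt e (kap es1) &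
       (o.1 == kap (rcons es1 e)) && (gam es1 + o.2.1 <= gam (rcons es1 e))) ->
  exists2 y, y \in dp opt [:: (k0, (0, [::]))] es & (y.1 == kap es) && (y.2.1 <= gam es).
Proof.
move=> h0 hS.
suff H es1 es2 : es = es1 ++ es2 ->
  exists2 y, y \in dp opt [:: (k0, (0, [::]))] es1 & (y.1 == kap es1) && (y.2.1 <= gam es1).
  by apply: (H es [::]); rewrite cats0.
elim/last_ind: es1 es2 => [|es1 e IH] es2 he.
  by exists (k0, (0, [::])); rewrite ?inE ?h0 ?eqxx.
rewrite cat_rcons in he; have [y hy /andP[/eqP e1 e2]] := IH _ he.
have [o ho /andP[/eqP e3 e4]] := hS _ _ _ he.
pose z : entry := (o.1, (y.2.1 + o.2.1, o.2.2 :: y.2.2)).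
have hz : z \in dp_expand opt e (dp opt [:: (k0, (0, [::]))] es1).
  apply/flattenP; exists [seq (o.1, (y.2.1 + o.2.1, o.2.2 :: y.2.2)) | o <- opt e y.1].
    by apply/mapP; exists y.
  by rewrite e1; apply/mapP; exists o.
have [_ _ hd] := dp_inserts_spec (dp_expand opt e (dp opt [:: (k0, (0, [::]))] es1)).
have [w hw /andP[/eqP e5 e6]] := hd _ hz.
exists w; first by rewrite dp_rcons.
rewrite e5 /= e3 eqxx /=; apply: leq_trans e6 _; rewrite /=.
by apply: leq_trans e4; rewrite leq_add2r.
Qed.
End LayeredDPTheory.

Lemma sz_le_seq {A : eqType} {eA : Enc A} m (s : seq A) :
  (forall a, a \in s -> sz a <= m) -> sz s <= 1 + size s * m.+1.
Proof.
elim: s => // a s IH h; rewrite sz_cons /= mulSn.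
have h1 : sz a <= m by apply: h; rewrite inE eqxx.
have h2 : sz s <= 1 + size s * m.+1 by apply: IH => x hx; apply: h; rewrite inE hx orbT.
by lia.
Qed.

Section PTdp2.
Context {V : Type} {K E S : eqType} {eV : Enc V} {eK : Enc K} {eE : Enc E} {eS : Enc S}.
Local Notation entry := (K * (nat * seq S))%type.

(** A table has one entry per key, so it stays small if the reachable keys, singled out by [Kok],
    are few. The cost is a single node, and the list of choices grows by one bounded element per
    layer. *)
Lemma PT_dp (opt : V -> E -> K -> seq (K * (nat * S))) (k0 : V -> K) (es : V -> seq E)
    (Kok : V -> pred K) (M : V -> nat) :
  PT (fun p : (V * E) * K => opt p.1.1 p.1.2 p.2) -> PT k0 -> PT es -> PT (fun p : K * K => p.1 == p.2) ->
  pbd M -> (forall v, Kok v (k0 v)) ->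
  (forall v e k o, Kok v k -> o \in opt v e k -> Kok v o.1) ->
  (forall v k, Kok v k -> sz k <= M v) ->
  (forall v s, uniq s -> all (Kok v) s -> size s <= M v) ->
  PT (fun v => dp (opt v) [:: (k0 v, (0, [::]))] (es v)).
Proof.
move=> hopt hk0 hes hK hM Hk0 Hopt HszK Hcard.
have hopt' W (eW : Enc W) (f : W -> V) (g : W -> E) (h : W -> K) : PT f -> PT g -> PT h ->
    PT (fun w => opt (f w) (g w) (h w)).
  by move=> hf hg hh; apply: (PT_comp hopt (PT_pair (PT_pair hf hg) hh)).
apply: PT_foldl => //.
- apply: PT_dp_insert_fold => //.
  rewrite /dp_expand; pt; apply: hopt'; pt.
- by apply: PT_cons; [|apply: PT_const]; apply: PT_pair => //; apply: PT_const.
have [d hd] := PT_sz hopt.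
(* Bounds every list of options that a layer can offer, hence every recorded choice. *)
pose Bd := fun v : V => (@sz _ eV v + @sz _ (enc_seq eE) (es v) + M v + 4) ^ d.
exists (fun v => M v + 10 + M v * (M v + 1 + sz (es v) * (Bd v + 1) + 5)).
  have h1 : pbd (fun v => sz (es v)) := PT_sz hes.
  rewrite /Bd; pbdt => //.
move=> v l1 l2 hl.
have szE (e : E) : e \in es v -> sz e <= sz (es v) by move=> he; apply: ltnW; apply: sz_mem.
have szopt e k o : e \in es v -> Kok v k -> o \in opt v e k -> sz o.2.2 <= Bd v.
  move=> he hk ho.
  have h1 : sz o.2.2 <= sz o by rewrite /sz /=; lia.
  apply: leq_trans h1 (leq_trans (ltnW (sz_mem ho)) _).
  apply: leq_trans (hd (v, e, k)) _; rewrite /Bd; case: (d) => // q; rewrite leq_exp2r //.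
  rewrite (_ : sz (v, e, k) = sz v + sz e + 1 + sz k + 1) //.
  by have := szE _ he; have := HszK _ _ hk; lia.
suff [H1 H2] : (forall y, y \in dp (opt v) [:: (k0 v, (0, [::]))] l1 ->
     Kok v y.1 /\ @sz _ (enc_seq eS) y.2.2 <= 1 + size l1 * (Bd v + 1)) /\
     uniq (map fst (dp (opt v) [:: (k0 v, (0, [::]))] l1)).
  set t := dp _ _ _ in H1 H2.
  have h3 : size t <= M v.
    rewrite -(size_map fst); apply: Hcard => //; apply/allP => k /mapP[y /H1[hy _] ->] //.
  have h4 : size l1 <= sz (es v).
    by apply: ltnW; apply: leq_ltn_trans (sz_size (es v)); rewrite hl size_cat leq_addr.
  have h5 : size l1 * (Bd v + 1) <= sz (es v) * (Bd v + 1) by rewrite leq_mul2r h4 orbT.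
  pose eT := enc_prod eK (enc_prod enc_nat (enc_seq eS)).
  apply: leq_trans (@sz_le_seq (K * (nat * seq S))%type eT (M v + 1 + sz (es v) * (Bd v + 1) + 4) t _) _.
    move=> y hy; have [hy1 hy2] := H1 _ hy.
    rewrite (_ : @sz _ eT y = @sz _ eK y.1 + (1 + @sz _ (enc_seq eS) y.2.2 + 1) + 1) //.
    by have := HszK _ _ hy1; lia.
  rewrite -addnS; set q := (M v + 1 + _ + 5).
  have : size t * q <= M v * q by rewrite leq_mul2r h3 orbT.
  by move: (size t * q) (M v * q) => *; lia.
elim/last_ind: l1 l2 hl => [|l1 e IH] l2 hl.
  by split=> [y|//]; rewrite /dp /= inE => /eqP ->; split; [exact: Hk0 | rewrite mul0n addn0].
rewrite cat_rcons in hl; have [IH1 IH2] := IH _ hl.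
have he : e \in es v by rewrite hl mem_cat inE eqxx orbT.
rewrite dp_rcons.
have [h1 h2 _] := dp_inserts_spec (dp_expand (opt v) e (dp (opt v) [:: (k0 v, (0, [::]))] l1)).
split=> // y hy; have [z zt [o ho ->]] := mem_dp_expand (h2 _ hy).
have [hz1 hz2] := IH1 _ zt; split; first exact: (Hopt _ _ _ _ hz1 ho).
rewrite size_rcons sz_cons mulSn; have h3 := szopt _ _ _ he hz1 ho.
by lia.
Qed.
End PTdp2.

(** * The algorithm runs in polynomial time *)

Section PTalg.
Context {V : Type} {eV : Enc V}.

Lemma PT_block_opt D (l : V -> seq nat) a b T (x : V -> item) iv :
  PT l -> PT a -> PT b -> PT T -> PT x -> PT iv ->
  PT (fun v => block_opt D (l v) (a v) (b v) (T v) (x v) (iv v)).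
Proof. move=> *; rewrite /block_opt /advance /t_in /t_out /t_ps /t_pc; cbv zeta; pt. Qed.

(** [n] is a constant of the program and not an input: there are at most [size l ^ n.+2] guesses. *)
Lemma PT_guesses n (l : V -> seq nat) : PT l -> PT (fun v => guesses n (l v)).
Proof.
move=> hl; elim: n => [|n IH]; rewrite /guesses; first by pt.
by rewrite -/guesses /lower; pt.
Qed.

Lemma PT_sort_out (s : V -> seq item) : PT s -> PT (fun v => sort_out (s v)).
Proof.
move=> hs; apply: (@PT_foldl_add _ _ _ _ _ _ (fun _ => insert_out)) => //.
- by rewrite /insert_out /t_out; pt.
- exact: PT_const.
exists (fun p => sz p + 1); first by pbdt.
move=> e x a; rewrite /insert_out.
set p := fun y : item => _ <= _; set q := fun y : item => _ < _.
have -> : filter q x = filter (predC p) x by apply: eq_filter => y; rewrite /q /p /= ltnNge.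
pose proof (sz_cat (filter p x) (a :: filter (predC p) x)) as h1.
rewrite sz_cons in h1.
have h2 : sz (filter p x) + sz (filter (predC p) x) = sz x + 1.
  elim: (x) => // y r IH /=; case: (p y); rewrite /= !sz_cons; lia.
by rewrite (_ : sz (e, a) = sz e + sz a + 1) //; lia.
Qed.
End PTalg.

(** Serves to count the possible vectors of fronts. *)
Fixpoint words {A : Type} n (L : seq A) : seq (seq A) :=
  if n is n'.+1 then flatten [seq [seq x :: t | t <- words n' L] | x <- L] else [:: [::]].

Lemma size_words {A : Type} n (L : seq A) : size (words n L) = size L ^ n.
Proof.
elim: n => //= n IH; rewrite expnS.
have H s : size (flatten [seq [seq x :: t | t <- words n L] | x <- s]) = size s * size L ^ n.
  by elim: s => //= x s IHs; rewrite size_cat size_map IH IHs mulSn.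
exact: H.
Qed.

Lemma mem_words {A : eqType} n (L t : seq A) : size t = n -> all (mem L) t -> t \in words n L.
Proof.
elim: n t => [|n IH] [|x t] //= [st] /andP[xL tL].
by apply/flattenP; exists [seq x :: t | t <- words n L]; apply/mapP; [exists x | exists t; rewrite ?IH].
Qed.

Definition forget (e : slot) := (e.1, e.2.2).
Definition front (e : slot) := e.2.1.

Lemma forget_advance iv m f : map forget (advance iv m f) = map forget iv.
Proof. by rewrite /advance -map_comp; apply: eq_map => e /=; case: ifP. Qed.

(** Identifiers and limits never change, so a key reachable from [k0] is determined by its fronts,
    each of which is an initial front or lies below [size l]. *)
Definition slots_ok n (l : seq nat) (k0 k : seq slot) : bool :=
  (k == k0) || [&& size k == n, map forget k == map forget k0 &
                   all (mem (map front k0 ++ iota 0 (size l))) (map front k)].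

Lemma slots_ok_card n l k0 (s : seq (seq slot)) : uniq s -> all (slots_ok n l k0) s ->
  size s <= 1 + (size k0 + size l) ^ n.
Proof.
move=> us /allP hs; pose L := map front k0 ++ iota 0 (size l).
pose dec (fs : seq nat) : seq slot := [seq (p.1.1, (p.2, p.1.2)) | p <- zip (map forget k0) fs].
apply: leq_trans (uniq_leq_size us (_ : {subset s <= k0 :: [seq dec t | t <- words n L]})) _.
  move=> k /hs /orP[/eqP->|/and3P[/eqP h1 /eqP h2 h3]]; first by rewrite inE eqxx.
  rewrite inE; apply/orP; right; apply/mapP; exists (map front k).
    by apply: mem_words => //; rewrite size_map.
  rewrite /dec -h2; elim: (k) => //= e r <-; by case: e => ? [].
by rewrite /= size_map size_words /L size_cat size_map size_iota add1n.
Qed.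

Lemma sz_slots (k : seq slot) : sz k = 6 * size k + 1.
Proof. by elim: k => //= e k IH; rewrite sz_cons IH (_ : sz e = 5) //; lia. Qed.

Lemma sz_pair {A B} {eA : Enc A} {eB : Enc B} (p : A * B) : sz p = sz p.1 + sz p.2 + 1.
Proof. by []. Qed.

Lemma sz_snd_snd {A B C} {eA : Enc A} {eB : Enc B} {eC : Enc C} (p : A * (B * C)) :
  sz p.2.2 <= sz p.
Proof. by rewrite (sz_pair p) (sz_pair p.2); lia. Qed.

Lemma block_opt_ok D (l : seq nat) a b T x k0 k o : slots_ok D.+1 l k0 k ->
  o \in block_opt D l a b T x k -> slots_ok D.+1 l k0 o.1.
Proof.
move=> hk; rewrite /block_opt mem_cat => /orP[|/mapP[e]].
  by case: ifP => // _; rewrite inE => /eqP ->.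
rewrite mem_filter => /andP[/and5P[/eqP h1 _ _ _ h2] he] -> /=.
have hk' : map forget k = map forget k0 /\ all (mem (map front k0 ++ iota 0 (size l))) (map front k).
  case/orP: hk => [/eqP->|/and3P[_ /eqP -> ->]] //; split=> //.
  by apply/allP => f hf; rewrite /= mem_cat hf.
case: hk' => h3 h4.
rewrite /slots_ok forget_advance h3 eqxx size_map h1 eqxx /=; apply/orP; right.
apply/allP => f /mapP[e' /mapP[e'' he'' ->] ->].
case: ifP => _; first by rewrite /= /front /= mem_cat mem_iota h2 orbT.
by apply: (allP h4); apply: map_f.
Qed.

Lemma PT_eqslots {W} {eW : Enc W} (f g : W -> seq slot) : PT f -> PT g -> PT (fun w => f w == g w).
Proof.
move=> hf hg; apply: PT_eqseq => //; apply: PT_eqpair; first by pt.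
by apply: PT_eqpair; pt.
Qed.

Lemma PT_block_sols {V} {eV : Enc V} D (l : V -> seq nat) (a b : V -> bool) (s : V -> seq item) :
  PT l -> PT a -> PT b -> PT s -> PT (fun v => block_sols D (l v) (a v) (b v) (s v)).
Proof.
move=> hl ha hb hs; rewrite /block_sols.
have hg := PT_guesses D hl; have hso := PT_sort_out hs.
pt.
have [szw [hs1 hs2]] : exists szw : V * (nat * seq slot) -> nat, pbd szw /\ forall w, sz w.2.2 <= szw w.
  by exists (fun w => sz w); split; [exact: pbd_sz | move=> w; exact: sz_snd_snd].
apply: (@PT_dp (V * (nat * seq slot))%type (seq slot) item placed _ _ _ _
  (fun w x k => block_opt D (l w.1) (a w.1) (b w.1) w.2.1 x k) (fun w => w.2.2)
  (fun w => sort_out (s w.1)) (fun w => slots_ok D.+1 (l w.1) w.2.2)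
  (fun w => szw w + 6 * D + 10 + (szw w + sz (l w.1)) ^ D.+1)).
- by apply: PT_block_opt; pt.
- by pt.
- by apply: (PT_comp hso); pt.
- by apply: PT_eqslots; pt.
- by pbdt => //; exact: (PT_sz (PT_comp hl (PT_fst PT_id))).
- by move=> w; rewrite /slots_ok eqxx.
- by move=> w x k o; apply: block_opt_ok.
- move=> w k /orP[/eqP->|/and3P[/eqP h _ _]].
    by apply: leq_trans (hs2 w) _; lia.
  by rewrite sz_slots h; lia.
- move=> w t ut ht; apply: leq_trans (slots_ok_card ut ht) _.
  have h1 : size w.2.2 <= szw w by apply: leq_trans (ltnW (sz_size w.2.2)) (hs2 w).
  have h2 : size (l w.1) <= sz (l w.1) by apply: ltnW; apply: sz_size.
  have : (size w.2.2 + size (l w.1)) ^ D.+1 <= (szw w + sz (l w.1)) ^ D.+1.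
    by rewrite leq_exp2r // leq_add.
  by lia.
Qed.

Lemma PT_stage_opt {V} {eV : Enc V} D (l : V -> seq nat) (st : V -> stage) (k : V -> bool * nat) :
  PT l -> PT st -> PT k -> PT (fun v => stage_opt D (l v) (st v) (k v)).
Proof.
move=> hl hst hk; rewrite /stage_opt; pt.
by apply: PT_block_sols; pt.
Qed.

Lemma stage_opt_ok D l st k o : o \in stage_opt D l st k -> o.1.2 < size l.
Proof.
by move=> /flattenP[t /mapP[b _ ->] /mapP[g]]; rewrite mem_filter => /andP[/andP[_ h] _] ->.
Qed.

Lemma PT_chain_sols {V} {eV : Enc V} D (l : V -> seq nat) (sts : V -> seq stage) :
  PT l -> PT sts -> PT (fun v => chain_sols D (l v) (sts v)).
Proof.
move=> hl hst; apply: (@PT_dp V (bool * nat)%type stage stage_sol _ _ _ _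
  (fun v => stage_opt D (l v)) (fun=> (false, 0)) sts (fun v k => k.2 < (size (l v)).+1)
  (fun v => 10 + 2 * sz (l v))) => //.
- by apply: PT_stage_opt; pt.
- exact: PT_const.
- by apply: PT_eqpair; pt.
- by pbdt; exact: PT_sz.
- by move=> v e k o _ /stage_opt_ok h; apply: ltnW.
- move=> v s us /allP hs.
  apply: leq_trans (uniq_leq_size us (_ : {subset s <= [seq (b, t) | b <- [:: true; false],
     t <- iota 0 (size (l v)).+1]})) _.
    move=> [b t] /hs h; apply/allpairsP; exists (b, t); rewrite mem_iota; split=> //.
    by case: b {h}.
  by rewrite size_allpairs size_iota; pose proof (sz_size (l v)); rewrite /=; lia.
Qed.

Lemma PT_scale {V} {eV : Enc V} (l : V -> seq nat) (U c : V -> nat) : PT l -> PT U -> PT c ->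
  PT (fun v => scale (l v) (U v) (c v)).
Proof.
move=> hl hU hc; apply: PT_foldl_add; [by pt | by pt | by pt |].
by exists (fun=> 1); first by pbdt.
Qed.

Lemma PT_roundup {V} {eV : Enc V} (ms : V -> seq nat) (p : V -> nat) : PT ms -> PT p -> PT (fun v => roundup (ms v) (p v)).
Proof. by move=> *; rewrite /roundup; pt. Qed.

Lemma PT_round_stage {V} {eV : Enc V} (ms : V -> seq nat) (r : V -> raw_stage) : PT ms -> PT r ->
  PT (fun v => round_stage (ms v) (r v)).
Proof.
move=> hm hr; rewrite /round_stage /round_times /t_ps /t_pc /t_in /t_out; pt;
by apply: PT_roundup; pt.
Qed.

Lemma PT_candidates {V} {eV : Enc V} D (l : V -> seq nat) (b0 : V -> nat) (rs : V -> seq raw_stage) (U : V -> nat) : PT l -> PT b0 -> PT rs -> PT U ->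
  PT (fun v => candidates D (l v) (b0 v : nat) (rs v) (U v)).
Proof.
move=> hl hb hr hU; rewrite /candidates; cbv zeta; pt; try by apply: PT_scale; pt.
apply: PT_chain_sols; pt; apply: PT_round_stage; pt; by apply: PT_scale; pt.
Qed.

Lemma PT_write {V} {eV : Enc V} (l : V -> seq nat) (rs : V -> seq raw_stage) (c : V -> nat * (nat * seq stage_sol)) : PT l -> PT rs -> PT c ->
  PT (fun v => write (l v) (rs v) (c v)).
Proof. by move=> hl hr hc; rewrite /write; pt; apply: PT_scale; pt. Qed.

Lemma PT_parse_step {V} {eV : Enc V} (s : V -> pstate) : PT s -> PT (fun v => parse_step (s v)).
Proof.
move=> hs; rewrite /parse_step; cbv zeta; pt.
Qed.

Lemma sz_nat (n : nat) : sz n = 1. Proof. by []. Qed.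

Lemma sz_nil {A} {eA : Enc A} : sz ([::] : seq A) = 1. Proof. by []. Qed.

Lemma sz_behead {A} {eA : Enc A} (s : seq A) : sz (behead s) <= sz s.
Proof. by case: s => //= a s; rewrite sz_cons; lia. Qed.

Lemma sz_parse_step (s : pstate) : sz (parse_step s) <= sz s + 30.
Proof.
case: s => [[tk [nc [nj ne]]] [ch es]]; rewrite /parse_step /=.
pose proof (sz_behead tk) as h1; pose proof (sz_behead (behead tk)) as h2.
pose proof (sz_behead (behead (behead tk))) as h3.
pose proof (sz_behead (behead (behead (behead tk)))) as h4.
case: ifP => _; last case: ifP => _; last case: ifP => _; last by lia.
- by rewrite !(sz_pair, sz_cons) /= !sz_nat; lia.
- have h5 : sz (((head (0, [::]) es).1, (head 0 tk, head 0 (behead tk),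
    (head 0 (behead (behead tk)), head 0 (behead (behead (behead tk))))) :: (head (0, [::]) es).2) :: behead es)
    <= sz es + 20.
    by case: (es) => [|e r] //=; rewrite !(sz_pair, sz_cons) /= !sz_nat; lia.
  by rewrite !(sz_pair ((_, _) : pstate)) /= !(sz_pair, sz_cons) /= !sz_nat in h5 *; lia.
- by case: ifP => _; rewrite !(sz_pair, sz_cons) /= !sz_nat sz_nil; lia.
Qed.

Lemma PT_parse {V} {eV : Enc V} (tk : V -> seq nat) : PT tk -> PT (fun v => parse (tk v)).
Proof.
move=> htk; rewrite /parse; cbv zeta.
have hf : PT (fun v => foldl (fun s _ => parse_step s) ((behead (behead (behead (tk v))),
    (head 0 (behead (behead (tk v))), (0, (head 0 (behead (behead (tk v)))).+1))), ([::], [::])) (tk v)).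
  apply: (@PT_foldl_add _ _ _ _ _ _ (fun _ s _ => parse_step s)) => //.
  - by apply: PT_parse_step; pt.
  - by pt.
  exists (fun=> 30); first by pbdt.
  by move=> _ s _; exact: sz_parse_step.
pt.
Qed.

Lemma PT_schedule D : PT (schedule D).
Proof.
rewrite /schedule; cbv zeta.
have hl : PT (fun i : (seq nat * seq nat) * seq nat => horizon i.1.1 i.2) by rewrite /horizon; pt.
have hp : PT (fun i : (seq nat * seq nat) * seq nat => parse i.2) by apply: PT_parse; pt.
have hb : PT (fun i : (seq nat * seq nat) * seq nat => foldl keep_best [::]
    (flatten [seq candidates D (horizon i.1.1 i.2) (head 0 (behead i.2)) (parse i.2) U | U <- i.1.2])).
  apply: (@PT_foldl_add _ _ _ _ _ _ (fun _ => keep_best)).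
  - by rewrite /keep_best; pt.
  - by pt.
  - pt; apply: PT_candidates; pt.
      by apply: (PT_comp hl); pt.
    by apply: (PT_comp hp); pt.
  exists (fun p => sz p + 1); first by pbdt.
  move=> e x a; rewrite /keep_best; case: ifP => _; last by lia.
  by rewrite sz_cons sz_nil (sz_pair (e, a)) /=; pose proof (sz_gt0 x); lia.
pt; apply: PT_write; pt.
  by apply: (PT_comp hl); pt.
by apply: (PT_comp hp); pt.
Qed.

(** * Parsing and rounding *)

Definition times_of (p : pjob) : times := ((pj_ps p, pj_pc p), (pj_cin p, pj_cout p)).

Definition edge_of_chain (e : chain_edge) : edge_data :=
  match e with Kept c => (c, [::]) | Replaced l => (0, map times_of l) end.

Definition raw_stages (I : ec_instance) : seq raw_stage :=
  zip ([seq (true, p) | p <- ch I] ++ [:: (false, (0, 0))]) (map edge_of_chain (ed I)).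

Definition rev_edge (e : edge_data) : edge_data := (e.1, rev e.2).

Lemma parse_chain (c : seq (nat * nat)) r w acc es :
  iter (size c) parse_step ((flatten [seq [:: p.1; p.2] | p <- c] ++ r, (size c, w)), (acc, es)) =
  ((r, (0, w)), (catrev c acc, es)).
Proof.
elim: c acc => //= p c IH acc; rewrite -iterS iterSr /= -IH; congr iter.
by rewrite /parse_step /= subn1; case: p.
Qed.

Lemma parse_jobs (l : seq pjob) r m c d js es :
  iter (size l) parse_step ((flatten (map enc_pjob l) ++ r, (0, (size l, m))), (c, (d, js) :: es)) =
  ((r, (0, (0, m))), (c, (d, catrev (map times_of l) js) :: es)).
Proof.
elim: l js => //= p l IH js; rewrite -iterS iterSr /= -IH; congr iter.
by rewrite /parse_step /= subn1.
Qed.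

Definition edge_steps (e : chain_edge) : nat := if e is Replaced l then (size l).+1 else 1.

Lemma parse_edge e r m c es :
  iter (edge_steps e) parse_step ((enc_edge e ++ r, (0, (0, m.+1))), (c, es)) =
  ((r, (0, (0, m))), (c, rev_edge (edge_of_chain e) :: es)).
Proof.
case: e => [d|l] /=; first by rewrite /parse_step /= subn1.
by rewrite -iterS iterSr /parse_step /= -/parse_step subn1 /= parse_jobs catrevE cats0.
Qed.

Lemma parse_edges (s : seq chain_edge) r c es :
  iter (sumn (map edge_steps s)) parse_step
    ((flatten (map enc_edge s) ++ r, (0, (0, size s))), (c, es)) =
  ((r, (0, (0, 0))), (c, catrev (map (rev_edge \o edge_of_chain) s) es)).
Proof.
elim: s es => //= e s IH es; rewrite addnC iterD -catA parse_edge.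
exact: IH.
Qed.

Lemma parse_done r c es m : iter m parse_step ((r, (0, (0, 0))), (c, es)) = ((r, (0, (0, 0))), (c, es)).
Proof. by elim: m => //= m ->. Qed.

Lemma size_enc_edges s : sumn (map edge_steps s) <= size (flatten (map enc_edge s)).
Proof.
elim: s => //= e s IH; rewrite size_cat leq_add //; case: e => //= l.
have: size l <= size (flatten (map enc_pjob l)); last by lia.
by elim: l => //= p l IHl; lia.
Qed.

Lemma foldl_iter {T A : Type} (f : T -> T) (s : seq A) x :
  foldl (fun y _ => f y) x s = iter (size s) f x.
Proof. by elim: s x => //= a s IH x; rewrite IH -iterSr. Qed.

(** The counters reach zero exactly at the end of the encoding; the remaining iterations leave the
    state alone, so the padding [z] is never read. *)
Lemma parse_correct I b k z : size (ed I) = (ec_n I).+1 ->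
  parse (enc_input I b k ++ z) = raw_stages I.
Proof.
move=> hs; rewrite /parse foldl_iter /enc_input /enc_instance.
set c := flatten [seq [:: p.1; p.2] | p <- ch I]; set e := flatten (map enc_edge (ed I)).
set tk := _ ++ z.
have -> : behead (behead (behead tk)) = c ++ (e ++ z) by rewrite /tk /= catA.
have -> : head 0 (behead (behead tk)) = ec_n I by [].
pose m1 := ec_n I; pose m2 := sumn (map edge_steps (ed I)).
have hm : m1 + m2 <= size tk.
  rewrite /tk /= !size_cat -/c -/e.
  have : size (ch I) <= size c by rewrite /c; elim: (ch I) => //= p s; lia.
  by have := size_enc_edges (ed I); rewrite -/e /m1 /m2 /ec_n; lia.
rewrite -(subnKC hm) -addnA addnC iterD parse_chain addnC iterD -hs parse_edges parse_done /=.
rewrite !catrevE !cats0 revK revK -map_comp /raw_stages; congr zip.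
by rewrite map_comp -map_comp; apply: eq_map => x /=; rewrite revK; case: (edge_of_chain x).
Qed.

Lemma iota0_rcons n : iota 0 n.+1 = rcons (iota 0 n) n.
Proof. by rewrite -addn1 iotaD cats1. Qed.

Lemma scaleE l U c : scale l U c = U * minn c (size l).
Proof.
rewrite /scale; elim: (size l) => [|n IH]; first by rewrite minn0 muln0.
rewrite iota0_rcons -cats1 foldl_cat /= IH.
case: ltnP => h; last by rewrite !(minn_idPl _) //; lia.
by rewrite !(minn_idPr _) ?mulnS; lia.
Qed.

Definition multiples (l : seq nat) U := [seq scale l U h | h <- iota 0 (size l)].

Lemma roundupE l U p : 0 < U -> roundup (multiples l U) p = minn ((p + U.-1) %/ U) (size l).
Proof.
move=> U0; rewrite /roundup size_filter /multiples count_map.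
have -> : count (preim (scale l U) (fun m => m < p)) (iota 0 (size l)) =
          count (fun h => U * h < p) (iota 0 (size l)).
  apply: eq_in_count => h; rewrite mem_iota /= scaleE => hh.
  by rewrite (minn_idPl _) //; lia.
elim: (size l) => [|n IH]; first by rewrite minn0.
rewrite iota0_rcons -cats1 count_cat IH /= addn0.
have -> : (U * n < p) = (n < (p + U.-1) %/ U).
  by rewrite leq_divRL // mulSn mulnC; lia.
by case: ltnP => h; lia.
Qed.

Section Rounding.
Variables (l : seq nat) (U : nat).
Hypothesis U_gt0 : 0 < U.
Local Notation g := (roundup (multiples l U)).

Lemma roundup_mono p p' : p <= p' -> g p <= g p'.
Proof.
move=> h; rewrite !roundupE //.
have : (p + U.-1) %/ U <= (p' + U.-1) %/ U by apply: leq_div2r; lia.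
lia.
Qed.

Lemma roundup0 : g 0 = 0.
Proof. by rewrite roundupE // add0n divn_small ?min0n //; lia. Qed.

Lemma roundup_le p : g p <= p.
Proof.
rewrite roundupE //; apply: leq_trans (geq_minl _ _) _.
case: p => [|p]; first by rewrite add0n divn_small //; lia.
by rewrite -ltnS ltn_divLR //; nia.
Qed.

(** The strict inequality says that the cap of [roundup] has not been reached. *)
Lemma roundup_ge p : g p < size l -> p <= U * g p.
Proof.
rewrite roundupE // => h; have e : minn ((p + U.-1) %/ U) (size l) = (p + U.-1) %/ U by lia.
rewrite e; have := divn_eq (p + U.-1) U; have := ltn_pmod (p + U.-1) U_gt0; lia.
Qed.

Lemma roundup_lt p : g p <= p %/ U + 1.
Proof.
rewrite roundupE //; apply: leq_trans (geq_minl _ _) _.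
rewrite -[p in p %/ U](addKn U) -ltnS ltn_divLR // addKn.
have := divn_eq p U; have := ltn_pmod p U_gt0; move: (p %/ U) => q; nia.
Qed.
End Rounding.

Lemma size_horizon k tk : size (horizon (nseq k 0) tk) = (6 * k * size tk).+1.
Proof.
rewrite /horizon /=; congr _.+1; elim: k => [|k IH]; first by rewrite muln0 mul0n.
by rewrite /= size_cat IH !size_cat; lia.
Qed.

(** * Parallel subgraphs *)

Lemma perm_insert_out acc x : perm_eq (insert_out acc x) (x :: acc).
Proof.
rewrite /insert_out -[x :: _]cat1s perm_catCA /= perm_cons.
rewrite (eq_filter (a1 := fun y => t_out y.2.1 < _) (a2 := predC (fun y => t_out x.2.1 <= t_out y.2.1))).
  by rewrite perm_filterC.
by move=> y /=; rewrite ltnNge.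
Qed.

Lemma perm_sort_out s : perm_eq (sort_out s) s.
Proof.
elim/last_ind: s => // s x IH; rewrite /sort_out -cats1 foldl_cat /= -/(sort_out s).
by apply: perm_trans (perm_insert_out _ _) _; rewrite perm_sym cats1 perm_rcons perm_sym perm_cons.
Qed.

Definition out_geq (x y : item) := t_out y.2.1 <= t_out x.2.1.

Lemma sort_out_sorted s : pairwise out_geq (sort_out s).
Proof.
elim/last_ind: s => // s x IH; rewrite /sort_out -cats1 foldl_cat /= -/(sort_out s) /insert_out.
rewrite pairwise_cat /= !pairwise_filter // !andbT; apply/andP; split.
  apply/allrelP => y z; rewrite mem_filter inE mem_filter => /andP[h1 _] /orP[/eqP->|/andP[h2 _]] //.
  by rewrite /out_geq; lia.
by apply/allP => z; rewrite mem_filter /out_geq => /andP[h _]; lia.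
Qed.

(* Slot [m] of a guess spans [gam m.+1, gam m]; slot 0 is the last one in time. *)
Definition slots_of (F gam : nat -> nat) n : seq slot :=
  [seq (m, (F m, gam m)) | m <- rev (iota 0 n.+1)].

Lemma slots_ofS F gam n : slots_of F gam n.+1 = (n.+1, (F n.+1, gam n.+1)) :: slots_of F gam n.
Proof. by rewrite /slots_of iota0_rcons rev_rcons. Qed.

(** A guess amounts to [n.+2] nonincreasing cut points; the function [gam] replaces the nested lists
    in all later arguments. *)
Lemma guessesP n l g : reflect (exists gam : nat -> nat, [/\ gam 0 = g.1,
    g.2 = slots_of (fun m => gam m.+1) gam n, forall m, m <= n -> gam m.+1 <= gam m & gam 0 < size l])
  (g \in guesses n l).
Proof.
apply: (iffP idP).
  elim: n g => [|n IH] g.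
    move=> /flattenP[t /mapP[u]]; rewrite mem_iota => /andP[_ hu] -> /mapP[b].
    rewrite mem_filter => /andP[hb _] ->.
    by exists (fun m => if m == 0 then u else b); split=> // m; rewrite leqn0 => /eqP ->.
  move=> /flattenP[t /mapP[g' /IH[gam [h1 h2 h3 h4]] ->] /mapP[b]].
  rewrite mem_filter => /andP[hb _] ->.
  have hl : lower g' = gam n.+1.
    rewrite /lower h2; case: (n) => [|q] //; by rewrite slots_ofS.
  rewrite hl in hb *.
  exists (fun m => if m == n.+2 then b else gam m); split=> //=.
  - rewrite slots_ofS eqxx /= (_ : n.+1 == n.+2 = false); last by lia.
    congr cons; rewrite h2; apply/eq_in_map => m; rewrite mem_rev mem_iota => hm.
    by rewrite !ifF //; lia.
  - move=> m hm; rewrite (_ : (m == n.+2) = false); last by lia.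
    by case: eqP => [e|ne]; [rewrite (_ : m = n.+1) //; lia | apply: h3; lia].
elim: n g => [|n IH] g [gam [h1 h2 h3 h4]].
  apply/flattenP; exists [seq (g.1, [:: (0, (b, g.1))]) | b <- iota 0 (size l) & b <= g.1].
    by apply/mapP; exists g.1 => //; rewrite mem_iota -h1.
  apply/mapP; exists (gam 1).
    by rewrite mem_filter mem_iota -h1 h3 //=; have := h3 0 isT; lia.
  by case: g h1 h2 => g1 g2 /= <- ->.
have hg : (g.1, slots_of (fun m => gam m.+1) gam n) \in guesses n l.
  by apply: IH; exists gam; split=> // m hm; apply: h3; lia.
have hdec m : m <= n.+1 -> gam m.+1 <= gam 0.
  elim: m => [|m IHm] hm; first exact: h3.
  by apply: leq_trans (h3 _ hm) (IHm _); lia.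
apply/flattenP; eexists; first by apply/mapP; exists (g.1, slots_of (fun m => gam m.+1) gam n).
have hl : lower (g.1, slots_of (fun m => gam m.+1) gam n) = gam n.+1.
  by rewrite /lower; case: (n) => [|q] //; rewrite slots_ofS.
apply/mapP; exists (gam n.+2).
  by rewrite mem_filter mem_iota hl h3 //=; have := hdec n.+1 (leqnn _); lia.
by rewrite hl /= -slots_ofS -h2; case: (g).
Qed.

Section Block.
Variables (D : nat) (l : seq nat) (a b : bool).

Definition ptm (s : bool) (d : times) := if s then t_pc d else t_ps d.

Definition fits (T : nat) (d : times) (s : bool) (ct : nat) : Prop :=
  (if a == s then 0 else t_in d) + ptm s d <= ct /\ ct + (if b == s then 0 else t_out d) <= T.

Definition cloud_cost (sd : nat -> bool) (s : seq item) := \sum_(x <- s | sd x.1) x.2.2.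

Lemma cloud_cost_rcons sd s x :
  cloud_cost sd (rcons s x) = cloud_cost sd s + (if sd x.1 then x.2.2 else 0).
Proof. by rewrite /cloud_cost -cats1 big_cat big_cons big_nil /=; case: (sd _); rewrite ?addn0. Qed.

Lemma eq_cloud_cost sd sd' s : (forall x : item, x \in s -> sd x.1 = sd' x.1) ->
  cloud_cost sd s = cloud_cost sd' s.
Proof.
move=> h; rewrite /cloud_cost big_seq_cond [RHS]big_seq_cond; apply: eq_bigl => z.
by case hz: (z \in s) => //=; apply: h.
Qed.

Definition disjoint_on (sd : nat -> bool) (ct : nat -> nat) (s : seq item) : Prop :=
  forall x y : item, x \in s -> y \in s -> x.1 != y.1 -> ~~ sd x.1 -> ~~ sd y.1 ->
    ct x.1 + t_ps y.2.1 <= ct y.1 \/ ct y.1 + t_ps x.2.1 <= ct x.1.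

Lemma ids_mem F gam n e : e \in slots_of F gam n -> e.1 <= n /\ e = (e.1, (F e.1, gam e.1)).
Proof. by move=> /mapP[m]; rewrite mem_rev mem_iota => hm -> /=; split=> //; lia. Qed.

Lemma advance_slots F gam n m f :
  advance (slots_of F gam n) m f = slots_of (fun i => if i == m then f else F i) gam n.
Proof.
rewrite /advance /slots_of -map_comp; apply: eq_map => i /=.
by case: eqP.
Qed.

(** [F] gives the current fronts. Each server job is confined to one slot, before its front; this
    makes a job appended later to any slot disjoint from it. *)
Definition block_run (T : nat) (gam : nat -> nat) (es : seq item) (k : seq slot) (c : nat)
    (ss : seq placed) : Prop :=
  exists sd ct F, [/\ k = slots_of F gam D, forall m, gam m.+1 <= F m,
    ss = rev [seq (x.1, (sd x.1, ct x.1)) | x <- es],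
    c = cloud_cost sd es &
    [/\ forall x : item, x \in es -> fits T x.2.1 (sd x.1) (ct x.1),
      forall x : item, x \in es -> ~~ sd x.1 -> exists m, [/\ m <= D, gam m.+1 + t_ps x.2.1 <= ct x.1,
         ct x.1 <= F m & ct x.1 <= gam m] &
      disjoint_on sd ct es]].

Lemma block_inv (T : nat) (gam : nat -> nat) :
  (forall m, m <= D -> gam m.+1 <= gam m) ->
  forall es y, y \in dp (block_opt D l a b T) [:: (slots_of (fun m => gam m.+1) gam D, (0, [::]))] es ->
  uniq (map fst es) -> block_run T gam es y.1 y.2.1 y.2.2.
Proof.
move=> hgam.
have hdec m m' : m < m' -> m' <= D -> gam m' <= gam m.+1.
  elim: m' => // m' IH h1 h2; case: (eqVneq m m') => [->|ne] //.
  by apply: leq_trans (hgam _ _) (IH _ _); lia.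
apply: (@dp_sound _ _ _ _ _ (fun es k c ss => uniq (map fst es) -> block_run T gam es k c ss)).
  move=> _; exists (fun=> false), (fun=> 0), (fun m => gam m.+1); split=> //.
  by rewrite /cloud_cost big_nil.
move=> es x k c ss o IH ho; rewrite map_rcons rcons_uniq => /andP[hx ux].
have [sd [ct [F [h1 h2 h3 h4 [h5 h6 h7]]]]] := IH ux.
have ne z : z \in es -> (z.1 == x.1) = false.
  by move=> hz; apply/negP => /eqP e; move: hx; rewrite -e map_f.
move: ho; rewrite /block_opt mem_cat => /orP[|/mapP[e]].
  case: ifP => // hT; rewrite inE => /eqP -> /=.
  pose off := (if a then 0 else t_in x.2.1) + t_pc x.2.1.
  exists (fun i => if i == x.1 then true else sd i), (fun i => if i == x.1 then off else ct i), F.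
  split=> //.
  - rewrite map_rcons rev_rcons /= eqxx h3; congr (_ :: rev _).
    by apply/eq_in_map => z hz; rewrite ne.
  - rewrite h4 cloud_cost_rcons eqxx; congr addn.
    by apply: eq_cloud_cost => z hz; rewrite ne.
  - split.
    + move=> z; rewrite mem_rcons inE => /orP[/eqP ->|hz]; last by rewrite ne //; apply: h5.
      by rewrite eqxx /fits /off /ptm; move: hT; case: (a); case: (b) => /=; lia.
    + move=> z; rewrite mem_rcons inE => /orP[/eqP ->|hz]; last by rewrite ne //; apply: h6.
      by rewrite eqxx.
    + move=> u v; rewrite !mem_rcons !inE => /orP[/eqP ->|hu] /orP[/eqP ->|hv]; rewrite ?eqxx //.
      by rewrite !ne //; apply: h7.
rewrite mem_filter => /andP[/and5P[_ q1 q2 q3 _] he] -> /=.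
rewrite h1 in he; have [em ee] := ids_mem he.
set m := e.1 in em ee; have e1 : e.2.1 = F m by rewrite ee.
have e2 : e.2.2 = gam m by rewrite ee.
rewrite {}e1 {}e2 in q1 q2 q3 *.
pose off := F m + t_ps x.2.1; rewrite -/off in q2 q3 *.
exists (fun i => if i == x.1 then false else sd i), (fun i => if i == x.1 then off else ct i),
  (fun i => if i == m then off else F i).
split.
- by rewrite h1 advance_slots.
- by move=> i; case: eqP => [->|_]; rewrite ?h2 // /off; apply: leq_trans (h2 m) (leq_addr _ _).
- rewrite map_rcons rev_rcons /= eqxx h3; congr (_ :: rev _).
  by apply/eq_in_map => z hz; rewrite ne.
- by rewrite h4 cloud_cost_rcons eqxx; congr addn; apply: eq_cloud_cost => z hz; rewrite ne.
(* Lower slot numbers are later in time; within slot [m] the new job starts at the old front. *)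
have key z : z \in es -> ~~ sd z.1 -> ct z.1 + t_ps x.2.1 <= off \/ off + t_ps z.2.1 <= ct z.1.
  move=> hz sz; have [i [i1 i2 i3 i4]] := h6 _ hz sz.
  case: (ltngtP i m) => him.
  - by right; apply: leq_trans i2; rewrite leq_add2r; apply: leq_trans q2 (hdec _ _ him em).
  - by left; rewrite leq_add2r; apply: leq_trans i4 (leq_trans (hdec _ _ him i1) (h2 m)).
  - by left; rewrite /off -him leq_add2r.
split.
- move=> z; rewrite mem_rcons inE => /orP[/eqP ->|hz]; last by rewrite ne //; apply: h5.
  by rewrite eqxx /fits /off /ptm; move: q1 q3; rewrite /off; case: (a); case: (b) => /=; lia.
- move=> z; rewrite mem_rcons inE => /orP[/eqP ->|hz].
    by rewrite eqxx => _; exists m; rewrite eqxx; split=> //; rewrite /off leq_add2r.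
  rewrite ne // => sz; have [i [i1 i2 i3 i4]] := h6 _ hz sz; exists i; split=> //.
  by case: eqP => // e'; apply: leq_trans i3 _; rewrite e' /off leq_addr.
- move=> u v; rewrite !mem_rcons !inE => /orP[/eqP ->|hu] /orP[/eqP ->|hv]; rewrite ?eqxx //.
  + by rewrite ne // => _ _ sv; case: (key _ hv sv); [right | left].
  + by rewrite ne // => _ su _; case: (key _ hu su); [left | right].
  + by rewrite !ne //; apply: h7.
Qed.

Lemma block_sound (s : seq item) y : uniq (map fst s) -> y \in block_sols D l a b s ->
  exists sd ct, [/\ y.1 < size l,
    forall x : item, x \in s -> [seq e <- y.2.2 | e.1 == x.1] = [:: (x.1, (sd x.1, ct x.1))],
    y.2.1 = cloud_cost sd s,
    forall x : item, x \in s -> fits y.1 x.2.1 (sd x.1) (ct x.1) &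
    disjoint_on sd ct s].
Proof.
move=> us /flattenP[t /mapP[g /guessesP[gam [g1 g2 g3 g4]] ->] /mapP[z hz ->]] /=.
have ps := perm_sort_out s.
have us' : uniq (map fst (sort_out s)) by rewrite (perm_uniq (perm_map _ ps)).
rewrite g2 in hz.
have [sd [ct [F [h1 h2 h3 h4 [h5 h6 h7]]]]] := block_inv g3 hz us'.
exists sd, ct; split.
- by rewrite -g1.
- move=> x hx; rewrite h3 filter_rev filter_map /=.
  have -> : [seq w <- sort_out s | preim (fun w => (w.1, (sd w.1, ct w.1))) (fun e => e.1 == x.1) w] = [:: x].
    rewrite (eq_filter (a2 := fun w => w.1 == x.1)) //.
    have hx' : x \in sort_out s by rewrite (perm_mem ps).
    elim: (sort_out s) hx' us' => //= w r IH; rewrite inE => /orP[/eqP <-|hx'] /andP[hw ur].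
      rewrite eqxx; congr cons; apply/eqP; rewrite -size_eq0 size_filter -leqn0 leqNgt -has_count.
      by apply/hasP => -[v hv /eqP e]; move: hw; rewrite -e map_f.
    case: eqP => [e|_]; last exact: IH.
    by move: hw; rewrite e map_f.
  by [].
- by rewrite h4 /cloud_cost; apply: perm_big.
- by move=> x hx; apply: h5; rewrite (perm_mem ps).
- by move=> u v hu hv; apply: h7; rewrite (perm_mem ps).
Qed.
End Block.

Lemma exists_max (A : eqType) (f : A -> nat) (s : seq A) : s != [::] ->
  exists2 x, x \in s & forall y, y \in s -> f y <= f x.
Proof.
elim: s => // x s IH _; case: (eqVneq s [::]) => [->|/IH[y ys hy]].
  by exists x; rewrite ?inE // => y; rewrite inE => /eqP->.
case: (leqP (f x) (f y)) => h; [exists y | exists x]; rewrite ?inE ?eqxx ?ys ?orbT //.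
  by move=> z; rewrite inE => /orP[/eqP->|/hy].
by move=> z; rewrite inE => /orP[/eqP->//|/hy]; lia.
Qed.

(* Disjoint intervals are counted by the unit cells they cover. *)
Lemma packing (A : eqType) (p z : A -> nat) lo (s : seq A) : s != [::] -> uniq s ->
  (forall x, x \in s -> lo + p x <= z x) ->
  (forall x y, x \in s -> y \in s -> x != y -> z x + p y <= z y \/ z y + p x <= z x) ->
  exists2 x, x \in s & lo + \sum_(y <- s) p y <= z x.
Proof.
move=> s0 us hlo hd; have [x xs hx] := exists_max z s0; exists x => //.
pose cells := flatten [seq iota (z y - p y) (p y) | y <- s].
have hsz : size cells = \sum_(y <- s) p y.
  rewrite size_flatten /shape -map_comp sumnE big_map.
  by apply: eq_bigr => y _; rewrite /= size_iota.
have ucells : uniq cells.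
  rewrite /cells; elim: (s) us hlo hd => //= y r IH /andP[yr ur] h1 h2.
  rewrite cat_uniq iota_uniq IH //=.
  - rewrite andbT; apply/hasP => -[c /flattenP[t /mapP[w wr ->]]].
    rewrite mem_iota => hc1; rewrite /= mem_iota => hc2.
    have yw : y != w by apply: contraNneq yr => ->.
    have := h1 y; rewrite inE eqxx => /(_ isT) hy; have := h1 w; rewrite inE wr orbT => /(_ isT) hw.
    by have := h2 y w; rewrite !inE eqxx wr orbT => /(_ isT isT yw); lia.
  - by move=> w wr; apply: h1; rewrite inE wr orbT.
  - by move=> u v hu hv; apply: h2; rewrite inE ?hu ?hv orbT.
have hsub : {subset cells <= iota lo (z x - lo)}.
  move=> c /flattenP[t /mapP[y ys ->]]; rewrite !mem_iota => hc.
  by have := hlo _ ys; have := hx _ ys; lia.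
have := uniq_leq_size ucells hsub; rewrite hsz size_iota.
by have := hlo _ xs; lia.
Qed.

Lemma uniq_fst_inj (A B : eqType) (s : seq (A * B)) x y : uniq (map fst s) ->
  x \in s -> y \in s -> x.1 = y.1 -> x = y.
Proof.
elim: s => //= w s IH /andP[hw us]; rewrite !inE => /orP[/eqP->|hx] /orP[/eqP->|hy] // e.
- by move: hw; rewrite e map_f.
- by move: hw; rewrite -e map_f.
- exact: IH.
Qed.

(** * Completeness of the program for one parallel subgraph *)

Section BlockComplete.
Variables (D : nat) (l : seq nat) (a b : bool).

Lemma eq_slots_of F F' gam n : (forall m, m <= n -> F m = F' m) -> slots_of F gam n = slots_of F' gam n.
Proof.
by move=> h; apply/eq_in_map => m; rewrite mem_rev mem_iota => hm; rewrite h //; lia.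
Qed.

(** An exchange argument. The given solution assigns server jobs to slots by [phi]; the program runs
    the jobs of each slot without gaps in the order of [sort_out]. When [e] is placed, [packing]
    provides a job [x] of the same slot, either [e] itself or one placed before, that finishes in
    the given solution no earlier than the new front. Its deadline is no later than that of [e], so
    [e] meets its deadline and the end of the slot. *)
Lemma block_complete (s : seq item) T (gam phi : nat -> nat) (sd : nat -> bool) (z : nat -> nat) : uniq (map fst s) -> T < size l ->
  gam 0 = T -> (forall m, m <= D -> gam m.+1 <= gam m) ->
  (forall x : item, x \in s -> fits a b T x.2.1 (sd x.1) (z x.1)) ->
  disjoint_on sd z s ->
  (forall x : item, x \in s -> ~~ sd x.1 -> [/\ phi x.1 <= D, gam (phi x.1).+1 + t_ps x.2.1 <= z x.1,
     z x.1 <= gam (phi x.1) & (if a then t_in x.2.1 else 0) <= gam (phi x.1).+1]) ->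
  exists2 y, y \in block_sols D l a b s & y.1 = T /\ y.2.1 <= cloud_cost sd s.
Proof.
move=> us hT g0 hgam hfit hdisj hphi.
have hg : forall m, m <= D.+1 -> gam m <= T.
  by elim=> [|m IH] hm; [rewrite g0 | apply: leq_trans (hgam _ _) (IH _); lia].
have ps := perm_sort_out s.
pose load (es : seq item) (m : nat) := \sum_(x <- es | ~~ sd x.1 && (phi x.1 == m)) t_ps x.2.1.
pose F (es : seq item) (m : nat) := gam m.+1 + load es m.
have [|es1 e es2 hes|y hy /andP[/eqP y1 y2]] := @dp_complete _ _ _ (block_opt D l a b T)
  (slots_of (fun m => gam m.+1) gam D) (fun es => slots_of (F es) gam D) (cloud_cost sd) (sort_out s).
- by apply: eq_slots_of => m _; rewrite /F /load big_nil addn0.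
- have he : e \in s by rewrite -(perm_mem ps) hes mem_cat inE eqxx orbT.
  have sub1 x : x \in rcons es1 e -> x \in s.
    by move=> hx; rewrite -(perm_mem ps) hes -cat_rcons mem_cat hx.
  have load_rcons m : load (rcons es1 e) m = load es1 m + (if ~~ sd e.1 && (phi e.1 == m) then t_ps e.2.1 else 0).
    by rewrite /load -cats1 big_cat big_cons big_nil /=; case: ifP; rewrite ?addn0.
  rewrite cloud_cost_rcons; have hf := hfit _ he.
  case hsd: (sd e.1) in hf *.
    exists (slots_of (F es1) gam D, (e.2.2, (e.1, (true, (if a then 0 else t_in e.2.1) + t_pc e.2.1)))).
      have hc : (if a then 0 else t_in e.2.1) + t_pc e.2.1 + (if b then 0 else t_out e.2.1) <= T.
        by move: hf; rewrite /fits /ptm; case: (a); case: (b) => /=; lia.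
      by rewrite /block_opt mem_cat hc inE eqxx.
    rewrite leqnn andbT /=; apply/eqP; apply: eq_slots_of => m _.
    by rewrite /F load_rcons hsd addn0.
  have [p1 p2 p3 p4] := hphi _ he (negbT hsd).
  set m := phi e.1 in p1 p2 p3 p4.
  pose I := [seq x <- rcons es1 e | ~~ sd x.1 && (phi x.1 == m)].
  have hI x : x \in I -> [/\ x \in s, ~~ sd x.1 & phi x.1 = m].
    by rewrite mem_filter => /andP[/andP[h1 /eqP h2] /sub1].
  have eI : e \in I by rewrite mem_filter hsd eqxx mem_rcons inE eqxx.
  have uI : uniq I.
    apply: filter_uniq; have : uniq (rcons es1 e ++ es2).
      by rewrite cat_rcons -hes (perm_uniq ps); apply: map_uniq us.
    by rewrite cat_uniq => /andP[].
  (* The jobs in [I] fill the slot exactly up to the new front. *)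
  have [|||x xI hx] := @packing _ (fun x => t_ps x.2.1) (fun x => z x.1) (gam m.+1) I _ uI.
  - by apply/eqP => e0; rewrite e0 in eI.
  - move=> x /hI[xs sx <-]; by have [_ ? _ _] := hphi _ xs sx.
  - move=> x y /hI[xs sx _] /hI[ys sy _] xy; apply: hdisj => //.
    by apply: contraNneq xy => exy; apply/eqP; apply: uniq_fst_inj us xs ys exy.
  have hsum : \sum_(y <- I) t_ps y.2.1 = load es1 m + t_ps e.2.1.
    by rewrite big_filter -/(load _ _) load_rcons hsd eqxx.
  have [xs sx hm] := hI _ xI.
  have [_ _ hz _] := hphi _ xs sx; rewrite hm in hz.
  have hmT : gam m <= T by apply: hg; lia.
  have hfm : F es1 m + t_ps e.2.1 <= z x.1 by rewrite /F -addnA -hsum.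
  have hq : t_out e.2.1 <= t_out x.2.1.
    move: xI; rewrite mem_filter mem_rcons inE => /andP[_ /orP[/eqP ->//|hx1]].
    have := sort_out_sorted s; rewrite hes pairwise_cat => /andP[/allrelP h _].
    by apply: h; rewrite ?inE ?eqxx.
  have [_ hxT] := hfit _ xs; rewrite (negbTE sx) in hxT.
  exists (slots_of (fun i => if i == m then F es1 m + t_ps e.2.1 else F es1 i) gam D,
    (0, (e.1, (false, F es1 m + t_ps e.2.1)))).
    rewrite /block_opt mem_cat; apply/orP; right; apply/mapP; exists (m, (F es1 m, gam m)).
      rewrite mem_filter /=; apply/andP; split; last first.
        by apply/mapP; exists m; rewrite // mem_rev mem_iota; lia.
      apply/and5P; split.
      - by rewrite size_map size_rev size_iota.
      - by rewrite /F; apply: leq_trans p4 (leq_addr _ _).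
      - by apply: leq_trans hfm hz.
      - by move: hxT; case: (b) => /= hxT; apply: leq_trans hxT; rewrite leq_add.
      - exact: leq_ltn_trans hfm (leq_ltn_trans hz (leq_ltn_trans hmT hT)).
    by rewrite /= advance_slots.
  rewrite addn0 leqnn andbT /=; apply/eqP; apply: eq_slots_of => i _.
  by rewrite /F load_rcons hsd /= eq_sym; case: eqP => [->|_]; rewrite ?addn0 ?addnA.
exists (T, y.2); last by split=> //; apply: leq_trans y2 _; rewrite leq_eqVlt /cloud_cost (perm_big _ ps) eqxx.
apply/flattenP; exists [seq (T, w.2) | w <- dp (block_opt D l a b T)
     [:: (slots_of (fun m => gam m.+1) gam D, (0, [::]))] (sort_out s)].
  apply/mapP; exists (T, slots_of (fun m => gam m.+1) gam D) => //.
  by apply/guessesP; exists gam; rewrite g0.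
by apply/mapP; exists y.
Qed.
End BlockComplete.

(** * Cutting the span under each of the three conditions *)

Section Phases.
Variables (D : nat) (a b : bool) (s : seq item) (T : nat) (sd : nat -> bool) (z : nat -> nat).
Hypothesis us : uniq (map fst s).
Hypothesis hfit : forall x : item, x \in s -> fits a b T x.2.1 (sd x.1) (z x.1).
Hypothesis hdisj : disjoint_on sd z s.

Definition release (x : item) := if a then t_in x.2.1 else 0.

(** The data that [block_complete] asks for. *)
Definition phased := exists gam phi : nat -> nat, [/\ gam 0 = T, forall m, m <= D -> gam m.+1 <= gam m &
  forall x : item, x \in s -> ~~ sd x.1 -> [/\ phi x.1 <= D, gam (phi x.1).+1 + t_ps x.2.1 <= z x.1,
     z x.1 <= gam (phi x.1) & (if a then t_in x.2.1 else 0) <= gam (phi x.1).+1]].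

Lemma server_fit (x : item) : x \in s -> ~~ sd x.1 -> release x + t_ps x.2.1 <= z x.1 <= T.
Proof.
move=> xs sx; have [] := hfit xs; rewrite (negbTE sx) /ptm /release.
by case: (a); case: (b) => /=; lia.
Qed.

Lemma phased_const r0 : (forall x : item, x \in s -> ~~ sd x.1 -> release x = r0) -> phased.
Proof.
(* One slot from the common release to the end, the others empty. The minimum matters when there is
   no server job, as [r0] may then exceed [T]. *)
move=> h; exists (fun m => if m == 0 then T else minn r0 T), (fun=> 0); split=> //.
  by case=> [|m] _ /=; lia.
move=> x xs sx; have := server_fit xs sx; have := h _ xs sx; rewrite /release /= => ->.
by split=> //; lia.
Qed.

Definition start (x : item) := z x.1 - t_ps x.2.1.

(** The job [f] that finishes first gets a slot of its own. Every other server job starts after [f]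
    has ended, and by then the length of [f] has passed, which is at least any release. *)
Lemma phased_first : 0 < D ->
  (forall x y : item, x \in s -> y \in s -> release y <= t_ps x.2.1) -> phased.
Proof.
move=> D0 hc; pose sv := [seq x <- s | ~~ sd x.1].
have hsv (x : item) : x \in s -> ~~ sd x.1 -> x \in sv by move=> xs sx; rewrite mem_filter sx.
(* A job of length 0 forces all releases to be 0. It is treated apart because only a positive length
   guarantees that the job finishing first precedes the others. *)
case: (hasP (a := fun x : item => t_ps x.2.1 == 0) (s := s)) => [[w ws /eqP w0]|hn].
  by apply: (@phased_const 0) => x xs _; apply/eqP; rewrite -leqn0 -w0; apply: hc.
have hp (x : item) : x \in s -> 0 < t_ps x.2.1.
  by move=> xs; rewrite lt0n; apply/negP => h; apply: hn; exists x.
case: (eqVneq sv [::]) => [e|ne].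
  by apply: (@phased_const 0) => x xs sx; have := hsv _ xs sx; rewrite e.
(* Completions are at most [T], so maximizing [T - z] picks the earliest one. *)
have [f fsv hf] : exists2 f : item, f \in sv & forall y : item, y \in sv -> T - z y.1 <= T - z f.1.
  exact: (@exists_max _ (fun x : item => T - z x.1) sv ne).
move: fsv; rewrite mem_filter => /andP[sf fs].
have hff := server_fit fs sf.
exists (fun m => if m == 0 then T else if m == 1 then z f.1 else start f),
  (fun i => if i == f.1 then 1 else 0); split=> //.
  case=> [|[|m]] _ /=; rewrite ?leqnn /start ?leq_subr //; by case/andP: hff.
move=> x xs sx; have hfx := server_fit xs sx.
case: eqP => [e|/eqP ne'].
  have {e} e : x = f by apply: uniq_fst_inj us xs fs e.
  subst x.
  by rewrite /= /start; split=> //; move: hff; rewrite /release; lia.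
have hmin := hf _ (hsv _ xs sx).
have hr := hc _ _ fs xs; have hpf := hp _ fs.
have := hdisj xs fs ne' sx sf; rewrite /= /release in hr hfx hff *.
by move=> hd; split=> //; lia.
Qed.

(** A job starting at [i < D] goes to the slot from [B i] to [B i.+1], any later one to the last
    slot. The slot of [x] begins no earlier than [ph x], which bounds the release, and no later than
    [start x], since jobs started earlier have ended by then. *)
Lemma phased_small : (forall x : item, x \in s -> release x <= D) -> phased.
Proof.
move=> hr.
pose B i := minn T (maxn i (\max_(w <- s | ~~ sd w.1 && (start w < i)) z w.1)).
have Bmono i j : i <= j -> B i <= B j.
  move=> ij; rewrite /B; have : \max_(w <- s | ~~ sd w.1 && (start w < i)) z w.1 <=
     \max_(w <- s | ~~ sd w.1 && (start w < j)) z w.1.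
    apply/bigmax_leqP_seq => w ws /andP[sw hw]; apply: leq_bigmax_seq => //.
    by rewrite sw (leq_trans hw).
  by lia.
pose ph (x : item) := minn (start x) D.
(* Slots are numbered from the last in time, so the index is reversed; [phi] receives an identifier,
   from which the job is recovered by filtering. *)
pose phi i := D - minn (head 0 [seq start x | x <- s & x.1 == i]) D.
have phiE (x : item) : x \in s -> phi x.1 = D - ph x.
  move=> xs; rewrite /phi /ph; congr (_ - minn _ _).
  have : x \in [seq y <- s | y.1 == x.1] by rewrite mem_filter eqxx.
  case e : [seq y <- s | y.1 == x.1] => [|y r] // _ /=.
  have : y \in [seq y <- s | y.1 == x.1] by rewrite e inE eqxx.
  rewrite mem_filter => /andP[/eqP exy ys].
  by rewrite (uniq_fst_inj us ys xs exy).
pose gam m := if m == 0 then T else B (D.+1 - m).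
exists gam, phi; split=> // [[|m] hm|x xs sx].
- by rewrite /gam /= /B geq_minl.
- by rewrite /gam /=; apply: Bmono; lia.
have hfx := server_fit xs sx.
have hstart (w : item) : w \in s -> ~~ sd w.1 -> start w + t_ps w.2.1 = z w.1.
  by move=> ws sw; have := server_fit ws sw; rewrite /start; lia.
have hx := hstart _ xs sx.
have gE : gam (phi x.1).+1 = B (ph x).
  by rewrite /gam /= phiE //; congr B; rewrite /ph; lia.
have hBs i : i <= start x -> B i <= start x.
  move=> hi; apply: leq_trans (geq_minr _ _) _; rewrite geq_max hi /=.
  apply/bigmax_leqP_seq => w ws /andP[sw hw]; have hw' := hstart _ ws sw.
  have nwx : w.1 != x.1.
    by apply/eqP => e; move: hw; rewrite (uniq_fst_inj us ws xs e); lia.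
  by have := hdisj ws xs nwx sw sx; lia.
rewrite gE phiE //; split; first by lia.
- by have := hBs (ph x) (geq_minl _ _); lia.
- rewrite /gam /ph; case: (leqP D (start x)) => h.
    by rewrite subnn /=; case/andP: hfx.
  rewrite ifF; last by lia.
  rewrite (_ : D.+1 - (D - start x) = (start x).+1); last by lia.
  rewrite leq_min; apply/andP; split; first by lia.
  apply: leq_trans (leq_maxr _ _); apply: (@leq_bigmax_seq _ s _ (fun w : item => z w.1) x) => //.
  by rewrite sx leqnn.
- have hrx := hr _ xs; rewrite /release in hrx hfx *.
  apply: leq_trans (_ : minn T (ph x) <= _); first by rewrite /ph; lia.
  by rewrite /B; lia.
Qed.
End Phases.

(** * The chain *)

Definition st0 : stage := (0, ([::], (false, (0, (0, 0))))).

Definition stage_time (st : stage) (c : bool) : nat := if c then st.2.2.2.2.1 else st.2.2.2.1.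
Definition stage_cost (st : stage) (c : bool) : nat := if c then st.2.2.2.2.2 else 0.

Section Chain.
Variables (D : nat) (l : seq nat).

Definition stage_link (st : stage) (a : bool) (t : nat) (g : nat * (nat * seq placed))
    (b : bool) (t' : nat) : Prop :=
  [/\ g \in block_sols D l a b st.2.1, (if a == b then 0 else st.1) <= g.1,
      t' = t + g.1 + stage_time st b, t' < size l & b -> st.2.2.1].

Lemma stage_linkP (st : stage) (a : bool) (t : nat) (g : nat * (nat * seq placed)) (b : bool) t' :
  stage_link st a t g b t' ->
  ((b, t'), (g.2.1 + stage_cost st b, ((b, t'), (t, g.2.2)))) \in stage_opt D l st (a, t).
Proof.
move=> [h1 h2 h3 h4 h5]; apply/flattenP; eexists.
  apply/mapP; exists b; last by [].
  by case: b h5 {h1 h2 h3} => [->|_] //; case: (st.2.2.1).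
by apply/mapP; exists g; rewrite ?mem_filter ?h1 ?h2 /= -/(stage_time st b) -?h3 ?h4.
Qed.

Lemma stage_optP (st : stage) (k : bool * nat) o : o \in stage_opt D l st k ->
  exists g b t', stage_link st k.1 k.2 g b t' /\
    o = ((b, t'), (g.2.1 + stage_cost st b, ((b, t'), (k.2, g.2.2)))).
Proof.
move=> /flattenP[t /mapP[b hb ->] /mapP[g]]; rewrite mem_filter => /andP[/andP[h1 h2] h3] ->.
exists g, b, (k.2 + g.1 + stage_time st b); split=> //; split=> //.
by move: hb; case: (st.2.2.1) => //; rewrite inE => /eqP ->.
Qed.

Definition chain_cost (sts : seq stage) (sd : nat -> bool) (gs : nat -> nat * (nat * seq placed)) n :=
  \sum_(0 <= j < n) ((gs j).2.1 + stage_cost (nth st0 sts j) (sd j.+1)).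

Definition chain_run (sts : seq stage) (k : bool * nat) (c : nat) (ss : seq stage_sol) : Prop :=
  exists (sd : nat -> bool) (tm : nat -> nat) (gs : nat -> nat * (nat * seq placed)),
  [/\ sd 0 = false, tm 0 = 0, k = (sd (size sts), tm (size sts)),
      ss = rev [seq ((sd j.+1, tm j.+1), (tm j, (gs j).2.2)) | j <- iota 0 (size sts)] &
      c = chain_cost sts sd gs (size sts) /\
      forall j, j < size sts -> stage_link (nth st0 sts j) (sd j) (tm j) (gs j) (sd j.+1) (tm j.+1)].

Lemma chain_sound sts y : y \in chain_sols D l sts -> chain_run sts y.1 y.2.1 y.2.2.
Proof.
apply: (@dp_sound _ _ _ _ _ chain_run).
  exists (fun=> false), (fun=> 0), (fun=> (0, (0, [::]))); split=> //; split=> //.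
  by rewrite /chain_cost big_geq.
move=> es st k c ss o [sd [tm [gs [h1 h2 h3 h4 [h5 h6]]]]] /stage_optP[g [b [t' [hl ->]]]].
set n := size es in h3 h4 h5 h6.
exists (fun i => if i == n.+1 then b else sd i), (fun i => if i == n.+1 then t' else tm i),
  (fun i => if i == n then g else gs i).
have ne i : i < n -> [/\ (i == n) = false, (i == n.+1) = false & (i.+1 == n.+1) = false] by move=> ?; split; lia.
have nn : (n == n.+1) = false by lia.
rewrite size_rcons -/n; split=> //.
- by rewrite eqxx.
- rewrite iota0_rcons map_rcons rev_rcons !eqxx nn h4 h3 /=; congr (_ :: rev _).
  by apply/eq_in_map => j; rewrite mem_iota => hj; have [|-> -> ->] := ne j; first by lia.
split.
- rewrite /chain_cost big_nat_recr //= !eqxx nth_rcons ltnn eqxx h5; congr addn.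
  rewrite /chain_cost; apply: eq_big_nat => j hj; have [|-> _ ->] := ne j; first by lia.
  by rewrite nth_rcons ifT //; lia.
- move=> j; rewrite ltnS leq_eqVlt => /orP[/eqP ->|hj].
    by rewrite !eqxx nn nth_rcons ltnn eqxx; rewrite h3 in hl.
  have [|-> -> ->] := ne j; first by lia.
  by rewrite nth_rcons hj; apply: h6.
Qed.

Lemma chain_complete sts (sd : nat -> bool) (tm : nat -> nat) gs (gam : nat -> nat) :
  sd 0 = false -> tm 0 = 0 ->
  (forall j, j < size sts -> stage_link (nth st0 sts j) (sd j) (tm j) (gs j) (sd j.+1) (tm j.+1) /\
     (gs j).2.1 <= gam j) ->
  exists2 y, y \in chain_sols D l sts & y.1 = (sd (size sts), tm (size sts)) /\
    y.2.1 <= \sum_(0 <= j < size sts) (gam j + stage_cost (nth st0 sts j) (sd j.+1)).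
Proof.
move=> s0 t0 h.
have [||y hy /andP[/eqP h1 h2]] := @dp_complete _ _ _ (stage_opt D l) (false, 0)
  (fun es => (sd (size es), tm (size es)))
  (fun es => \sum_(0 <= j < size es) (gam j + stage_cost (nth st0 sts j) (sd j.+1))) sts.
- by rewrite s0 t0.
- move=> es1 st es2 hes; have [|hl hg] := h (size es1).
    by rewrite hes size_cat /=; lia.
  have hst : nth st0 sts (size es1) = st by rewrite hes nth_cat ltnn subnn.
  rewrite hst in hl; eexists; first exact: stage_linkP hl.
  rewrite /= size_rcons eqxx big_nat_recr //= hst; lia.
by exists y.
Qed.
End Chain.

(** * Jobs, edges and costs of an instance *)

Definition jl (I : ec_instance) j : seq pjob := if edge_of I j is Replaced l then l else [::].
Definition kc (I : ec_instance) j : nat := if edge_of I j is Kept c then c else 0.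
Definition pj0 := PJob 0 0 0 0.

Lemma pjob_ofE I j i : pjob_of I j i = nth pj0 (jl I j) i.
Proof. by rewrite /pjob_of /jl; case: (edge_of I j) => // c; rewrite nth_nil. Qed.

Lemma sub_jobsE I j : sub_jobs I j = [seq PJ j i | i <- iota 0 (size (jl I j))].
Proof. by rewrite /sub_jobs /jl; case: (edge_of I j). Qed.

Lemma mem_jobs I x : (x \in jobs I) = match x with
  | CJ k => k <= (ec_n I).+1 | PJ j i => (1 <= j <= (ec_n I).+1) && (i < size (jl I j)) end.
Proof.
rewrite /jobs mem_cat; apply/orP/idP.
  case=> [/mapP[k]|/flattenP[t /mapP[j]]]; first by rewrite mem_iota => hk ->; lia.
  rewrite mem_iota => hj -> ; rewrite sub_jobsE => /mapP[i]; rewrite mem_iota => hi ->.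
  by apply/andP; split; lia.
case: x => [k|j i] h; first by left; apply/mapP; exists k; rewrite // mem_iota; lia.
case/andP: h => hj hi; right; apply/flattenP; exists (sub_jobs I j).
  by apply/mapP; exists j; rewrite // mem_iota; lia.
by rewrite sub_jobsE; apply/mapP; exists i; rewrite // mem_iota.
Qed.

Lemma edgesP I x y c : (x, y, c) \in edges I ->
  exists2 j, j <= ec_n I &
    [\/ edge_of I j.+1 = Kept c /\ (x = CJ j /\ y = CJ j.+1),
        exists2 i, i < size (jl I j.+1) & [/\ x = CJ j, y = PJ j.+1 i & c = pj_cin (nth pj0 (jl I j.+1) i)]
      | exists2 i, i < size (jl I j.+1) & [/\ x = PJ j.+1 i, y = CJ j.+1 & c = pj_cout (nth pj0 (jl I j.+1) i)]].
Proof.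
move=> /flattenP[t /mapP[[|j]]]; rewrite mem_iota => // hj -> he; exists j; first by lia.
move: he; rewrite /sub_edges /jl; case: (edge_of I j.+1) => [c'|ls].
  by rewrite inE => /eqP[-> -> ->]; apply: Or31.
move=> /flattenP[t' /mapP[i]]; rewrite mem_iota => hi ->; rewrite !inE => /orP[] /eqP[-> -> ->].
  by apply: Or32; exists i => //; lia.
by apply: Or33; exists i => //; lia.
Qed.

Lemma mem_edge I j : j <= ec_n I -> {subset sub_edges I j.+1 <= edges I}.
Proof.
move=> hj e he; apply/flattenP; exists (sub_edges I j.+1) => //.
by apply/mapP; exists j.+1; rewrite // mem_iota; lia.
Qed.

Lemma edge_kept I j c : j <= ec_n I -> edge_of I j.+1 = Kept c -> (CJ j, CJ j.+1, c) \in edges I.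
Proof. by move=> hj he; apply: (mem_edge hj); rewrite /sub_edges he inE. Qed.

Lemma edge_par I j i : j <= ec_n I -> i < size (jl I j.+1) ->
  (CJ j, PJ j.+1 i, pj_cin (nth pj0 (jl I j.+1) i)) \in edges I /\
  (PJ j.+1 i, CJ j.+1, pj_cout (nth pj0 (jl I j.+1) i)) \in edges I.
Proof.
move=> hj; rewrite /jl; case he: (edge_of I j.+1) => [|ls] //= hi.
by split; apply: (mem_edge hj); rewrite /sub_edges he; apply/flattenP;
  eexists; (try by apply/mapP; exists i; rewrite // mem_iota); rewrite !inE eqxx ?orbT.
Qed.

Section Stages.
Variables (I : ec_instance) (ms : seq nat).
Hypothesis wf : size (ed I) = (ec_n I).+1.
Local Notation g := (roundup ms).
Local Notation N := (ec_n I).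

Definition item_of j i : item :=
  let d := times_of (nth pj0 (jl I j) i) in (i, (round_times ms d, t_pc d)).
Definition items j : seq item := [seq item_of j i | i <- iota 0 (size (jl I j))].
Definition stages : seq stage := [seq round_stage ms r | r <- raw_stages I].

Lemma size_raw_stages : size (raw_stages I) = N.+1.
Proof. by rewrite /raw_stages size_zip size_map size_cat size_map /= wf addn1 minnn. Qed.

Lemma size_stages : size stages = N.+1.
Proof. by rewrite size_map size_raw_stages. Qed.

Definition chain_p j : nat * nat := if j < N then nth (0, 0) (ch I) j else (0, 0).

Lemma nth_raw j d : j <= N ->
  nth d (raw_stages I) j = ((j < N, chain_p j), (kc I j.+1, map times_of (jl I j.+1))).
Proof.
move=> hj; rewrite (set_nth_default ((false, (0, 0)), (0, [::]))) ?size_raw_stages //.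
rewrite /raw_stages nth_zip; last by rewrite size_map size_cat size_map /= wf addn1.
congr pair.
  rewrite nth_cat size_map -/(ec_n I) /chain_p; case: ltnP => h; first by rewrite (nth_map (0, 0)).
  by rewrite (_ : j - N = 0) //; lia.
rewrite (nth_map (Kept 0)); last by rewrite wf.
by rewrite /kc /jl /edge_of /=; case: (nth _ _ _).
Qed.

Lemma nth_stages j : j <= N -> nth st0 stages j =
  (g (kc I j.+1), (items j.+1, (j < N, (g (chain_p j).1, (g (chain_p j).2, (chain_p j).2))))).
Proof.
move=> hj; rewrite /stages (nth_map ((false, (0, 0)), (0, [::]))) ?size_raw_stages //.
rewrite nth_raw // /round_stage /=; congr (_, (_, _)).
rewrite /items size_map; set L := jl I j.+1; apply: (@eq_from_nth _ (item_of j.+1 0)).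
  by rewrite !size_map size_zip size_iota size_map minnn.
move=> i; rewrite size_map size_zip size_iota size_map minnn => hi.
rewrite (nth_map (0, times_of pj0)); last by rewrite size_zip size_iota size_map minnn.
rewrite (nth_map 0) ?size_iota // nth_zip ?size_iota ?size_map // nth_iota // (nth_map pj0) //.
Qed.

Lemma chain_ps j : j <= N -> ps_of I (CJ j.+1) = (chain_p j).1.
Proof. by move=> hj; rewrite /ps_of /chain_p /=; case: ltnP. Qed.

Lemma chain_pc j : j < N -> pc_of I (CJ j.+1) = (chain_p j).2.
Proof. by move=> hj; rewrite /pc_of /chain_p hj. Qed.

Lemma mem_items j x : x \in items j -> exists2 i, i < size (jl I j) & x = item_of j i.
Proof. by move=> /mapP[i]; rewrite mem_iota => hi ->; exists i. Qed.

Lemma item_mem j i : i < size (jl I j) -> item_of j i \in items j.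
Proof. by move=> hi; apply/mapP; exists i; rewrite // mem_iota. Qed.

Lemma uniq_items j : uniq (map fst (items j)).
Proof. by rewrite /items -map_comp (eq_map (g := id)) ?map_id ?iota_uniq. Qed.

Lemma ptm_item j i s : ptm s (item_of j i).2.1 = g (if s then pc_of I (PJ j i) else ps_of I (PJ j i)).
Proof. by rewrite /ptm /=; case: s; rewrite /t_pc /t_ps /= pjob_ofE. Qed.

(** Regroups the cost by stages, to match [chain_cost]. Source and sink are on the server and
    contribute nothing. *)
Lemma costE side : ~~ side src -> ~~ side (snk I) ->
  cost I side = \sum_(0 <= j < N.+1) (cloud_cost (fun i => side (PJ j.+1 i)) (items j.+1) +
     stage_cost (nth st0 stages j) (side (CJ j.+1))).
Proof.
move=> s0 s1; rewrite /cost /jobs big_cat big_map big_flatten big_map big_split [LHS]addnC.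
congr addn.
  rewrite (iotaDl 1 0) big_map /index_iota subn0; apply: eq_bigr => j _.
  rewrite sub_jobsE big_map /cloud_cost /items big_map; apply: eq_bigr => i _.
  by rewrite /= pjob_ofE.
rewrite -[iota 0 N.+2]/(0 :: iota 1 N.+1) big_cons (negbTE s0) (iotaDl 1 0) big_map /index_iota subn0.
rewrite big_mkcond big_seq [RHS]big_seq; apply: eq_bigr => j; rewrite mem_iota => hj.
rewrite nth_stages; last by lia.
rewrite add1n /stage_cost; case: ifP => // hs.
case: (ltnP j N) => hjN; first by rewrite chain_pc.
by move: s1; rewrite /snk (_ : N = j) ?hs //; lia.
Qed.
End Stages.

Lemma flatten_map_flatten (A B : Type) (f : A -> seq B) (ss : seq (seq A)) :
  flatten [seq f x | x <- flatten ss] = flatten [seq flatten [seq f x | x <- s] | s <- ss].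
Proof. by elim: ss => //= s ss IH; rewrite map_cat flatten_cat IH. Qed.

(** * From solutions of the rounded instance to schedules *)

Section Sound.
Variables (I : ec_instance) (l : seq nat) (U : nat) (D : nat).
Hypothesis wf : ec_wf I.
Hypothesis U0 : 0 < U.
Local Notation ms := (multiples l U).
Local Notation g := (roundup ms).
Local Notation N := (ec_n I).

(** Multiplying by [U] makes each rounded constraint at least as strong as the original one. The cap
    of [roundup] is never reached: every rounded quantity in use is at most a completion time, and
    these lie below [size l]. *)
Lemma schedule_sound y : y \in chain_sols D l (stages I ms) ->
  exists (side : job -> bool) (C : job -> nat),
  [/\ valid I side C, cost I side = y.2.1, C (snk I) = U * y.1.2, y.1.2 < size l &
      forall m, write l (raw_stages I) (m, (U, rev y.2.2)) = enc_schedule I side C].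
Proof.
case: wf => hed hne hy.
have [sd [tm [gs [s0 t0 e1 e2 [e3 hl]]]]] := chain_sound hy.
rewrite (size_stages ms hed) in e1 e2 e3 hl.
(* For an actual job the filter returns exactly one entry, by [block_sound], so the default is not
   met. *)
pose look j i : placed := head (0, (false, 0)) [seq e <- (gs j).2.2 | e.1 == i].
pose side x := match x with CJ k => sd k | PJ j i => (look j.-1 i).2.1 end.
pose C x := match x with CJ k => U * tm k | PJ j i => U * (tm j.-1 + (look j.-1 i).2.2) end.
have blk j : j <= N -> [/\
    forall i, i < size (jl I j.+1) -> [seq e <- (gs j).2.2 | e.1 == i] = [:: (i, (side (PJ j.+1 i), (look j i).2.2))],
    (gs j).2.1 = cloud_cost (fun i => side (PJ j.+1 i)) (items I ms j.+1),
    forall i, i < size (jl I j.+1) -> fits (sd j) (sd j.+1) (gs j).1 (item_of I ms j.+1 i).2.1 (side (PJ j.+1 i)) (look j i).2.2 &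
    forall i i', i < size (jl I j.+1) -> i' < size (jl I j.+1) -> i != i' -> ~~ side (PJ j.+1 i) -> ~~ side (PJ j.+1 i') ->
      (look j i).2.2 + g (ps_of I (PJ j.+1 i')) <= (look j i').2.2 \/
      (look j i').2.2 + g (ps_of I (PJ j.+1 i)) <= (look j i).2.2].
  move=> hj; have [h1 _ _ _ _] := hl _ hj; rewrite (nth_stages ms hed hj) /= in h1.
  have [sb [ct [_ b2 b3 b4 b5]]] := block_sound (uniq_items I ms j.+1) h1.
  have lk i : i < size (jl I j.+1) -> look j i = (i, (sb i, ct i)).
    by move=> hi; rewrite /look (b2 _ (item_mem ms hi)).
  split.
  - by move=> i hi; rewrite (b2 _ (item_mem ms hi)) /side /= lk.
  - rewrite b3; apply: eq_cloud_cost => x /mem_items[i hi ->].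
    by rewrite /side /= lk.
  - by move=> i hi; have := b4 _ (item_mem ms hi); rewrite /side /= lk.
  - move=> i i' hi hi' ne s1 s2; have := b5 _ _ (item_mem ms hi) (item_mem ms hi') ne.
    move: s1 s2; rewrite /side /= !lk //= => s1 s2 /(_ s1 s2).
    by rewrite /t_ps /= !pjob_ofE.
have tmS j : j <= N -> [/\ tm j.+1 = tm j + (gs j).1 + g (ptime I side (CJ j.+1)),
    tm j.+1 < size l, (if sd j == sd j.+1 then 0 else g (kc I j.+1)) <= (gs j).1 & sd j.+1 -> j < N].
  move=> hj; have [_ h2 h3 h4 h5] := hl _ hj; rewrite (nth_stages ms hed hj) /= in h2 h3 h5.
  split=> //; rewrite h3; congr addn; rewrite /stage_time /ptime [side _]/=.
  by case: ifP => hs; [rewrite chain_pc ?h5 | rewrite chain_ps].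
have tmono j j' : j <= j' -> j' <= N.+1 -> tm j <= tm j'.
  elim: j' => [|j' IH] h1 h2; first by rewrite (_ : j = 0) //; lia.
  case: (eqVneq j j'.+1) => [->//|ne].
  by have [h3 _ _ _] := tmS _ h2; apply: leq_trans (IH _ _) _; lia.
have tlt j : j <= N.+1 -> tm j < size l.
  case: j => [|j] hj; last by have [] := tmS _ hj.
  by rewrite t0; have [_ h _ _] := tmS _ (leq0n N); lia.
have ge p : g p < size l -> p <= U * g p by apply: roundup_ge.
have fitR j i : j <= N -> i < size (jl I j.+1) ->
    C (CJ j) + (if sd j == side (PJ j.+1 i) then 0 else pj_cin (nth pj0 (jl I j.+1) i)) +
       ptime I side (PJ j.+1 i) <= C (PJ j.+1 i) /\
    C (PJ j.+1 i) + (if side (PJ j.+1 i) == sd j.+1 then 0 else pj_cout (nth pj0 (jl I j.+1) i)) +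
       ptime I side (CJ j.+1) <= C (CJ j.+1).
  move=> hj hi; have [_ _ b3 _] := blk _ hj; have [f1 f2] := b3 _ hi.
  have [t1 t2 _ _] := tmS _ hj.
  rewrite ptm_item -/(ptime I side (PJ j.+1 i)) in f1.
  set a1 := (if _ then 0 else pj_cin _); set a2 := (if _ then 0 else pj_cout _).
  have f1' : g a1 + g (ptime I side (PJ j.+1 i)) <= (look j i).2.2.
    by move: f1; rewrite /a1 /t_in /=; case: ifP; rewrite ?roundup0.
  have f2' : (look j i).2.2 + g a2 <= (gs j).1.
    by move: f2; rewrite /a2 /t_out /= eq_sym; case: ifP; rewrite ?roundup0.
  have h1 := ge a1; have h2 := ge a2; have h3 := ge (ptime I side (PJ j.+1 i)).
  have h4 := ge (ptime I side (CJ j.+1)).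
  have -> : C (PJ j.+1 i) = U * tm j + U * (look j i).2.2 by rewrite -mulnDr.
  have -> : C (CJ j.+1) = U * tm j.+1 by [].
  have -> : C (CJ j) = U * tm j by [].
  split.
    rewrite -addnA leq_add2l; apply: leq_trans (leq_add (h1 _) (h3 _)) _; [lia|lia|].
    by rewrite -mulnDr leq_mul2l f1' orbT.
  rewrite t1 !mulnDr -!addnA leq_add2l.
  apply: leq_trans (leq_add (leqnn _) (leq_add (h2 _) (h4 _))) _; [lia|lia|].
  by rewrite addnA leq_add2r -mulnDr leq_mul2l f2' orbT.
have keptR j c : j <= N -> edge_of I j.+1 = Kept c ->
    C (CJ j) + (if sd j == sd j.+1 then 0 else c) + ptime I side (CJ j.+1) <= C (CJ j.+1).
  move=> hj he; have [t1 t2 t3 _] := tmS _ hj.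
  rewrite /kc he in t3; set a1 := (if _ then 0 else c).
  have f1 : g a1 <= (gs j).1 by move: t3; rewrite /a1; case: ifP; rewrite ?roundup0.
  have h1 := ge a1; have h4 := ge (ptime I side (CJ j.+1)).
  rewrite /C t1 !mulnDr -!addnA leq_add2l.
  apply: leq_trans (leq_add (h1 _) (h4 _)) _; [lia|lia|].
  by rewrite leq_add2r leq_mul2l f1 orbT.
have stepR j : j <= N -> C (CJ j) + ptime I side (CJ j.+1) <= C (CJ j.+1).
  move=> hj; have [t1 t2 t3 _] := tmS _ hj; have h4 := ge (ptime I side (CJ j.+1)).
  rewrite /C t1 !mulnDr -!addnA leq_add2l.
  by apply: leq_trans (h4 _) (leq_addl _ _); lia.
have CJmono j j' : j <= j' -> j' <= N.+1 -> C (CJ j) <= C (CJ j').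
  by move=> h1 h2; rewrite /C leq_mul2l tmono ?orbT.
(* Chain jobs separate the stages, so two server jobs need a closer look only if they belong to the
   same stage. *)
pose st x := match x with CJ k => k | PJ j _ => j end.
have stle x : x \in jobs I -> st x <= N.+1 /\ C x <= C (CJ (st x)).
  rewrite mem_jobs; case: x => [k|j i] //= /andP[hj hi].
  case: j hj hi => // j hj hi; split; first by lia.
  have hjN : j <= N by lia.
  by have [_ h] := fitR _ _ hjN hi; apply: leq_trans h; rewrite -addnA leq_addr.
have stge x j : x \in jobs I -> st x = j.+1 -> C (CJ j) + ptime I side x <= C x.
  rewrite mem_jobs; case: x => [k|j' i] /=; first by move=> h1 h2; rewrite h2; apply: stepR; lia.
  move=> /andP[hj hi] e; rewrite e in hj hi *.
  have hjN : j <= N by lia.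
  by have [h _] := fitR _ _ hjN hi; apply: leq_trans h; rewrite leq_add2r leq_addr.
exists side, C; split.
- split.
  + by rewrite /= s0.
  + by rewrite /snk /=; apply/negP => /(let: And4 _ _ _ h := tmS _ (leqnn N) in h); rewrite ltnn.
  + move=> x x' hx hx' ne sx sx'.
    have [st1 c1] := stle _ hx; have [st2 c2] := stle _ hx'.
    have lt u v : u \in jobs I -> v \in jobs I -> st u < st v -> C u + ptime I side v <= C v.
      move=> hu hv huv; have [q1 q2] := stle _ hu; have [q3 _] := stle _ hv.
      case ev : (st v) huv q3 => [|j] // huv q3.
      by apply: leq_trans (stge _ _ hv ev); rewrite leq_add2r (leq_trans q2) // CJmono //; lia.
    case: (ltngtP (st x) (st x')) => h; [by left; apply: lt | by right; apply: lt |].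
    move: hx hx' ne sx sx' h {st1 c1 st2 c2}; rewrite !mem_jobs.
    case: x => [k|j i]; case: x' => [k'|j' i'] /=.
    * by move=> _ _ ne _ _ e; rewrite e eqxx in ne.
    * move=> hk /andP[hj hi] _ _ _ e; right; rewrite e.
      case: j' hj hi {e} => // j hj hi.
      have hjN : j <= N by lia.
      by have [_ h] := fitR _ _ hjN hi; apply: leq_trans h; rewrite leq_add2r leq_addr.
    * move=> /andP[hj hi] hk _ _ _ e; left; rewrite -e.
      case: j hj hi {e} => // j hj hi.
      have hjN : j <= N by lia.
      by have [_ h] := fitR _ _ hjN hi; apply: leq_trans h; rewrite leq_add2r leq_addr.
    * move=> /andP[hj hi] /andP[hj' hi'] ne sx sx' e; rewrite -e in hi' hj' sx' ne *.
      case: j hj hi hi' {hj' e} sx sx' ne => // j hj hi hi' sx sx' ne.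
      have hj' : j <= N by lia.
      have [_ _ b3 b4] := blk _ hj'.
      have nei : i != i' by apply: contraNneq ne => ->.
      have gel u : u < size (jl I j.+1) -> ~~ side (PJ j.+1 u) ->
          ptime I side (PJ j.+1 u) <= U * g (ps_of I (PJ j.+1 u)).
        move=> hu su; rewrite /ptime (negbTE su); apply: ge.
        have [f1 f2] := b3 _ hu; rewrite ptm_item (negbTE su) in f1.
        by have [t1 t2 _ _] := tmS _ hj'; lia.
      rewrite /C /=; have [h|h] := b4 _ _ hi hi' nei sx sx'; [left | right].
        apply: leq_trans (leq_add (leqnn _) (gel _ hi' sx')) _.
        by rewrite -mulnDr leq_mul2l; apply/orP; right; lia.
      apply: leq_trans (leq_add (leqnn _) (gel _ hi sx)) _.
      by rewrite -mulnDr leq_mul2l; apply/orP; right; lia.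
  + move=> x x' c /edgesP[j hj [[he [-> ->]]|[i hi [-> -> ->]]|[i hi [-> -> ->]]]].
    * by have := keptR _ _ hj he; rewrite /=; case: ifP; rewrite ?addn0.
    * by have [h _] := fitR _ _ hj hi; move: h; rewrite [side (CJ j)]/=; case: ifP; rewrite ?addn0.
    * by have [_ h] := fitR _ _ hj hi; move: h; rewrite [side (CJ j.+1)]/=; case: ifP; rewrite ?addn0.
- rewrite e3 (costE ms hed).
  + rewrite /chain_cost; apply: eq_big_nat => j hj.
    by have [|_ -> _ _] := blk j; first by lia.
  + by rewrite /= s0.
  + by rewrite /snk /=; apply/negP => /(let: And4 _ _ _ h := tmS _ (leqnn N) in h); rewrite ltnn.
- by rewrite e1.
- by rewrite e1 tlt.
move=> m; rewrite /write e2 revK /enc_schedule /jobs.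
have scE c : c < size l -> scale l U c = U * c.
  by move=> hc; rewrite scaleE (minn_idPl _) // ltnW.
rewrite map_cat flatten_cat catA; congr cat.
  rewrite [RHS](_ : flatten _ = [:: nat_of_bool (sd 0); U * tm 0] ++
    flatten [seq [:: nat_of_bool (side x); C x] | x <- [seq CJ k | k <- iota 1 N.+1]]) //.
  rewrite s0 t0 muln0; congr (_ ++ flatten _).
  rewrite (iotaDl 1 0) -!map_comp; apply/eq_in_map => j; rewrite mem_iota => hj /=.
  by rewrite add1n scE // tlt //; lia.
rewrite flatten_map_flatten; congr flatten.
have -> : raw_stages I = [seq nth ((false, (0, 0)), (0, [::])) (raw_stages I) j | j <- iota 0 N.+1].
  by rewrite -(size_raw_stages hed) map_nth_iota0 // take_size.
rewrite zip_map (iotaDl 1 0) -!map_comp; apply/eq_in_map => j; rewrite mem_iota => hj.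
have {}hj : j <= N by lia.
rewrite /= add1n nth_raw //= size_map sub_jobsE -map_comp; congr flatten.
apply/eq_in_map => i; rewrite mem_iota => hi /=.
have {}hi : i < size (jl I j.+1) by lia.
have [b1 _ b3 _] := blk _ hj; rewrite b1 //= scE //.
have [f1 f2] := b3 _ hi; have [t1 t2 _ _] := tmS _ hj.
by apply: leq_ltn_trans t2; rewrite t1; lia.
Qed.
End Sound.

(** * Rounding a schedule *)

Definition rvalid (I : ec_instance) (g : nat -> nat) (side : job -> bool) (C : job -> nat) : Prop :=
  [/\ ~~ side src, ~~ side (snk I),
      (forall x y, x \in jobs I -> y \in jobs I -> x != y -> ~~ side x -> ~~ side y ->
         C x + g (ptime I side y) <= C y \/ C y + g (ptime I side x) <= C x) &
      (forall x y c, (x, y, c) \in edges I ->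
         C x + (if side x == side y then 0 else g c) + g (ptime I side y) <= C y)].

Section Complete.
Variables (I : ec_instance) (l : seq nat) (U : nat) (cmax : nat).
Hypothesis wf : ec_wf I.
Hypothesis cond : ec_conditions cmax I.
Hypothesis U0 : 0 < U.
Local Notation ms := (multiples l U).
Local Notation g := (roundup ms).
Local Notation N := (ec_n I).
Local Notation D := cmax.+1.

(** Each condition survives rounding, as [roundup] is monotone and never exceeds its argument. [D]
    is [cmax.+1] so that the two slots for the first condition exist even if [cmax] is 0. *)
Lemma phased_items j a b T sd z : j <= N ->
  (forall x : item, x \in items I ms j.+1 -> fits a b T x.2.1 (sd x.1) (z x.1)) ->
  disjoint_on sd z (items I ms j.+1) ->
  phased D a (items I ms j.+1) T sd z.
Proof.
move=> hj hfit hd; have us := uniq_items I ms j.+1.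
case E : (edge_of I j.+1) => [c|ls].
  by apply: (@phased_const D a b _ T sd z us hfit 0) => x; rewrite /items /jl E.
have jlE : jl I j.+1 = ls by rewrite /jl E.
have lmem i : i < size ls -> nth pj0 ls i \in ls by apply: mem_nth.
have hjr : 0 < j.+1 <= N.+1 by lia.
have [h|[h|h]] := cond hjr E; last 1 first.
- pose r0 := if a then g (pj_cin (nth pj0 ls 0)) else 0.
  apply: (@phased_const D a b _ T sd z us hfit r0) => x /mem_items[i]; rewrite jlE => hi -> _.
  rewrite /release /r0 /=; case: (a) => //; rewrite /t_in /= jlE; congr (g _).
  by apply: h; apply: lmem => //; lia.
- apply: (@phased_first D a b _ T sd z us hfit hd) => // x y /mem_items[i]; rewrite jlE => hi -> /mem_items[i']; rewrite jlE => hi' ->.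
  rewrite /release /t_in /t_ps /= jlE; case: (a) => //; apply: roundup_mono => //.
  have := h _ _ (lmem _ hi) (lmem _ hi'); rewrite geq_max !leq_min => /andP[/andP[+ _] _]; exact.
- apply: (@phased_small D a b _ T sd z us hfit hd) => x /mem_items[i]; rewrite jlE => hi ->.
  rewrite /release /t_in /= jlE; case: (a) => //; apply: leq_trans (roundup_le _ U0 _) _.
  have [+ _] := h _ (lmem _ hi); exact: leqW.
Qed.

(** Times are taken relative to [C src], since the given schedule may start late whereas the program
    starts at 0. *)
Lemma schedule_complete side C : rvalid I g side C -> C (snk I) - C src < size l ->
  exists2 y, y \in chain_sols D l (stages I ms) &
    y.1 = (false, C (snk I) - C src) /\ y.2.1 <= cost I side.
Proof.
case: wf => hed hne [v1 v2 v3 v4] hT.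
have step j : j <= N -> C (CJ j) + (if side (CJ j) == side (CJ j.+1) then 0 else g (kc I j.+1)) +
    g (ptime I side (CJ j.+1)) <= C (CJ j.+1).
  move=> hj; rewrite /kc; case E : (edge_of I j.+1) => [c|ls].
    exact: v4 (edge_kept hj E).
  rewrite roundup0 // if_same addn0.
  (* A parallel subgraph is nonempty, and any of its jobs links the two chain jobs. *)
  have h0 : 0 < size (jl I j.+1).
    rewrite /jl E; case: ls E => // E; exfalso; apply: (hne j.+1) => //; lia.
  have [q1 q2] := edge_par hj h0; have := v4 _ _ _ q1; have := v4 _ _ _ q2; lia.
have mono j j' : j <= j' -> j' <= N.+1 -> C (CJ j) <= C (CJ j').
  elim: j' => [|j' IH] h1 h2; first by rewrite (_ : j = 0) //; lia.
  case: (eqVneq j j'.+1) => [->//|ne].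
  by have := step _ h2; have := IH _ (ltnW h2); lia.
pose tm j := C (CJ j) - C src.
(* The span, from the completion of one chain job to the start of the next. *)
pose T j := C (CJ j.+1) - g (ptime I side (CJ j.+1)) - C (CJ j).
have tmlt j : j <= N.+1 -> tm j < size l.
  move=> hj; apply: leq_ltn_trans hT; rewrite /tm /snk leq_sub2r //; exact: mono.
have tmE j : j <= N -> tm j.+1 = tm j + T j + g (ptime I side (CJ j.+1)).
  move=> hj; have := step _ hj; have := mono 0 j (leq0n _) (leqW hj); rewrite /tm /T /src; lia.
pose gam j := cloud_cost (fun i => side (PJ j.+1 i)) (items I ms j.+1).
have blk j : j <= N -> exists2 y, y \in block_sols D l (side (CJ j)) (side (CJ j.+1)) (items I ms j.+1) &
    y.1 = T j /\ y.2.1 <= gam j.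
  move=> hj; pose z i := C (PJ j.+1 i) - C (CJ j); pose sd i := side (PJ j.+1 i).
  have epar i : i < size (jl I j.+1) -> _ := fun hi => edge_par hj hi.
  have hfit (x : item) : x \in items I ms j.+1 ->
      fits (side (CJ j)) (side (CJ j.+1)) (T j) x.2.1 (sd x.1) (z x.1).
    move=> /mem_items[i hi ->]; have [q1 q2] := epar _ hi.
    have hp : ptm (sd i) (item_of I ms j.+1 i).2.1 = g (ptime I side (PJ j.+1 i)) := ptm_item _ _ _ _ _.
    have := v4 _ _ _ q1; have := v4 _ _ _ q2; have := step _ hj.
    rewrite /fits hp /t_in /t_out /= -/(sd i) /z /T.
    move: (g (ptime I side (PJ j.+1 i))) => p; move: (g (ptime I side (CJ j.+1))) => p'.
    move: (g (pj_cin _)) => c1; move: (g (pj_cout _)) => c2.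
    rewrite [side (CJ j.+1) == sd i]eq_sym; do !case: ifP => _; move=> *; split; lia.
  have hd : disjoint_on sd z (items I ms j.+1).
    move=> x y /mem_items[i hi ->] /mem_items[i' hi' ->] /= ne si si'.
    have [q1 _] := epar _ hi; have [q1' _] := epar _ hi'.
    have w1 := v4 _ _ _ q1; have w2 := v4 _ _ _ q1'.
    have nj : PJ j.+1 i != PJ j.+1 i' by apply: contraNneq ne => -[->].
    have hp k : ~~ side (PJ j.+1 k) -> t_ps (item_of I ms j.+1 k).2.1 = g (ptime I side (PJ j.+1 k)).
      by move=> hk; rewrite /ptime (negbTE hk) /t_ps /= pjob_ofE.
    have in1 k : k < size (jl I j.+1) -> PJ j.+1 k \in jobs I by move=> hk; rewrite mem_jobs hk; lia.
    have [h|h] := v3 _ _ (in1 _ hi) (in1 _ hi') nj si si'; [left|right]; rewrite hp // /z; lia.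
  have [gm [phi [p1 p2 p3]]] := phased_items hj hfit hd.
  have hTj : T j < size l.
    by apply: leq_ltn_trans (tmlt j.+1 hj); rewrite tmE //; lia.
  exact: (block_complete (uniq_items I ms j.+1) hTj p1 p2 hfit hd p3).
pose gs j := nth (0, (0, [::])) [seq y <- block_sols D l (side (CJ j)) (side (CJ j.+1)) (items I ms j.+1) |
   (y.1 == T j) && (y.2.1 <= gam j)] 0.
have gsP j : j <= N -> [/\ gs j \in block_sols D l (side (CJ j)) (side (CJ j.+1)) (items I ms j.+1),
    (gs j).1 = T j & (gs j).2.1 <= gam j].
  move=> hj; have [y hy [y1 y2]] := blk _ hj.
  have : gs j \in [seq y <- block_sols D l (side (CJ j)) (side (CJ j.+1)) (items I ms j.+1) |
     (y.1 == T j) && (y.2.1 <= gam j)].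
    apply: mem_nth; rewrite size_filter -has_count; apply/hasP; exists y => //.
    by rewrite y1 eqxx y2.
  by rewrite mem_filter => /andP[/andP[/eqP h1 h2] h3].
have [|||y hy [y1 y2]] := @chain_complete D l (stages I ms) (fun j => side (CJ j)) tm gs gam.
- exact: negbTE v1.
- by rewrite /tm subnn.
- move=> j; rewrite size_stages // ltnS => hj; have [q1 q2 q3] := gsP _ hj; split=> //.
  rewrite nth_stages //; split=> //=.
  + by rewrite q2 /T; have := step _ hj; lia.
  + rewrite tmE // q2; congr addn; rewrite /stage_time /ptime.
    case: ifP => hs; last by rewrite chain_ps.
    rewrite chain_pc // ltn_neqAle hj andbT; apply: contraTneq hs => ->.
    exact: v2.
  + exact: tmlt.
  + move=> hs; rewrite ltn_neqAle hj andbT; apply: contraTneq hs => ->; exact: v2.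
rewrite size_stages // in y1 y2.
exists y => //; split; first by rewrite y1 (negbTE (v2 : ~~ side (CJ N.+1))).
by rewrite (costE ms hed).
Qed.
End Complete.

(** Used with weight 1 for ranks and with the server times for the sequential schedule. *)
Lemma key_sum (T : eqType) (s : seq T) (key F : T -> nat) x y : x \in s -> key x < key y ->
  \sum_(z <- s | key z < key x) F z + F x <= \sum_(z <- s | key z < key y) F z.
Proof.
move=> xs h; rewrite big_mkcond [leqRHS]big_mkcond (big_rem x xs) [leqRHS](big_rem x xs) /=.
rewrite ltnn h add0n addnC leq_add2l; apply: leq_sum => z _.
by case: ltnP => // h'; rewrite (ltn_trans h' h).
Qed.

(** Increases along every edge: the jobs replacing edge [(j - 1, j)] get the odd number between
    those of the two chain jobs. *)
Definition topo (x : job) : nat := match x with CJ k => k.*2 | PJ j _ => j.*2.-1 end.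

Lemma topo_lt I x : x \in jobs I -> topo x < (ec_n I).+2.*2.
Proof. by rewrite mem_jobs; case: x => [k|j i] /=; lia. Qed.

Lemma edge_jobs I x y c : (x, y, c) \in edges I ->
  [/\ x \in jobs I, y \in jobs I & topo x < topo y].
Proof.
move=> /edgesP[j hj [[_ [-> ->]]|[i hi [-> -> _]]|[i hi [-> -> _]]]];
  by rewrite !mem_jobs ?hi /topo; split; lia.
Qed.

Section Round.
Variables (I : ec_instance) (l : seq nat) (U : nat) (side : job -> bool) (C : job -> nat).
Hypothesis U0 : 0 < U.
Hypothesis v : valid I side C.
Local Notation g := (roundup (multiples l U)).
Local Notation p := (ptime I side).

(* At equal completion times, jobs of length 0 come last: this keeps the order
   on the server, and the topological index settles the remaining ties along edges. *)
Definition time_key x := ((C x).*2 + (p x == 0)) * (ec_n I).+2.*2 + topo x.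

Definition rank x := \sum_(z <- jobs I | time_key z < time_key x) 1.

Definition spread x := C x %/ U + (rank x).*2.

Lemma time_key_lt x y : x \in jobs I -> y \in jobs I ->
  time_key x < time_key y = (C x < C y) || (C x == C y) && (((p x == 0) < (p y == 0)) ||
     ((p x == 0) == (p y == 0)) && (topo x < topo y)).
Proof.
move=> /topo_lt hx /topo_lt hy; rewrite /time_key; move: (ec_n I).+2.*2 hx hy => M hx hy.
have aux a b : a < b -> a * M + topo x < b * M + topo y.
  by move=> h; have : a.+1 * M <= b * M; [rewrite leq_mul2r h orbT | rewrite mulSn; lia].
have aux' a b : b < a -> (a * M + topo x < b * M + topo y) = false.
  by move=> h; have : b.+1 * M <= a * M; [rewrite leq_mul2r h orbT | rewrite mulSn; lia].
case: (ltngtP (C x) (C y)) => [h|h|->] /=; first by apply: aux; lia.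
  by apply: aux'; lia.
by case: (p x == 0); case: (p y == 0) => /=; rewrite ?ltn_add2l //; [apply: aux' | apply: aux]; lia.
Qed.

(** The ranks differ by at least one, which contributes the 2, and rounding down is superadditive,
    which contributes [n %/ U]. *)
Lemma spread_lt x y n m : x \in jobs I -> time_key x < time_key y ->
  C x + n <= C y -> m <= n %/ U + 2 -> spread x + m <= spread y.
Proof.
move=> xj h hn hm; have := key_sum (fun=> 1) xj h; rewrite -/(rank x) -/(rank y) /spread => hr.
have : (C x + n) %/ U <= C y %/ U by apply: leq_div2r.
have : C x %/ U + n %/ U <= (C x + n) %/ U.
  by rewrite leq_divRL // mulnDl leq_add // leq_trunc_div.
lia.
Qed.

Lemma spread_rvalid : rvalid I g side spread.
Proof.
case: v => v1 v2 v3 v4; split=> //.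
- move=> x y xj yj ne sx sy.
  have key_le a b : a \in jobs I -> b \in jobs I -> time_key a < time_key b ->
      C a + p b <= C b \/ C b + p a <= C a -> spread a + g (p b) <= spread b.
    move=> aj bj h hab; apply: (spread_lt (n := p b)) => //; last first.
      by have := roundup_lt l U0 (p b); lia.
    by move: h; rewrite time_key_lt //; lia.
  have hxy := v3 _ _ xj yj ne sx sy.
  case: (ltngtP (time_key x) (time_key y)) => h.
  + by left; apply: key_le.
  + by right; apply: key_le => //; case: hxy; [right|left].
  + have e1 : time_key x < time_key y = false by lia.
    have e2 : time_key y < time_key x = false by lia.
    rewrite time_key_lt // in e1; rewrite time_key_lt // in e2.
    (* Equal keys mean equal completion times and equal zero flags, so disjointness leaves only two
       jobs of length 0, for which either order will do. *)
    have [px py] : p x = 0 /\ p y = 0 by lia.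
    by rewrite px py roundup0 // /spread; lia.
- move=> x y c he; have [xj yj ht] := edge_jobs he; have := v4 _ _ _ he => hC.
  rewrite -addnA; apply: (spread_lt (n := (if side x == side y then 0 else c) + p y)) => //.
  + by rewrite time_key_lt //; move: hC; case: ifP => _; lia.
  + by move: hC; case: ifP => _; lia.
  + have := roundup_lt l U0 (p y); have := roundup_lt l U0 c.
    have : c %/ U + p y %/ U <= (c + p y) %/ U.
      by rewrite leq_divRL // mulnDl leq_add // leq_trunc_div.
    by case: ifP => _; lia.
Qed.

Lemma spread_le x : spread x <= C x %/ U + (size (jobs I)).*2.
Proof.
rewrite leq_add2l leq_double /rank -sum1_size big_mkcond.
by apply: leq_sum => z _; case: ifP.
Qed.

(** For short schedules the unit is 1, and [C] itself is kept without the loss of [spread]. *)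
Lemma valid_rvalid : rvalid I g side C.
Proof.
case: v => v1 v2 v3 v4; split=> //.
- move=> x y xj yj ne sx sy; have := roundup_le l U0 (p x); have := roundup_le l U0 (p y).
  by have := v3 _ _ xj yj ne sx sy; lia.
- move=> x y c he; have := v4 _ _ _ he; have := roundup_le l U0 (p y); have := roundup_le l U0 c.
  by case: ifP; lia.
Qed.
End Round.

(** * The schedule that runs everything on the server *)

Section AllServer.
Variable I : ec_instance.

(** Lexicographic in the topological index and the position in the list, so it separates any two
    jobs. *)
Definition list_key x := topo x * size (jobs I) + index x (jobs I).

(** Feasible for every budget and no longer than the sum of the input; this places the optimum in
    the range covered by the units that are tried. *)
Definition sequential x := \sum_(z <- jobs I | list_key z < list_key x) ps_of I z + ps_of I x.

Lemma sequential_lt x y : x \in jobs I -> list_key x < list_key y ->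
  sequential x + ps_of I y <= sequential y.
Proof. by move=> xj h; rewrite leq_add2r; apply: key_sum. Qed.

Lemma sequential_valid : valid I (fun=> false) sequential.
Proof.
split=> // [x y xj yj ne _ _|x y c he].
- rewrite /ptime; case: (ltngtP (list_key x) (list_key y)) => h.
  + by left; apply: sequential_lt.
  + by right; apply: sequential_lt.
  + exfalso; case/negP: ne; apply/eqP.
    have e : index x (jobs I) = index y (jobs I).
      have hx : index x (jobs I) < size (jobs I) by rewrite index_mem.
      have hy : index y (jobs I) < size (jobs I) by rewrite index_mem.
      by have := congr1 (modn^~ (size (jobs I))) h; rewrite !modnMDl !modn_small.
    by rewrite -(nth_index x xj) e nth_index.
- have [xj yj ht] := edge_jobs he; rewrite eqxx; apply: sequential_lt => //.
  have hx : index x (jobs I) < size (jobs I) by rewrite index_mem.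
  apply: (@leq_trans ((topo x).+1 * size (jobs I))); first by rewrite /list_key mulSn; lia.
  by apply: leq_trans (leq_addr _ _); rewrite leq_mul2r ht orbT.
Qed.

Lemma sequential_cost : cost I (fun=> false) = 0.
Proof. by rewrite /cost big_pred0. Qed.

Lemma sum_jobs (F : job -> nat) : \sum_(x <- jobs I) F x =
  \sum_(0 <= k < (ec_n I).+2) F (CJ k) +
  \sum_(0 <= j < (ec_n I).+1) \sum_(0 <= i < size (jl I j.+1)) F (PJ j.+1 i).
Proof.
rewrite /jobs big_cat big_map big_flatten big_map (iotaDl 1 0) big_map /index_iota !subn0.
congr addn; apply: eq_bigr => j _; by rewrite sub_jobsE big_map subn0.
Qed.

Hypothesis wf : size (ed I) = (ec_n I).+1.

(** Lets the horizon and the length of the output be measured by the number of tokens. *)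
Lemma size_jobs_enc b k : size (jobs I) <= size (enc_input I b k).
Proof.
rewrite -sum1_size sum_jobs sum_nat_const_nat muln1 subn0 /enc_input /enc_instance /=.
rewrite size_cat !size_flatten /shape -!map_comp !sumnE !big_map.
have -> : \sum_(x <- ch I) size [:: x.1; x.2] = 2 * ec_n I.
  by rewrite /= big_const_seq count_predT iter_addn_0.
rewrite -wf; have : \sum_(0 <= j < size (ed I)) \sum_(0 <= i < size (jl I j.+1)) 1 <=
   \sum_(e <- ed I) size (enc_edge e).
  rewrite [leqRHS](big_nth (Kept 0)); apply: leq_sum => j _.
  rewrite sum_nat_const_nat muln1 subn0 /jl /edge_of /=; case: (nth _ _ _) => //= ls.
  by rewrite size_flatten /shape -map_comp sumnE big_map /= big_const_seq count_predT iter_addn_0; lia.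
move=> h; rewrite [X in _ <= (_ + X).+3](_ : _ = \sum_(e <- ed I) size (enc_edge e)) //; move: wf; lia.
Qed.

Lemma sum_ps_enc b k : \sum_(x <- jobs I) ps_of I x <= sumn (enc_input I b k).
Proof.
rewrite sum_jobs big_nat_recr // big_nat_recl //= /enc_instance /=.
rewrite sumn_cat !sumn_flatten !sumnE !big_map.
have h1 : \sum_(0 <= k0 < ec_n I) (if 0 < k0.+1 <= ec_n I then (nth (0, 0) (ch I) k0).1 else 0) <= \sum_(x <- ch I) sumn [:: x.1; x.2].
  rewrite [leqRHS](big_nth (0, 0)); apply: leq_sum => j _; case: ifP => //= _; lia.
have h2 : \sum_(0 <= j < (ec_n I).+1) \sum_(0 <= i < size (jl I j.+1)) pj_ps (pjob_of I j.+1 i) <=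
   \sum_(e <- ed I) sumn (enc_edge e).
  rewrite -wf [leqRHS](big_nth (Kept 0)); apply: leq_sum => j _.
  under eq_bigr => i _ do rewrite pjob_ofE.
  rewrite /jl /edge_of /=; case: (nth _ _ _) => /= [c|ls]; first by rewrite big_geq.
  rewrite sumn_flatten sumnE !big_map (big_nth pj0).
  have : \sum_(0 <= i < size ls) pj_ps (nth pj0 ls i) <= \sum_(0 <= i < size ls) sumn (enc_pjob (nth pj0 ls i)).
    by apply: leq_sum => i _ /=; lia.
  lia.
rewrite ltnn add0n addn0; do 3 apply: leq_trans _ (leq_addl _ _); exact: leq_add h1 h2.
Qed.

Lemma sequential_makespan b k : sequential (snk I) <= sumn (enc_input I b k).
Proof.
apply: leq_trans (sum_ps_enc b k); rewrite /sequential (_ : ps_of I (snk I) = 0) ?addn0.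
  by rewrite big_mkcond; apply: leq_sum => z _; case: ifP.
by rewrite /= ltnn.
Qed.
End AllServer.

(** * The approximation guarantee *)

Lemma keep_best_correct (s : seq (nat * (nat * seq stage_sol))) : s != [::] ->
  exists2 c, foldl keep_best [::] s = [:: c] & c \in s /\ forall d, d \in s -> c.1 <= d.1.
Proof.
elim/last_ind: s => // s d IH _; rewrite -cats1 foldl_cat /=.
have [->|ne] := eqVneq s [::].
  by exists d => //; split=> [|d']; rewrite inE // => /eqP ->.
have [c -> [cs hc]] := IH ne; rewrite /keep_best /= andbT.
case: ltnP => h; [exists d | exists c] => //; rewrite mem_cat ?inE ?eqxx ?orbT ?cs; split=> // e;
  rewrite mem_cat inE => /orP[/hc|/eqP ->] //; exact: leq_trans (ltnW h).
Qed.

Section Approximation.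
Variables (I : ec_instance) (b k cmax : nat) (z : seq nat).
Hypothesis wf : ec_wf I.
Hypothesis cond : ec_conditions cmax I.
Hypothesis k_gt0 : 0 < k.
Local Notation x := (enc_input I b k).
Local Notation l := (horizon (nseq k 0) (x ++ z)).
Local Notation us := (powers_upto (sumn x)).
Local Notation J := (size (jobs I)).

Definition all_candidates :=
  flatten [seq candidates cmax.+1 l b (raw_stages I) U | U <- us].

Lemma horizon_lb : 6 * k * J < size l.
Proof.
rewrite size_horizon ltnS leq_mul2l size_cat; apply/orP; right.
exact: leq_trans (size_jobs_enc wf.1 b k) (leq_addr _ _).
Qed.

Lemma candidate_sound c : c \in all_candidates ->
  exists side C, [/\ valid I side C, cost I side <= b, c.1 = C (snk I) &
    write l (raw_stages I) c = enc_schedule I side C].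
Proof.
move=> /flattenP[t /mapP[U hU ->]] /mapP[y]; rewrite mem_filter => /andP[/andP[hb _] hy] ->.
have U0 : 0 < U by move: hU; rewrite mem_rev => /mapP[n _ ->]; rewrite expn_gt0.
have [side [C [h1 h2 h3 h4 h5]]] := schedule_sound wf U0 hy.
exists side, C; split; rewrite ?h2 ?h5 //=.
by rewrite scaleE (minn_idPl _) 1?ltnW.
Qed.

Lemma candidate_complete U side C : U \in us -> rvalid I (roundup (multiples l U)) side C ->
  cost I side <= b -> C (snk I) < size l ->
  exists2 c, c \in all_candidates & c.1 <= U * C (snk I).
Proof.
move=> hU hv hc hT.
have U0 : 0 < U by move: hU; rewrite mem_rev => /mapP[n _ ->]; rewrite expn_gt0.
have [|y hy [y1 y2]] := schedule_complete wf cond U0 hv; first exact: leq_ltn_trans (leq_subr _ _) hT.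
exists (scale l U y.1.2, (U, rev y.2.2)).
  apply/flattenP; exists (candidates cmax.+1 l b (raw_stages I) U); first exact: map_f.
  apply/mapP; exists y => //; rewrite mem_filter hy y1 (leq_trans y2 hc) //.
by rewrite scaleE y1 /= leq_mul2l (leq_trans (geq_minl _ _)) ?leq_subr ?orbT.
Qed.

Lemma approximation_bounded side C : valid I side C -> cost I side <= b -> C (snk I) <= sumn x ->
  exists2 c, c \in all_candidates & k * c.1 <= k.+1 * C (snk I).
Proof.
move=> hv hc; set T := C (snk I) => hT; have hl := horizon_lb.
have J0 : 0 < J by apply: (@leq_trans 1) => //; rewrite -has_predT; apply/hasP; exists src; rewrite ?mem_jobs.
have us_mem n : n <= trunc_log 2 (sumn x) -> 2 ^ n \in us.
  by move=> hn; rewrite mem_rev; apply: map_f; rewrite mem_iota; lia.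
case: (ltnP T (4 * J * k)) => hTk.
  have hTl : T < size l by apply: leq_ltn_trans hl; nia.
  have [c h1 h2] := candidate_complete (us_mem 0 (leq0n _)) (valid_rvalid l (ltn0Sn 0) hv) hc hTl.
  by exists c => //; move: h2; rewrite -/T; nia.
(* With [U] the largest power of two up to [q], both bounds on [T] come from [trunc_log_bounds]. *)
pose q := T %/ (2 * J * k).
have M0 : 0 < 2 * J * k by rewrite !muln_gt0 J0.
have q0 : 0 < q by rewrite divn_gt0 //; lia.
have /andP[b1 b2] := trunc_log_bounds (ltnSn 1) q0; set n := trunc_log 2 q in b1 b2.
set U := 2 ^ n in b1; rewrite expnS -/U in b2.
have U0 : 0 < U by rewrite expn_gt0.
(* The unit is among those tried because [q <= T <= sumn x]. *)
have hU : U \in us by apply: us_mem; apply: leq_trunc_log; apply: leq_trans hT; apply: leq_div.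
rewrite leq_divRL // in b1; rewrite ltn_divLR // in b2.
have hs := spread_le I U side C (snk I) : spread I U side C (snk I) <= T %/ U + J.*2.
have hq : T %/ U < 4 * J * k by rewrite ltn_divLR //; lia.
have [|c h1 h2] := candidate_complete hU (spread_rvalid l U0 hv) hc.
  by apply: leq_ltn_trans hl; apply: leq_trans hs _; nia.
exists c => //; have hd : T %/ U * U <= T := leq_trunc_div _ _.
apply: (@leq_trans (k * (U * (T %/ U + J.*2)))); last by nia.
by rewrite leq_mul2l (leq_trans h2) ?orbT // leq_mul2l hs orbT.
Qed.

(** A schedule longer than the sum of the input is no better than the sequential one, which is used
    in its place. *)
Lemma approximation side C : valid I side C -> cost I side <= b ->
  exists2 c, c \in all_candidates & k * c.1 <= k.+1 * C (snk I).
Proof.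
move=> hv hc; case: (leqP (C (snk I)) (sumn x)) => h; first exact: approximation_bounded hv hc h.
have hm := sequential_makespan wf.1 b k.
have [|c h1 h2] := approximation_bounded (sequential_valid I) _ hm; first by rewrite sequential_cost.
by exists c => //; apply: leq_trans h2 _; rewrite leq_mul2l (leq_trans hm) ?orbT // ltnW.
Qed.

Lemma schedule_correct : exists side C,
  [/\ valid I side C, cost I side <= b,
      schedule cmax.+1 ((nseq k 0, us), x ++ z) = enc_schedule I side C &
      forall side' C', valid I side' C' -> cost I side' <= b ->
        k * makespan I C <= k.+1 * makespan I C'].
Proof.
(* Completeness for the sequential schedule provides a candidate, whatever the budget. *)
have ne : all_candidates != [::].
  have [|c + _] := approximation (sequential_valid I); first by rewrite sequential_cost.
  by case: all_candidates.
have [c cE [hc hmin]] := keep_best_correct ne.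
have [side [C [h1 h2 h3 h4]]] := candidate_sound hc.
exists side, C; split=> //.
  rewrite /schedule /= parse_correct; last exact: wf.1.
  by rewrite -/all_candidates cE /= cats0.
move=> side' C' h5 h6; have [d hd h7] := approximation h5 h6.
by apply: leq_trans h7; rewrite /makespan -h3 leq_mul2l hmin ?orbT.
Qed.
End Approximation.

Definition pad m0 (x : seq nat) := nseq ((2 ^ m0 * size x).-1 - size x) 0.

Definition machine_input m0 x : (seq nat * seq nat) * seq nat :=
  ((nseq (head 0 x) 0, powers_upto (sumn x)), x ++ pad m0 x).

Lemma enc_machine_input m0 x :
  enc (machine_input m0 x) = in_value (head 0 x) (sumn x) (padded m0 x).
Proof. by rewrite /enc /= /enc_prod /= /enc /enc_seq /in_value map_nseq. Qed.

Lemma sz_seq_nat (s : seq nat) : sz s = (size s).*2.+1.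
Proof. by elim: s => // a s IH; rewrite sz_cons IH (_ : sz a = 1) //=; lia. Qed.

(** All three parts are linear: the unary accuracy in [head 0 x], the powers of two in the bit
    length, the padded tokens in [2 ^ m0 * size x]. *)
Lemma sz_machine_input m0 x :
  (sz (machine_input m0 x)).+2 <= (20 + 4 * 2 ^ m0) * (input_size x + head 0 x).+1.
Proof.
rewrite /machine_input /sz /= -!/(sz _).
have := size_input_size x; have := sumn_input_size x; set S := input_size x => hs hx.
have hu : size (powers_upto (sumn x)) <= S.+1.
  rewrite size_rev size_map size_iota ltnS; case: (posnP (sumn x)) => [-> //|h0].
  have /andP[b1 _] := trunc_log_bounds (ltnSn 1) h0.
  by rewrite -(leq_exp2l (m := 2)) // (leq_trans b1) // ltnW.
rewrite !sz_seq_nat size_nseq size_cat size_nseq.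
have : 2 ^ m0 * size x <= 2 ^ m0 * S by rewrite leq_mul2l hx orbT.
move: (2 ^ m0) hu => M hu; nia.
Qed.

Theorem theorem6 :
  forall cmax : nat,
  exists (P : program) (a d : nat),
  forall (I : ec_instance) (b k : nat),
    ec_wf I -> 0 < k -> ec_conditions cmax I ->
    exists out : seq nat,
      computes_within P (enc_input I b k)
        (a * (input_size (enc_input I b k) + k).+1 ^ d) out /\
      exists (side : job -> bool) (C : job -> nat),
        [/\ valid I side C, cost I side <= b, out = enc_schedule I side C &
            forall (side' : job -> bool) (C' : job -> nat),
              valid I side' C' -> cost I side' <= b ->
              k * makespan I C <= k.+1 * makespan I C'].
Proof.
move=> cmax; have [t [N [[e hN] _ ht]]] := PT_schedule cmax.+1.
have [P [m0 [c [m0_gt0 hP]]]] := machine_correct t.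
pose W := 20 + 4 * 2 ^ m0.
(* The exponent [e] bounds the evaluation of the term, one more power absorbs the linear summands,
   and the square comes from [machine_correct]. *)
exists P, (c * (W + W ^ e) ^ 2), (e.+1 * 2) => I b k wf k0 cond.
set x := enc_input I b k.
have [side [C [h1 h2 h3 h4]]] := schedule_correct b (pad m0 x) wf cond k0.
exists (enc_schedule I side C); split; last by exists side, C.
have [n hn hev] := ht (machine_input m0 x).
(* The source is listed first and is on the server, so the output starts with 0, as
   [machine_correct] requires. *)
have [ys hys] : exists ys, enc_schedule I side C = 0 :: ys.
  by case: h1 => s0 _ _ _; eexists; rewrite /enc_schedule /jobs /= -/src (negbTE s0).
have hsz : size (enc_schedule I side C) <= (size x).*2.
  apply: leq_trans (_ : (size (jobs I)).*2 <= _); last by rewrite leq_double size_jobs_enc //; case: wf.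
  by rewrite /enc_schedule; elim: (jobs I) => //= j s IH; lia.
rewrite enc_machine_input [schedule _ _]h3 hys in hev; rewrite hys in hsz *.
have [n' [q1 q2 q3]] := hP x ys n k0 hsz hev; exists n'; split=> //.
apply: leq_trans q2 _; rewrite -mulnA leq_mul2l expnM -expnMn leq_exp2r //; apply/orP; right.
set M := (input_size x + k).+1.
have hM : (sz (machine_input m0 x)).+2 <= W * M := sz_machine_input m0 x.
have hNM : n <= W ^ e * M ^ e.
  rewrite -expnMn; apply: leq_trans hn _; apply: leq_trans (hN _) _.
  by case: (e) => // e'; rewrite leq_exp2r.
rewrite expnS.
have Me : 0 < M ^ e by rewrite expn_gt0.
have : (input_size x + head 0 x).+1 <= W * M by rewrite /W /=; nia.
have hWe : W ^ e * M ^ e <= W ^ e * (M * M ^ e) by rewrite leq_mul2l leq_pmull ?orbT.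
have : M <= M * M ^ e by rewrite leq_pmulr.
have : W * M <= W * (M * M ^ e) by rewrite leq_mul2l leq_pmulr ?orbT.
by rewrite mulnDl; lia.
Qed.
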